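(* Let $\tau\ge1$, $\widetilde T=(t_1,\dots,t_\tau)$, and let $f$ belong to the kernel of $\Delta_T:\mathcal S^2_T(\Omega_D,A)\to\mathcal S^0_T(\Omega_D,A)$. (1) If $t_1-t_0$ is even, then for every $n\in\mathbb N$ there is a unique $f^{[n]}\in\mathcal S^\omega_T(\Omega_D,A)$ with $\Delta_{\widetilde T}^nf=f^{[n]}\prod_{\ell=1}^n(t_1-t_0-2\ell+1)$. (2) If $t_1-t_0$ is an odd natural number $2n_1+1$, then $\Delta^n_{\widetilde T}f\equiv0$ in $\Omega_D$ for all $n>n_1$, and for every $n\le n_1$ there is a unique $f^{[n]}\in\mathcal S^\omega_T(\Omega_D,A)$ with $\Delta_{\widetilde T}^nf=f^{[n]}\prod_{\ell=1}^n(t_1-t_0-2\ell+1)$. In both cases, writing $f=\mathcal I(F)$, the $T$-stem function $F^{[n]}\in\mathrm{Stem}^\omega_T(D,A\otimes\mathbb R^{2^\tau})$ inducing $f^{[n]}$ (whenever the latter is defined) satisfies, for every $K\subseteq\{1,\dots,\tau\}$ and every $(\alpha,\beta)\in D'=\{(\alpha,\beta)\in D:\beta_1\ne0\}$, \[F^{[n]}_K(\alpha,\beta)=\sum_{\ell=0}^n\frac{b_{n-1,\ell-1}}{\beta_1^{2n-\ell}}(\partial^\ell_{\beta_1}F_K)(\alpha,\beta)\ \text{ if }1\notin K,\qquad F^{[n]}_K(\alpha,\beta)=\sum_{\ell=0}^n\frac{b_{n,\ell}}{\beta_1^{2n-\ell}}(\partial^\ell_{\beta_1}F_K)(\alpha,\beta)\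 \text{ if }1\in K.\]
   Context: $A$ is a finite-dimensional associative real algebra with unit and a $*$-involution $x\mapsto x^c$; $\mathbb S_A=\{x:x+x^c=0,xx^c=1\}\ne\emptyset$. $V\subseteq A$ has basis $(v_0=1,v_1,\dots,v_N)$, $N\ge1$, $v_s\in\mathbb S_A$ pairwise anticommuting for $s\ge1$, $V\subseteq\bigcup_{J\in\mathbb S_A}(\mathbb R+J\mathbb R)$; $A$ carries the Euclidean norm making a completion of this basis orthonormal. $\mathbb R_{\ell,m}=\mathrm{Span}_{\mathbb R}(v_\ell,\dots,v_m)$, $\mathbb S_{\ell,m}$ its unit sphere. A list of steps $T=(t_0,\dots,t_\tau)$, $0\le t_0<\dots<t_\tau=N$, has torus $\mathbb T=\mathbb S_{t_0+1,t_1}\times\cdots\times\mathbb S_{t_{\tau-1}+1,t_\tau}$ (for $0$ steps: single index $J=\emptyset$). For $J\in\mathbb T$, $\beta\in\mathbb R^\tau$: $\beta J=\sum\beta_hJ_h$; $J_\emptyset=1$, $J_K=J_{k_1}\cdots J_{k_p}$; $\overline\beta^h$ flips the sign of $\beta_h$. $D\subseteq\mathbb R_{0,t_0}\times\mathbb R^\tau$ open, reflection invariant, $\Omega_D=\{\alpha+\beta J\}$ open. $T$-stem functions $F=\sum_KE_KF_K$ ($F_K(\alpha,\overline\beta^h)=F_K$ if $h\notin K$, $-F_K$ if $h\in K$) induce $\mathcal I(F)(\alpha+\beta J)=\sum_KJ_KF_K(\alpha,\beta)$ ($\mathcal I$ injective); $\mathrm{Stem}^p_T,\mathcal S^p_T$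 their $C^p$ versions ($\omega$ = real analytic). Laplacian: with $\alpha=\sum_{s\le t_0}x_sv_s$, $(\Delta_TF)_K=\sum_{s=0}^{t_0}\partial^2_{x_s}F_K+\sum_h\partial^2_{\beta_h}F_K$, $\Delta_T\mathcal I(F)=\mathcal I(\Delta_TF)$; same for any list of steps. Elements of the kernel of $\Delta_T$ on $\mathcal S^2_T$ lie in $\mathcal S^\omega_T(\Omega_D,A)$. $\widetilde T$ has mirror $\mathbb R_{0,t_1}$, $\Omega_D=\Omega_{\widetilde D}$ for $\widetilde T$ with $\widetilde D=\{(\alpha+x^1,\beta_2,\dots,\beta_\tau):x^1\in\mathbb R_{t_0+1,t_1},(\alpha,\|x^1\|,\beta_2,\dots)\in D\}$, every element of $\mathcal S^p_T(\Omega_D,A)$ ($p\in\{\infty,\omega\}$) is an element of $\mathcal S^p_{\widetilde T}(\Omega_D,A)$, and $\Delta_{\widetilde T}$ is applied in that sense. The numbers $b_{n,\ell}$: $b_{-1,-1}=1$; for $n\in\mathbb N$, $b_{n,-1}=0$ and $b_{n,\ell}=\frac{(-1)^{n+\ell}}{2^{n-\ell}}\frac{(2n-\ell)!}{\ell!(n-\ell)!}$ for $0\le\ell\le n$. *)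

(* Defs.v *)
From HB Require Import structures.
From mathcomp Require Import all_boot all_order all_algebra all_field.
From mathcomp Require Import all_classical all_reals all_analysis.
Unset Strict Implicit. Unset Printing Implicit Defensive.
Import Order.TTheory GRing.Theory Num.Theory.
Import numFieldNormedType.Exports.
Local Open Scope classical_set_scope.
Local Open Scope ring_scope.

Section Defs.
Context {R : realType} {A : falgType R}.

Definition dimA := (\dim (@fullv R A))%N.
Definition coordA (x : A) : 'rV[R]_dimA :=
  \row_(i < dimA) coord (vbasis (@fullv R A)) i x.
Definition ofcoordA (r : 'rV[R]_dimA) : A :=
  \sum_(i < dimA) r ord0 i *: (vbasis (@fullv R A))`_i.

Definition rcoord m (q : 'rV[R]_m) (k : nat) : R := \sum_(j < m | val j == k) q ord0 j.
Definition dirvec m (k : nat) : 'rV[R]_m := \row_(j < m) (val j == k)%:R.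

Definition partial m (k : nat) (G : 'rV[R]_m -> A) (p : 'rV[R]_m) : A :=
  ofcoordA (derive (fun x => coordA (G x)) p (dirvec m k)).

Definition C0on m (D : set 'rV[R]_m) (G : 'rV[R]_m -> A) : Prop :=
  forall p, D p -> {for p, continuous (fun x => coordA (G x))}.

Fixpoint Ckon m (D : set 'rV[R]_m) (k : nat) (G : 'rV[R]_m -> A) : Prop :=
  match k with
  | 0%N => C0on m D G
  | k'.+1 => C0on m D G /\
      forall i : 'I_m, (forall p, D p -> derivable (fun x => coordA (G x)) p (dirvec m i))
                       /\ Ckon m D k' (partial m i G)
  end.

(* real analyticity: locally the sum of an absolutely convergent power series
   (multi-indices grouped by total degree) *)
Definition mono_term m (c : ('I_m -> nat) -> R) (p x : 'rV[R]_m) (k : nat) : R :=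
  \sum_(a : {ffun 'I_m -> 'I_k.+1} | (\sum_(i < m) val (a i) == k)%N)
     c (fun i => val (a i)) * \prod_(i < m) (x ord0 i - p ord0 i) ^+ val (a i).
Definition abs_mono_term m (c : ('I_m -> nat) -> R) (p x : 'rV[R]_m) (k : nat) : R :=
  \sum_(a : {ffun 'I_m -> 'I_k.+1} | (\sum_(i < m) val (a i) == k)%N)
     `|c (fun i => val (a i))| * \prod_(i < m) `|x ord0 i - p ord0 i| ^+ val (a i).

Definition analytic_at m (g : 'rV[R]_m -> R) (p : 'rV[R]_m) : Prop :=
  exists r : R, 0 < r /\ exists c : ('I_m -> nat) -> R,
    forall x, ball p r x ->
      cvgn (series (abs_mono_term m c p x)) /\
      series (mono_term m c p x) @ \oo --> g x.

Definition Comegaon m (D : set 'rV[R]_m) (G : 'rV[R]_m -> A) : Prop :=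
  forall p, D p -> forall j : 'I_dimA, analytic_at m (fun x => coordA (G x) ord0 j) p.

Inductive regularity := Creg of nat | Cw.
Definition Creg_on m (r : regularity) (D : set 'rV[R]_m) (G : 'rV[R]_m -> A) : Prop :=
  match r with Creg k => Ckon m D k G | Cw => Comegaon m D G end.

Definition SA (conj : A -> A) (x : A) : Prop := x + conj x = 0 /\ x * conj x = 1.

Definition star_involution (conj : A -> A) : Prop :=
  (forall a : R, forall x y : A, conj (a *: x + y) = a *: conj x + conj y) /\
  (forall x, conj (conj x) = x) /\
  (forall x y, conj (x * y) = conj y * conj x).

(* unit sphere S_{l,m} of R_{l,m} = Span(v_l,...,v_m) (orthonormal basis) *)
Definition sphere (v : nat -> A) (l m : nat) (x : A) : Prop :=
  exists y : nat -> R, x = \sum_(l <= s < m.+1) y s *: v s /\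
                       \sum_(l <= s < m.+1) y s ^+ 2 = 1.

(* ---------- a list of steps (t 0 < ... < t tau); components h = 0..tau-1
   (h here corresponds to h+1 in the paper) ---------- *)
Section Steps.
Variables (v : nat -> A) (t : nat -> nat) (tau : nat).
Local Notation m := ((t 0).+1 + tau)%N.

Definition torus (J : nat -> A) : Prop :=
  forall h, (h < tau)%N -> sphere v (t h).+1 (t h.+1) (J h).

Definition alphaof (p : 'rV[R]_m) : A := \sum_(s < (t 0).+1) rcoord m p s *: v s.
Definition betaof (p : 'rV[R]_m) (h : nat) : R := rcoord m p ((t 0).+1 + h).
Definition pt (p : 'rV[R]_m) (J : nat -> A) : A :=
  alphaof p + \sum_(h < tau) betaof p h *: J h.

Definition Omega (D : set 'rV[R]_m) (x : A) : Prop :=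
  exists p J, D p /\ torus J /\ x = pt p J.

Definition flip (h : nat) (p : 'rV[R]_m) : 'rV[R]_m :=
  \row_(j < m) (if val j == ((t 0).+1 + h)%N then - p ord0 j else p ord0 j).

Definition reflection_invariant (D : set 'rV[R]_m) : Prop :=
  forall h p, (h < tau)%N -> D p -> D (flip h p).

Definition is_stem (D : set 'rV[R]_m) (F : {set 'I_tau} -> 'rV[R]_m -> A) : Prop :=
  forall (K : {set 'I_tau}) (h : 'I_tau) p, D p ->
    F K (flip h p) = if h \in K then - F K p else F K p.

Definition JK (J : nat -> A) (K : {set 'I_tau}) : A := \prod_(h < tau | h \in K) J h.

Definition induces (D : set 'rV[R]_m) (F : {set 'I_tau} -> 'rV[R]_m -> A) (f : A -> A) : Prop :=
  forall p J, D p -> torus J -> f (pt p J) = \sum_(K : {set 'I_tau}) JK J K * F K p.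

Definition stem_reg (r : regularity) (D : set 'rV[R]_m) F : Prop :=
  is_stem D F /\ forall K, Creg_on m r D (F K).

Definition slice_reg (r : regularity) (D : set 'rV[R]_m) (f : A -> A) : Prop :=
  exists F, stem_reg r D F /\ induces D F f.

Definition lapS (F : {set 'I_tau} -> 'rV[R]_m -> A) : {set 'I_tau} -> 'rV[R]_m -> A :=
  fun K p => \sum_(i < m) partial m i (partial m i (F K)) p.

Definition slice_lap (D : set 'rV[R]_m) (f g : A -> A) : Prop :=
  exists F, stem_reg (Creg 2) D F /\ induces D F f /\ induces D (lapS F) g.

Fixpoint lap_iter (D : set 'rV[R]_m) (n : nat) (f g : A -> A) : Prop :=
  match n with
  | 0%N => forall x, Omega D x -> g x = f x
  | n'.+1 => exists h, lap_iter D n' f h /\ slice_lap D h g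
  end.

Definition dbeta1 (l : nat) (G : 'rV[R]_m -> A) : 'rV[R]_m -> A :=
  iter l (partial m (t 0).+1) G.
End Steps.

Definition ttilde (t : nat -> nat) : nat -> nat := fun i => t i.+1.

Definition toD (t : nat -> nat) (tau : nat) (q : 'rV[R]_((t 1%N).+1 + tau.-1)) :
    'rV[R]_((t 0%N).+1 + tau) :=
  \row_(j < (t 0%N).+1 + tau)
    (if (val j < (t 0%N).+1)%N then rcoord _ q j
     else if val j == (t 0%N).+1 then
       Num.sqrt (\sum_((t 0%N).+1 <= s < (t 1%N).+1) rcoord _ q s ^+ 2)
     else rcoord _ q (val j - (t 0%N).+1 - 1 + (t 1%N).+1)).

Definition Dtilde (t : nat -> nat) (tau : nat) (D : set 'rV[R]_((t 0%N).+1 + tau)) :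
    set 'rV[R]_((t 1%N).+1 + tau.-1) :=
  fun q => D (toD t tau q).

End Defs.

Definition bnum (R : realType) (n l : nat) : R :=
  (-1) ^+ (n + l) / 2%:R ^+ (n - l) * ((2 * n - l)`!)%:R / ((l`!)%:R * ((n - l)`!)%:R).
(* bshift n l = b_{n-1,l-1} (with b_{-1,-1} = 1, b_{n,-1} = 0) *)
Definition bshift (R : realType) (n l : nat) : R :=
  match n, l with
  | 0%N, 0%N => 1
  | 0%N, _.+1 => 0
  | _.+1, 0%N => 0
  | n'.+1, l'.+1 => bnum R n' l'
  end.

Section Conclusion.
Context {R : realType} {A : falgType R}.
Variables (v : nat -> A) (t : nat -> nat) (tau : nat).
Variables (D : set 'rV[R]_((t 0%N).+1 + tau)) (f : A -> A).

Definition cprod (n : nat) : R :=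
  \prod_(1 <= l < n.+1) ((t 1%N)%:R - (t 0%N)%:R - (2 * l)%:R + 1).

(* Delta_{T~}^n f computed with T~ = (t_1,...,t_tau) on D~ (Omega_{D~} = Omega_D) *)
Definition lapTt_iter (n : nat) (g : A -> A) : Prop :=
  lap_iter v (ttilde t) tau.-1 (Dtilde t tau D) n f g.

Definition fn_statement (n : nat) : Prop :=
  exists fn : A -> A,
    slice_reg v t tau Cw D fn /\
    lapTt_iter n (fun x => cprod n *: fn x) /\
    (forall g : A -> A, slice_reg v t tau Cw D g ->
        lapTt_iter n (fun x => cprod n *: g x) ->
        forall x, Omega v t tau D x -> g x = fn x) /\
    (forall F Fn : {set 'I_tau} -> 'rV[R]_((t 0%N).+1 + tau) -> A,
        is_stem t tau D F -> induces v t tau D F f ->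
        is_stem t tau D Fn -> induces v t tau D Fn fn ->
        forall (K : {set 'I_tau}) p, D p -> betaof t tau p 0 != 0 ->
          Fn K p =
          if [exists h in K, val h == 0%N] then
            \sum_(l < n.+1) (bnum R n l / betaof t tau p 0 ^+ (2 * n - l)) *:
                            dbeta1 t tau l (F K) p
          else
            \sum_(l < n.+1) (bshift R n l / betaof t tau p 0 ^+ (2 * n - l)) *:
                            dbeta1 t tau l (F K) p).
End Conclusion.

(* Main.v *)
Require Import Defs.
From HB Require Import structures.
From mathcomp Require Import all_boot all_order all_algebra all_field.
From mathcomp Require Import all_classical all_reals all_analysis.
From mathcomp Require Import ring lra zify.
Import Order.TTheory GRing.Theory Num.Theory.
Import numFieldNormedType.Exports.
Local Open Scope classical_set_scope.
Local Open Scope ring_scope.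

(** The components of the stem function of a kernel element are harmonic, hence real
    analytic: the maximum principle on a half cube, with a quadratic barrier, bounds the
    first derivatives of a harmonic function; difference quotients then show that its
    derivatives are harmonic, and iteration yields Cauchy estimates.  Since an analytic
    function vanishing on beta_1 = 0 is an analytic multiple of beta_1, the operator
    (1 / beta_1) d/dbeta_1 preserves analytic functions even in beta_1.  Let a_n be its
    iterates on F_K if 1 is not in K (put c = 1), on F_K / beta_1 if 1 is in K (put c = 3).
    Harmonicity gives, with Delta' the Laplacian in the variables other than beta_1,
      Delta' a_n + (2 n + c) a_(n+1) + beta_1^2 a_(n+2) = 0,
    so that after the substitution beta_1 = |x^1| both a_n (for c = 1) and x^1 a_n (for
    c = 3) are mapped by the Laplacian of the enlarged mirror to t_1 - t_0 - 1 - 2 n times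
    their successor.  Thus Delta_T~ acts as a weighted shift, the weights multiply up to
    the constant of the theorem, and f^[n] is induced by the components a_n and
    beta_1 a_n.  Expanding the iterates gives the numbers b_(n,l). *)

(** * Directional derivatives *)

(** Regularity has to be proved up to and across beta_1 = 0: [D] may meet that hyperplane, the stem
    components are only assumed C^2, and each division by beta_1 costs a derivative. The maximum
    principle supplies it without mean values or a fundamental solution. Laplace's equation is
    available componentwise only because the induced function determines its stem function. The
    second obstacle is that |x^1| is not differentiable at x^1 = 0. The chain rule survives there
    because the functions composed with it have a beta_1-derivative divisible by beta_1. The values
    of c come from a'' = a_1 + beta_1^2 a_2 and (beta_1 a)'' = beta_1 (3 a_1 + beta_1^2 a_2).
    Multiplying by a coordinate of x^1 adds 2 to the weight, through the cross term of the Leibniz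
    rule, which exactly offsets passing from c = 1 to c = 3. All components therefore share one
    weight, and a scalar constant factors out of the iterated Laplacian. The weight at n is the
    factor l = n + 1 of the product; if t_1 - t_0 = 2 n_1 + 1 it vanishes at n = n_1. The functions
    f^[n] are built for every n, but the identity determines them only while the product is
    nonzero. *)

Lemma eq_ler {R : realType} (x y : R) : x = y -> x <= y.
Proof. by move=> ->. Qed.

Section Lines.
Context {R : realType}.
Implicit Types V W U : normedModType R.

(** [L] need only be affine along the line through [x] in direction [v], because both difference
    quotients are then the same function of [h]. This covers translations and reflections, and also
    [toD], which is affine in some directions only. *)
Lemma is_derive_affine V W U (f : W -> U) (L : V -> W) x v w d :
  (forall h : R, L (h *: v + x) = h *: w + L x) ->
  is_derive (L x) w f d -> is_derive x v (f \o L) d.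
Proof.
move=> HL [df <-].
have E : (fun h => h^-1 *: (((f \o L) \o shift x) (h *: v) - (f \o L) x)) =
         (fun h => h^-1 *: ((f \o shift (L x)) (h *: w) - f (L x))).
  by apply/funext => h /=; rewrite HL.
by split; rewrite /derivable /derive E.
Qed.

Lemma is_derive_line V U (f : V -> U) x v s d :
  is_derive (x + s *: v) v f d -> is_derive s 1 (fun s : R => f (x + s *: v)) d.
Proof.
apply: (@is_derive_affine R^o V U f (fun s : R => x + s *: v)) => h.
by rewrite scalerDl -scalerA scale1r addrCA.
Qed.

Lemma is_derive_line0 V U (f : V -> U) x v d :
  is_derive (0 : R) 1 (fun s : R => f (x + s *: v)) d -> is_derive x v f d.
Proof.
have E : (fun h => h^-1 *: (((fun s : R => f (x + s *: v)) \o shift 0) (h *: 1)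
      - f (x + 0 *: v))) = (fun h => h^-1 *: ((f \o shift x) (h *: v) - f x)).
  apply/funext => h /=; rewrite scale0r !addr0 [_ *: 1]mulr1.
  by rewrite (addrC x).
by move=> [df <-]; split; move: df; rewrite /derivable /derive E.
Qed.

Lemma is_deriveZv V (f : V -> R) x v (c d : R) :
  is_derive x v f d -> is_derive x (c *: v) f (c * d).
Proof.
move=> dF; apply: is_derive_line0.
have -> : (fun s : R => f (x + s *: (c *: v))) =
          (fun s : R => f (x + s *: v)) \o ( *%R c).
  by apply/funext => s /=; rewrite scalerA (mulrC s).
rewrite mulrC; apply: is_derive1_comp.
  by rewrite mulr0; apply: is_derive_line; rewrite scale0r addr0.
have -> : ( *%R c) = c *: (id : R -> R) by apply/funext.
by apply: is_derive_eq; rewrite -[LHS]/(c * 1) mulr1.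
Qed.

Lemma is_derive_cont1 (f : R -> R) (x d : R) : is_derive x 1 f d -> {for x, continuous f}.
Proof.
by move=> [df _]; apply/differentiable_continuous/derivable1_diffP.
Qed.

Lemma MVT_line V (f : V -> R) x w (df : R -> R) :
  (forall s : R, 0 <= s <= 1 -> is_derive (x + s *: w) w f (df s)) ->
  exists2 s : R, 0 <= s <= 1 & f (x + w) - f x = df s.
Proof.
move=> H; pose g (s : R) := f (x + s *: w).
have Hg (s : R) : 0 <= s <= 1 -> is_derive s 1 g (df s).
  by move=> /H; apply: is_derive_line.
have [||c c01] := @MVT_segment R g df 0 1 ler01.
- by move=> s; rewrite in_itv /= => /andP[/ltW s0 /ltW s1]; apply: Hg; rewrite s0 s1.
- apply: continuous_in_subspaceT => s; rewrite inE /= in_itv /= => /Hg.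
  exact: is_derive_cont1.
- rewrite /g scale1r scale0r addr0 subr0 mulr1 => E.
  by exists c => //; rewrite in_itv /= in c01.
Qed.

(** The first-order expansion, multiplied out so that [h] = 0 is allowed. Most derivative estimates
    below go through this form. *)
Lemma is_deriveP V (f : V -> R) x v (d : R) :
  is_derive x v f d <->
  forall e : R, 0 < e -> exists2 r : R, 0 < r &
    forall h, `|h| < r -> `|f (x + h *: v) - f x - h * d| <= e * `|h|.
Proof.
split.
  move=> [df <-] e e0.
  have /cvgrPdist_le /(_ _ e0) [r /= r0 Hr] := df.
  exists r => // h hr; have [->|h0] := eqVneq h 0.
    by rewrite scale0r addr0 subrr mul0r subrr !normr0 mulr0.
  have := Hr h; rewrite /= sub0r normrN => /(_ hr h0).
  rewrite -[X in X <= e * _]normrN -(@ler_pM2r _ `|h|) ?normr_gt0 // -normrM => H.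
  apply: le_trans H; apply/eq_ler; congr `|_|.
  rewrite /shift /= (addrC (h *: v)) -[h^-1 *: _]/(h^-1 * _) mulrBl mulrAC mulVf // mul1r.
  by rewrite -/(derive f x v) mulrC; ring.
move=> H.
have C : (fun h => h^-1 *: ((f \o shift x) (h *: v) - f x)) @ 0^' --> d.
  apply/cvgrPdist_le => e e0; have [r r0 Hr] := H e e0.
  near=> h.
  have h0 : h != 0 by near: h; exact: nbhs_dnbhs_neq.
  have hr : `|h| < r by near: h; exact: dnbhs0_lt.
  have := Hr h hr; rewrite -ler_pdivrMr ?normr_gt0 // -normf_div => Hh; apply: le_trans Hh.
  apply/eq_ler; rewrite -normrN; congr `|_|.
  rewrite /shift /= (addrC (h *: v)) -[h^-1 *: _]/(h^-1 * _) mulrBl mulrAC divff // mul1r.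
  by ring.
split; first by apply/cvg_ex; exists d.
by apply: cvg_lim.
Unshelve. all: by end_near. Qed.

End Lines.

Section EpsForms.
Context {R : realType}.
Implicit Types V : normedModType R.

Lemma pos_lt_both (a b : R) : 0 < a -> 0 < b -> exists h : R, [/\ 0 < h, h < a & h < b].
Proof.
move=> a0 b0; exists (Num.min a b / 2).
have m0 : 0 < Num.min a b by rewrite lt_min a0.
have : Num.min a b / 2 < Num.min a b by rewrite ltr_pdivrMr // ltr_pMr // ltrDr.
by rewrite lt_min => /andP[? ?]; split=> //; rewrite divr_gt0.
Qed.

Lemma continuousP_norm V (f : V -> R) x :
  {for x, continuous f} <->
  forall e : R, 0 < e -> exists2 r : R, 0 < r &
    forall y, `|y - x| < r -> `|f y - f x| <= e.
Proof.
split.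
  move=> /cvgrPdist_le H e e0; have /nbhs_normP[r /= r0 Hr] := H e e0.
  exists r => // y yr; rewrite distrC; apply: Hr => /=; by rewrite distrC.
move=> H; apply/cvgrPdist_le => e e0; have [r r0 Hr] := H e e0.
apply/nbhs_normP; exists r => // y /=; rewrite distrC => yr.
by rewrite distrC; exact: Hr.
Qed.

Lemma openP_norm V (U : set V) :
  open U <-> forall x, U x -> exists2 r : R, 0 < r & forall y, `|y - x| < r -> U y.
Proof.
rewrite openE; split.
  move=> H x /H /nbhs_normP[r /= r0 Hr]; exists r => // y yr; apply: Hr => /=.
  by rewrite distrC.
move=> H x /H[r r0 Hr]; apply/nbhs_normP; exists r => // y /=; rewrite distrC.
exact: Hr.
Qed.

Lemma nearP_norm V (P : V -> Prop) x (r : R) : 0 < r ->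
  (forall y, `|y - x| < r -> P y) -> \near x, P x.
Proof.
move=> r0 H; apply/nbhs_normP; exists r => // y /=; rewrite distrC; exact: H.
Qed.

Lemma locally_bounded_at V (f : V -> R) x : {for x, continuous f} ->
  exists B : R, exists r : R, [/\ 0 < B, 0 < r & forall y, `|y - x| < r -> `|f y| <= B].
Proof.
move=> /continuousP_norm /(_ 1 ltr01)[r r0 H]; exists (`|f x| + 1), r; split => //.
move=> y /H {}H; rewrite -[f y](subrK (f x)) addrC.
by apply: (le_trans (ler_normD _ _)); rewrite lerD2l.
Qed.

(** Schwarz's theorem in the form that also produces the second mixed derivative: only [fab] is
    assumed to exist, and the derivative of [fb] along [a] is a conclusion. *)
Lemma is_derive_schwarz V (f fa fb fab : V -> R) x a b (r : R) : 0 < r ->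
  (forall z, `|z - x| < r -> is_derive z a f (fa z)) ->
  (forall z, `|z - x| < r -> is_derive z b f (fb z)) ->
  (forall z, `|z - x| < r -> is_derive z b fa (fab z)) ->
  {for x, continuous fab} -> is_derive x a fb (fab x).
Proof.
move=> r0 Ha Hb Hab /continuousP_norm Hc; apply/is_deriveP => e e0.
have k1 (u : V) : x + u - x = u by rewrite addrC addKr.
have k2 (u w : V) : x + u + w - x = u + w by rewrite -[x + u + w]addrA k1.
have [rho rho0 Hrho] := Hc e e0.
pose K := `|a| + `|b| + 1; pose q := Num.min r rho / K.
have K0 : 0 < K by rewrite /K; have := normr_ge0 a; have := normr_ge0 b; lra.
have q0 : 0 < q by rewrite divr_gt0 // lt_min r0.
have near_x (s t : R) : `|s| < q -> `|t| < q -> `|s *: a + t *: b| < Num.min r rho.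
  move=> sq tq; have Kq : Num.min r rho = q * K by rewrite /q divfK ?gt_eqF.
  apply: (le_lt_trans (ler_normD _ _)); rewrite !normrZ Kq /K mulrDr mulrDr mulr1.
  have A1 : `|s| * `|a| <= q * `|a| by rewrite ler_wpM2r // ltW.
  have A2 : `|t| * `|b| <= q * `|b| by rewrite ler_wpM2r // ltW.
  lra.
(* The second difference is s t [fab] at an intermediate point: mean value theorem along [a] for the
   increment [phi] of [f] in direction [b], and along [b] for [fa]. Continuity of [fab] at [x] then
   gives the bound. *)
have DD (s t : R) : `|s| < q -> `|t| < q ->
  `|f (x + s *: a + t *: b) - f (x + s *: a) - (f (x + t *: b) - f x)
      - s * t * fab x| <= e * `|s| * `|t|.
  move=> sq tq; pose phi y := f (y + t *: b) - f y.
  have sc (c u : R) : 0 <= c <= 1 -> `|u| < q -> `|c * u| < q.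
    move=> /andP[c0 c1] uq; rewrite normrM (ger0_norm c0).
    by apply: le_lt_trans uq; rewrite ler_piMl.
  have [|c c01 Ec] := @MVT_line R V phi x (s *: a)
    (fun c => s * (fa (x + (c * s) *: a + t *: b) - fa (x + (c * s) *: a))).
    move=> c c01; rewrite scalerA; apply: is_deriveZv.
    have H1 : is_derive (x + (c * s) *: a) a (f \o (fun y => y + t *: b))
                (fa (x + (c * s) *: a + t *: b)).
      apply: (@is_derive_affine _ _ _ _ f (fun y => y + t *: b) _ _ a).
        by move=> h; rewrite -!addrA.
      apply: Ha; rewrite k2.
      by apply: lt_le_trans (near_x _ _ (sc _ _ c01 sq) tq) _; rewrite ge_min lexx.
    have H2 : is_derive (x + (c * s) *: a) a f (fa (x + (c * s) *: a)).
      apply: Ha; rewrite k1.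
      have := near_x _ 0 (sc _ _ c01 sq); rewrite normr0 scale0r addr0 => /(_ q0).
      by move=> /lt_le_trans; apply; rewrite ge_min lexx.
    exact: is_deriveB.
  have [|c' c'01 Ec'] := @MVT_line R V fa (x + (c * s) *: a) (t *: b)
    (fun c' => t * fab (x + (c * s) *: a + (c' * t) *: b)).
    move=> c' c'01; rewrite scalerA; apply: is_deriveZv; apply: Hab.
    rewrite k2.
    by apply: lt_le_trans (near_x _ _ (sc _ _ c01 sq) (sc _ _ c'01 tq)) _; rewrite ge_min lexx.
  have -> : f (x + s *: a + t *: b) - f (x + s *: a) - (f (x + t *: b) - f x) =
     phi (x + s *: a) - phi x by [].
  rewrite Ec Ec' mulrA -mulrBr !normrM mulrC -mulrA ler_wpM2r ?mulr_ge0 //.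
  apply: Hrho; rewrite k2.
  by apply: lt_le_trans (near_x _ _ (sc _ _ c01 sq) (sc _ _ c'01 tq)) _; rewrite ge_min lexx orbT.
(* With [s] fixed, the second difference divided by t tends to fb(x + s a) - fb(x) as t goes to 0;
   [eta] absorbs the error of stopping at a positive t. *)
exists q => // s sq; apply/ler_addgt0Pr => eta eta0.
have eta2 : 0 < eta / 2 by rewrite divr_gt0.
have xs : `|x + s *: a - x| < r.
  have := near_x s 0 sq; rewrite normr0 scale0r addr0 k1 => /(_ q0).
  by move=> /lt_le_trans; apply; rewrite ge_min lexx.
have xx : `|x - x| < r by rewrite subrr normr0.
have [r1 r10 H1] := (is_deriveP _ _ _ _ _).1 (Hb _ xs) _ eta2.
have [r2 r20 H2] := (is_deriveP _ _ _ _ _).1 (Hb _ xx) _ eta2.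
have [h [h0 h1 h2]] := pos_lt_both _ _ r10 r20.
have [t [t0 tq th]] := pos_lt_both _ _ q0 h0.
have [t1 t2] : `|t| < r1 /\ `|t| < r2 by rewrite gtr0_norm //; split; exact: lt_trans th _.
rewrite -(gtr0_norm t0) in tq.
have := DD s t sq tq; have := H1 _ t1; have := H2 _ t2.
rewrite (gtr0_norm t0) => {}H1 {}H2 H3.
rewrite -(@ler_pM2r _ t) // -[X in _ * X <= _](gtr0_norm t0) -normrM.
set A := f (x + s *: a + t *: b) in H2 H3; set B := f (x + s *: a) in H2 H3.
set C := f (x + t *: b) in H1 H3.
have -> : (fb (x + s *: a) - fb x - s * fab x) * t =
   (A - B - (C - f x) - s * t * fab x) - (A - B - t * fb (x + s *: a)) +
     (C - f x - t * fb x) by ring.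
apply: (le_trans (ler_normD _ _)).
apply: (le_trans (lerD (ler_normB _ _) (lexx _))).
by apply: (le_trans (lerD (lerD H3 H2) H1)); apply/eq_ler; field.
Qed.

(** The maximum makes 0 a critical point; if [g2] were positive, [g1] would be positive just to the
    right of 0 and [g] would increase there. *)
Lemma second_derivative_max (g g1 : R -> R) (g2 rho : R) : 0 < rho ->
  (forall s : R, `|s| < rho -> is_derive s 1 g (g1 s)) ->
  is_derive (0 : R) 1 g1 g2 ->
  (forall s, `|s| < rho -> g s <= g 0) -> g2 <= 0.
Proof.
move=> rho0 Hg Hg1 gmax.
have itvP' (s : R) : s \in `]-rho, rho[ -> `|s| < rho by rewrite in_itv /= ltr_norml.
have g10 : g1 0 = 0.
  have : is_derive (0 : R) 1 g 0.
    apply: (@derive1_at_max _ g (-rho) rho 0); first by rewrite ltW// gtrN.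
    - by move=> t /itvP' /Hg[].
    - by rewrite in_itv /= oppr_lt0 rho0.
    - by move=> t /itvP' /gmax.
  have /Hg[_ <-] : `|0 : R| < rho by rewrite normr0.
  by move=> [_ ->].
rewrite leNgt; apply/negP => g20.
have [r r0 H] := (is_deriveP _ _ _ _ _).1 Hg1 (g2 / 2) (divr_gt0 g20 (ltr0Sn _ _)).
have [h [h0 hr hrho]] := pos_lt_both _ _ r0 rho0.
have bnd (c : R) : 0 <= c <= h -> `|c| < rho.
  by move=> /andP[c0 ch]; rewrite ger0_norm //; apply: le_lt_trans hrho.
have [||c] := @MVT R g g1 0 h h0.
- move=> c; rewrite in_itv /= => /andP[/ltW c0 /ltW ch]; apply: Hg.
  by apply: bnd; rewrite c0 ch.
- apply: continuous_in_subspaceT => c; rewrite inE /= in_itv /= => /bnd /Hg.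
  exact: is_derive_cont1.
rewrite in_itv /= subr0 => /andP[c0 ch] E.
have : g h <= g 0 by apply: gmax; rewrite gtr0_norm.
have cr : `|c| < r by rewrite gtr0_norm //; apply: lt_trans hr.
have := H c cr; rewrite g10 subr0 add0r [c *: _]mulr1 (gtr0_norm c0) ler_norml => /andP[H1 _].
have gc : 0 < g1 c by have := mulr_gt0 g20 c0; lra.
have := mulr_gt0 gc h0; lra.
Qed.

(** The symmetric difference is what a bound on the odd part of a function controls. *)
Lemma derive_le_central V (u : V -> R) p v (d K del : R) : 0 < del ->
  is_derive p v u d ->
  (forall s : R, 0 < s -> s <= del -> u (p + s *: v) - u (p - s *: v) <= K * s * 2) -> d <= K.
Proof.
move=> del0 Hd H; apply/ler_addgt0Pr => eta eta0.
have [r r0 Hr] := (is_deriveP _ _ _ _ _).1 Hd _ eta0.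
have [s [s0 sr sdel]] := pos_lt_both _ _ r0 del0.
have := H s s0 (ltW sdel).
have := Hr s; rewrite (gtr0_norm s0) => /(_ sr); rewrite ler_norml => /andP[H1 _].
have := Hr (- s); rewrite normrN (gtr0_norm s0) => /(_ sr).
rewrite scaleNr ler_norml => /andP[_ H2] H3.
rewrite -(@ler_pM2r _ s) //; lra.
Qed.

End EpsForms.

Section RowSpace.
Context {R : realType} {m : nat}.
Implicit Types (x y z p : 'rV[R]_m) (u : 'rV[R]_m -> R) (i j : 'I_m).
Local Notation E i := (@dirvec R m i).

Lemma coord_le_norm x i : `|x ord0 i| <= `|x|.
Proof.
rewrite [leRHS]/Num.Def.normr /= mx_normrE.
by apply: (@le_bigmax _ _ _ 0 (fun ij : 'I_1 * 'I_m => `|x ij.1 ij.2|) (ord0, i)).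
Qed.

Lemma norm_rV_lt x (r : R) : 0 < r -> (forall i, `|x ord0 i| < r) -> `|x| < r.
Proof.
move=> r0 H; rewrite /Num.Def.normr /= mx_normrE; apply/bigmax_ltP; split => //.
by move=> [i j] _ /=; rewrite (ord1 i).
Qed.

Lemma norm_rV_le x (r : R) : 0 <= r -> (forall i, `|x ord0 i| <= r) -> `|x| <= r.
Proof.
move=> r0 H; rewrite /Num.Def.normr /= mx_normrE; apply/bigmax_leP; split => //.
by move=> [i j] _ /=; rewrite (ord1 i).
Qed.

Lemma dirvecE i j : E i ord0 j = (j == i)%:R.
Proof. by rewrite mxE. Qed.

Lemma shift_dirvecE x i (s : R) j : (x + s *: E i) ord0 j = x ord0 j + s * (j == i)%:R.
Proof. by rewrite mxE [X in _ + X]mxE dirvecE. Qed.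

Lemma norm_dirvec_le i (s : R) : `|s *: E i| <= `|s|.
Proof.
apply: norm_rV_le => // j; rewrite mxE dirvecE.
by case: eqP => _; rewrite ?mulr1 // mulr0 normr0.
Qed.

(* Locked, so that unification never unfolds the limit defining a derivative. *)
Fact pd_key : unit. Proof. by []. Qed.
Definition pd : 'I_m -> ('rV[R]_m -> R) -> 'rV[R]_m -> R :=
  locked_with pd_key (fun i u x => 'D_(E i) u x).

Lemma pdE i u x : pd i u x = 'D_(E i) u x.
Proof. by rewrite /pd unlock. Qed.

Lemma is_derive_D i u x : derivable u x (E i) -> is_derive x (E i) u (pd i u x).
Proof. by rewrite pdE => /derivableP. Qed.

Lemma D_val i u x d : is_derive x (E i) u d -> pd i u x = d.
Proof. by rewrite pdE => -[_ <-]. Qed.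

Lemma eq_near_D i u u' x (r : R) : 0 < r ->
  (forall y, `|y - x| < r -> u y = u' y) -> pd i u x = pd i u' x.
Proof. by move=> r0 H; rewrite !pdE; apply: near_eq_derive; apply: nearP_norm r0 H. Qed.

Lemma eq_near_is_derive v u u' x (r d : R) : 0 < r ->
  (forall y, `|y - x| < r -> u y = u' y) -> is_derive x v u d -> is_derive x v u' d.
Proof. by move=> r0 H; apply: near_eq_is_derive; apply: nearP_norm r0 H. Qed.

Lemma pd_cst i (c : R) x : pd i (fun=> c) x = 0.
Proof. rewrite pdE; exact: derive_cst. Qed.

Lemma pd_shift i u (t0 : 'rV[R]_m) : pd i (fun x => u (x + t0)) = (fun x => pd i u (x + t0)).
Proof.
apply/funext => x; rewrite !pdE /derive.
have -> // : (fun h : R => h^-1 *: (((fun x => u (x + t0)) \o shift x) (h *: E i) - u (x + t0))) =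
  (fun h => h^-1 *: ((u \o shift (x + t0)) (h *: E i) - u (x + t0))).
by apply/funext => h /=; rewrite addrA.
Qed.

Lemma norm_shift_lt p z w (r s : R) : `|z - p| < r -> `|w| <= s -> `|z + w - p| < r + s.
Proof.
by move=> H1 H2; rewrite addrAC; apply: (le_lt_trans (ler_normD _ _)); rewrite ltr_leD.
Qed.

Lemma convex_norm_lt (a b q c r : R) : `|a - q| < r -> `|b - q| < r -> 0 <= c <= 1 ->
  `|a + c * (b - a) - q| < r.
Proof.
move=> ar br /andP[c0 c1].
have -> : a + c * (b - a) - q = (1 - c) * (a - q) + c * (b - q) by ring.
apply: (le_lt_trans (ler_normD _ _)); rewrite !normrM.
have c1' : 0 <= 1 - c by rewrite subr_ge0.
rewrite (ger0_norm c0) (ger0_norm c1').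
have [c00|cn0] := eqVneq c 0; first by rewrite c00; lra.
have A1 : (1 - c) * `|a - q| <= (1 - c) * r by rewrite ler_wpM2l // ltW.
have A2 : c * `|b - q| < c * r by rewrite ltr_pM2l // lt0r cn0.
by lra.
Qed.

(** Change the coordinates of [x] into those of [y] one at a time, [z k] being the k-th hybrid, and
    apply the mean value theorem to each change. The norm is the sup norm, so hybrids of points of a
    ball stay in the ball. *)
Lemma lipschitz_of_partials u (du : 'I_m -> 'rV[R]_m -> R) p (r B : R) :
  (forall z i, `|z - p| < r -> is_derive z (E i) u (du i z)) ->
  (forall z i, `|z - p| < r -> `|du i z| <= B) ->
  forall x y, `|x - p| < r -> `|y - p| < r -> `|u y - u x| <= m%:R * B * `|y - x|.
Proof.
move=> Hd HB x y xp yp.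
pose z k : 'rV[R]_m := \row_j (if (j < k)%N then y ord0 j else x ord0 j).
have r0 : 0 < r by apply: le_lt_trans xp.
have z0 : z 0%N = x by apply/rowP => j; rewrite mxE.
have zm : z m = y by apply/rowP => j; rewrite mxE ltn_ord.
have zS i : z i.+1 = z i + (y ord0 i - x ord0 i) *: E i.
  apply/rowP => j; rewrite !mxE ltnS leq_eqVlt; case: eqP => [ji|ji].
    have -> : j = i by exact: val_inj.
    by rewrite ltnn /= mulr1 addrCA subrr addr0.
  by rewrite mulr0 addr0.
have zc (k : 'I_m) (c : R) : 0 <= c <= 1 ->
    `|z k + c *: ((y ord0 k - x ord0 k) *: E k) - p| < r.
  move=> c01; apply: norm_rV_lt => // j.
  have := le_lt_trans (coord_le_norm _ j) xp; have := le_lt_trans (coord_le_norm _ j) yp.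
  rewrite !mxE => yj xj; case: eqP => [jk|jk].
    have ? : j = k by exact: val_inj.
    by subst j; rewrite ltnn mulr1; exact: convex_norm_lt.
  by rewrite !mulr0 addr0; case: ifP.
have step (k : 'I_m) : `|u (z k.+1) - u (z k)| <= B * `|y - x|.
  rewrite zS.
  have [c c01|c c01 ->] := @MVT_line R _ u (z k) ((y ord0 k - x ord0 k) *: E k)
    (fun c => (y ord0 k - x ord0 k) * du k (z k + c *: ((y ord0 k - x ord0 k) *: E k))).
    by apply: is_deriveZv; apply: Hd; exact: zc.
  rewrite normrM mulrC; apply: ler_pM => //; first by apply: HB; exact: zc.
  by have := coord_le_norm (y - x) k; rewrite !mxE.
have -> : u y - u x = \sum_(k < m) (u (z k.+1) - u (z k)).
  rewrite -(big_mkord xpredT (fun k => u (z k.+1) - u (z k))).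
  by rewrite (telescope_sumr (fun k => u (z k))) // zm z0.
apply: (le_trans (ler_norm_sum _ _ _)).
apply: (le_trans (ler_sum _ (fun k _ => step k))).
by rewrite sumr_const card_ord -mulrA [leRHS]mulr_natl.
Qed.

Lemma continuous_of_partials u (du : 'I_m -> 'rV[R]_m -> R) p (r B : R) : 0 < r ->
  (forall z i, `|z - p| < r -> is_derive z (E i) u (du i z)) ->
  (forall z i, `|z - p| < r -> `|du i z| <= B) -> {for p, continuous u}.
Proof.
move=> r0 Hd HB; apply/continuousP_norm => e e0.
pose K := m%:R * `|B| + 1.
have K0 : 0 < K by rewrite /K; have := mulr_ge0 (ler0n R m) (normr_ge0 B); lra.
exists (Num.min r (e / K)); first by rewrite lt_min r0 divr_gt0.
move=> y; rewrite lt_min => /andP[yr ye].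
have pp : `|p - p| < r by rewrite subrr normr0.
apply: (le_trans (lipschitz_of_partials _ _ _ _ _ Hd HB _ _ pp yr)).
apply: (@le_trans _ _ (K * `|y - p|)).
  rewrite ler_wpM2r //; apply: (@le_trans _ _ (m%:R * `|B|)).
    by rewrite ler_wpM2l // ler_norm.
  by rewrite /K lerDl.
by rewrite mulrC -ler_pdivlMr // ltW.
Qed.

End RowSpace.

(** * Regularity of harmonic functions *)

Section Harmonic.
Context {R : realType} {m : nat}.
Implicit Types (x y z p : 'rV[R]_m) (u : 'rV[R]_m -> R) (i j : 'I_m) (U : set 'rV[R]_m).
Local Notation E i := (@dirvec R m i).

Definition harm U u := forall x, U x ->
  [/\ {for x, continuous u},
      (forall i, derivable u x (E i) /\ {for x, continuous (pd i u)}),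
      (forall i j, derivable (pd i u) x (E j) /\ {for x, continuous (pd j (pd i u))}) &
      \sum_i pd i (pd i u) x = 0].

Lemma is_derive_quad (a b c s : R) :
  is_derive s 1 (fun s : R => a + (b * s + c * s ^+ 2)) (b + 2 * c * s).
Proof.
apply/is_deriveP => e e0; have c1 : 0 < `|c| + 1 by have := normr_ge0 c; lra.
exists (e / (`|c| + 1)) => [|h]; first by rewrite divr_gt0.
rewrite ltr_pdivlMr // => he; rewrite [h *: 1]mulr1.
have -> : a + (b * (s + h) + c * (s + h) ^+ 2) - (a + (b * s + c * s ^+ 2))
   - h * (b + 2 * c * s) = (c * h) * h by ring.
rewrite normrM ler_wpM2r // normrM mulrC; apply: le_trans (ltW he).
by rewrite ler_wpM2l // lerDl.
Qed.

(* Comparison on a half cube with a quadratic barrier: the odd part of [u] in the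
   [i]-th coordinate vanishes on the mirror, so its slope there is at most that of
   the barrier. *)
Lemma harm_partial_le U u p (d M : R) i : 0 < d -> 0 < M -> harm U u ->
  (forall x, `|x - p| <= d -> U x /\ `|u x| <= M) ->
  pd i u p <= m.+1%:R * M / d.
Proof.
move=> d0 M0 Hu HM.
pose y x (j : 'I_m) : R := x ord0 j - p ord0 j.
pose sg x := x - (2 * y x i) *: E i.
pose c : R := 2 * M / d ^+ 2.
have c0 : 0 < c by rewrite divr_gt0 // ?mulr_gt0 // exprn_gt0.
(* The barrier [psi] is built for four properties: it is nonnegative on the half cube; on a face at
   distance [d] it is at least c d^2 = 2 M, a bound for u(x) - u(sg x); its Laplacian 2 c (m - 1) -
   2 c m = - 2 c is negative; its slope at [p] in direction [i] is 2 (m + 1) M / d, twice the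
   asserted bound. *)
pose term (k : 'I_m) x : R :=
  if k == i then m.+1%:R * d * y x k - m%:R * y x k ^+ 2 else y x k ^+ 2.
pose psi x : R := c * \sum_k term k x.
pose w x := u x - u (sg x) - psi x.
pose A k : set R :=
  if k == i then `[p ord0 k, p ord0 k + d]%classic else `[p ord0 k - d, p ord0 k + d]%classic.
pose H := [set v : 'rV[R]_m | forall k, A k (v ord0 k)].
have AP k (a : R) : A k a <-> p ord0 k - (if k == i then 0 else d) <= a <= p ord0 k + d.
  by rewrite /A; case: eqP => _; rewrite /= in_itv /= ?subr0.
have HP x : H x <-> (forall k, `|y x k| <= d) /\ 0 <= y x i.
  split=> [Hx|[Hx xi] k].
    split=> [k|]; last by have /AP := Hx i; rewrite eqxx subr0 subr_ge0 => /andP[].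
    have /AP := Hx k; rewrite /y ler_norml; case: eqP => _ /andP[? ?];
      by apply/andP; split; lra.
  apply/AP; have := Hx k; rewrite ler_norml; move: xi; rewrite /y.
  by case: eqP => [->|_] ? /andP[? ?]; apply/andP; split; lra.
have ysg x k : y (sg x) k = if k == i then - y x k else y x k.
  by rewrite /y /sg -scaleNr shift_dirvecE; case: eqP => [->|_]; rewrite ?mulr1 ?mulr0 /y; ring.
have inQ x : (forall k, `|y x k| <= d) -> `|x - p| <= d.
  by move=> Hx; apply: norm_rV_le => [|k]; [exact: ltW | rewrite !mxE; exact: Hx].
have HQ x : H x -> `|x - p| <= d by move=> /HP[Hx _]; exact: inQ.
have HsQ x : H x -> `|sg x - p| <= d.
  by move=> /HP[Hx _]; apply: inQ => k; rewrite ysg; case: eqP; rewrite ?normrN.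
have term_ge0 x k : H x -> 0 <= term k x.
  move=> /HP[Hx xi]; rewrite /term; case: eqP => [->|_]; last exact: sqr_ge0.
  have /andP[_ yd] : - d <= y x i <= d by rewrite -ler_norml.
  have dy : 0 <= (d - y x i) * (y x i * m%:R).
    by rewrite mulr_ge0 ?subr_ge0 // mulr_ge0.
  have := mulr_ge0 (ltW d0) xi; rewrite -natr1; nra.
have psi_ge0 x : H x -> 0 <= psi x.
  move=> Hx; apply: mulr_ge0; first exact: ltW.
  by apply: sumr_ge0 => k _; exact: term_ge0.
have ycont k x : {for x, continuous (y ^~ k)}.
  apply/continuousP_norm => e e0; exists e => // x' /ltW; apply: le_trans.
  by have := coord_le_norm (x' - x) k; rewrite /y !mxE opprB addrA subrK.
have wcont : {within H, continuous w}.
  apply: continuous_in_subspaceT => x; rewrite inE => Hx.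
  have [c1 _ _ _] := Hu _ (HM _ (HQ _ Hx)).1.
  have [c2 _ _ _] := Hu _ (HM _ (HsQ _ Hx)).1.
  have c3 : {for x, continuous (fun x => u (sg x))}.
    apply/continuousP_norm => e e0.
    have [r r0 Hr] := (continuousP_norm _ _ _).1 c2 _ e0.
    exists (r / 3) => [|x' x'r]; first by rewrite divr_gt0.
    apply: Hr.
    have -> : sg x' - sg x = (x' - x) + (- (2 * (x' - x) ord0 i)) *: E i.
      apply/rowP => k; rewrite shift_dirvecE mxE [X in _ + X]mxE.
      by rewrite /sg -!scaleNr !shift_dirvecE /y !mxE -![_ *: _]/(_ * _); ring.
    apply: (le_lt_trans (ler_normD _ _)).
    have := norm_dirvec_le i (- (2 * (x' - x) ord0 i)).
    rewrite normrN normrM (ger0_norm (ler0n _ 2)); have := coord_le_norm (x' - x) i.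
    by lra.
  apply: (@continuousB _ _ _ (fun x => u x - u (sg x))).
    exact: (@continuousB _ _ _ u (fun x => u (sg x))).
  apply: (@continuousM _ _ (fun=> c)); first exact: cst_continuous.
  apply: (@cvg_big _ _ _ _ _ _ _ (nbhs x)) => [|k _]; first exact: add_continuous.
  rewrite /term; case: eqP => _.
    apply: (@continuousB _ _ _ (fun x => m.+1%:R * d * y x k)).
      by apply: (@continuousM _ _ (fun=> _)); [exact: cst_continuous | exact: ycont].
    apply: (@continuousM _ _ (fun=> m%:R)); first exact: cst_continuous.
    by apply: (@continuousM _ _ (y ^~ k)); exact: ycont.
  by apply: (@continuousM _ _ (y ^~ k)); exact: ycont.
have pH : H p by apply/HP; rewrite /y subrr; split=> // k; rewrite subrr normr0 ltW.
have cH : compact H.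
  by apply: rV_compact => k; rewrite /A; case: eqP => _; exact: segment_compact.
have [z zH zmax] := EVT_max_rV (ex_intro _ p pH) cH wcont.
move: zH; rewrite inE => zH.
have {}zmax x : H x -> w x <= w z by move=> Hx; apply: zmax; rewrite inE.
have [zd zi] := (HP z).1 zH.
have [Uz uz] := HM _ (HQ _ zH); have [Usz usz] := HM _ (HsQ _ zH).
(* The maximum point [z] of [w] on the half cube lies on the mirror, where the odd part vanishes, or
   on a face, where the barrier dominates, or in the interior. The interior is impossible because
   the Laplacian of [w] is 2 c > 0. *)
have wz : w z <= 0.
  have [zi0|zi0] := eqVneq (y z i) 0.
    have -> : w z = - psi z by rewrite /w /sg zi0 mulr0 scale0r subr0 subrr sub0r.
    by rewrite oppr_le0 psi_ge0.
  have [/existsP[k /eqP zk]|] := boolP [exists k, `|y z k| == d].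
    have tk : d ^+ 2 <= term k z.
      rewrite /term; case: eqP => [ki|_]; last by rewrite -zk real_normK ?num_real.
      by move: zk; rewrite ki (ger0_norm zi) => ->; rewrite -natr1; nra.
    have ps : 2 * M <= psi z.
      have -> : 2 * M = c * d ^+ 2 by rewrite /c divfK // expf_neq0 // gt_eqF.
      rewrite ler_pM2l // (bigD1 k) //=; apply: (le_trans tk); rewrite lerDl.
      by apply: sumr_ge0 => j _; exact: term_ge0.
    move: uz usz; rewrite /w !ler_norml => /andP[? ?] /andP[? ?]; lra.
  move=> /existsPn zlt; exfalso.
  have {}zlt k : `|y z k| < d by rewrite lt_neqAle zlt zd.
  have {}zi0 : 0 < y z i by rewrite lt0r zi0.
  pose q j : R := if j == i then - m%:R * c else c.
  have g2 j : pd j (pd j u) z - pd j (pd j u) (sg z) - 2 * q j <= 0.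
    (* The reflection reverses direction [i] only; the sign enters the first derivative and squares
       to 1 in the second. *)
    pose ep : R := if j == i then -1 else 1.
    have sgl (s : R) : sg (z + s *: E j) = sg z + s *: (ep *: E j).
      apply/rowP => k; rewrite /sg -!scaleNr scalerA !shift_dirvecE /y shift_dirvecE /ep.
      by have [->|ji] := eqVneq j i; rewrite /= -![_ *: _]/(_ * _); ring.
    have yl (s : R) k : y (z + s *: E j) k = y z k + s * (k == j)%:R.
      by rewrite /y shift_dirvecE; ring.
    pose rho := Num.min (y z i) (d - `|y z j|).
    have rho0 : 0 < rho by rewrite lt_min zi0 subr_gt0 zlt.
    have lH (s : R) : `|s| < rho -> H (z + s *: E j).
      rewrite lt_min => /andP[s1 s2]; apply/HP; split=> [k|].
        rewrite yl; case: eqP => [->|_]; last by rewrite mulr0 addr0.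
        by rewrite mulr1; apply: (le_trans (ler_normD _ _)); lra.
      rewrite yl; case: eqP => _; last by rewrite mulr0 addr0 ltW.
      by rewrite mulr1; move: s1; rewrite ltr_norml => /andP[? ?]; lra.
    have [b psil] : exists b, forall s : R, psi (z + s *: E j) = psi z + (b * s + q j * s ^+ 2).
      exists (c * if j == i then m.+1%:R * d - 2 * m%:R * y z i else 2 * y z j) => s.
      rewrite /psi (bigD1 j) //= [X in _ = c * X + _](bigD1 j) //=.
      rewrite (eq_bigr (term^~ z)); last first.
        by move=> k kj; rewrite /term yl (negbTE kj) mulr0 addr0.
      rewrite /term /q yl eqxx mulr1.
      by have [->|_] := eqVneq j i; ring.
    pose g (s : R) := w (z + s *: E j).
    pose g1 (s : R) := pd j u (z + s *: E j) - ep * pd j u (sg z + s *: (ep *: E j))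
                       - (b + 2 * q j * s).
    apply: (@second_derivative_max R g g1 _ rho rho0) => [s sr||s sr].
    - have [Us _] := HM _ (HQ _ (lH _ sr)); have [Us' _] := HM _ (HsQ _ (lH _ sr)).
      have -> : g = (fun s => u (z + s *: E j)) - (fun s => u (sg z + s *: (ep *: E j)))
                    - (fun s => psi z + (b * s + q j * s ^+ 2)).
        by apply/funext => s'; rewrite /g /w sgl psil.
      apply: is_deriveB; first apply: is_deriveB.
      + apply: is_derive_line; apply: is_derive_D.
        by have [_ /(_ j)[]] := Hu _ Us.
      + apply: is_derive_line; apply: is_deriveZv; apply: is_derive_D; rewrite -sgl.
        by have [_ /(_ j)[]] := Hu _ Us'.
      + exact: is_derive_quad.
    - have -> : g1 = (fun s => pd j u (z + s *: E j))
           - ep *: (fun s => pd j u (sg z + s *: (ep *: E j)))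
           - (fun s => b + 2 * q j * s) by apply/funext.
      apply: is_deriveB; first apply: is_deriveB.
      + apply: is_derive_line; rewrite scale0r addr0; apply: is_derive_D.
        by have [_ _ /(_ j j)[]] := Hu _ Uz.
      + have H1 : is_derive (0 : R) 1 (fun s : R => pd j u (sg z + s *: (ep *: E j)))
                   (ep * pd j (pd j u) (sg z)).
          apply: is_derive_line; apply: is_deriveZv; rewrite scale0r addr0.
          by apply: is_derive_D; have [_ _ /(_ j j)[]] := Hu _ Usz.
        apply: is_derive_eq; rewrite -[_ *: _]/(_ * _) mulrA /ep.
        by case: eqP => _; rewrite ?mulrNN mul1r mul1r.
      + have -> : (fun s : R => b + 2 * q j * s) = (fun s => b + (2 * q j * s + 0 * s ^+ 2)).
          by apply/funext => s; ring.
        by apply: is_derive_eq (is_derive_quad _ _ _ _) _; ring.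
    - rewrite /g scale0r addr0; exact: zmax (lH _ sr).
  have : \sum_j (pd j (pd j u) z - pd j (pd j u) (sg z) - 2 * q j) <= 0 by apply: sumr_le0.
  have -> : \sum_j (pd j (pd j u) z - pd j (pd j u) (sg z) - 2 * q j) = 0 - 0 - \sum_j 2 * q j.
    rewrite !sumrB; congr (_ - _ - _); first by have [] := Hu _ Uz.
    by have [] := Hu _ Usz.
  rewrite subr0 sub0r -mulr_sumr (bigD1 i) //= {1}/q eqxx.
  rewrite (eq_bigr (fun=> c)); last by move=> k ki; rewrite /q (negbTE ki).
  rewrite sumr_const cardC1 card_ord oppr_le0.
  have -> : 2 * (- m%:R * c + c *+ m.-1) = - (2 * c).
    have m0 : (0 < m)%N by apply: leq_ltn_trans (ltn_ord i).
    by rewrite -[X in - X%:R](prednK m0) -natr1 -mulr_natl; ring.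
  lra.
apply: (@derive_le_central R _ u p (E i) _ _ d d0).
  apply: is_derive_D; have /HM[Up _] : `|p - p| <= d by rewrite subrr normr0 ltW.
  by have [_ /(_ i)[]] := Hu _ Up.
move=> s s0 sd.
have yp k : y (p + s *: E i) k = s * (k == i)%:R.
  by rewrite /y shift_dirvecE; ring.
have Hs : H (p + s *: E i).
  apply/HP; split=> [k|]; last by rewrite yp eqxx mulr1 ltW.
  by rewrite yp; case: eqP => _; rewrite ?mulr1 ?mulr0 ?normr0 ?gtr0_norm // ltW.
have := le_trans (zmax _ Hs) wz; rewrite /w.
have -> : sg (p + s *: E i) = p - s *: E i.
  by rewrite /sg yp eqxx mulr1 mulr_natl mulr2n scalerDl opprD addrA addrK.
have -> : psi (p + s *: E i) = c * (m.+1%:R * d * s - m%:R * s ^+ 2).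
  rewrite /psi (bigD1 i) //= big1 ?addr0 => [|k ki].
    by rewrite /term eqxx yp eqxx mulr1.
  by rewrite /term (negbTE ki) yp (negbTE ki) mulr0 expr0n.
rewrite subr_le0 => /le_trans; apply.
have -> : m.+1%:R * M / d * s * 2 = c * (m.+1%:R * d * s).
  by rewrite /c; field; rewrite gt_eqF.
by rewrite ler_pM2l // gerBl mulr_ge0 // sqr_ge0.
Qed.

End Harmonic.

Section Quotients.
Context {R : realType} {V : normedModType R}.
Implicit Types (f H : V -> R) (x v : V).

Lemma norm_derive_le f x v (d K del : R) : 0 < del -> is_derive x v f d ->
  (forall s : R, `|s| < del -> `|f (x + s *: v) - f x| <= K * `|s|) -> `|d| <= K.
Proof.
move=> del0 Hd HK; apply/ler_addgt0Pr => e e0.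
have [r r0 Hr] := (is_deriveP _ _ _ _ _).1 Hd _ e0.
have [s [s0]] := pos_lt_both _ _ r0 del0; rewrite -(gtr0_norm s0) => /Hr H1 /HK H2.
rewrite -(@ler_pM2r _ `|s|) ?normr_gt0 ?gt_eqF // -normrM mulrDl.
have -> : d * s = (f (x + s *: v) - f x) - (f (x + s *: v) - f x - s * d) by ring.
by apply: (le_trans (ler_normB _ _)); exact: lerD.
Qed.

(** The hypothesis says that the quotients for [h] and [h'] differ by at most C (|h| + |h'|),
    cleared of denominators. They are Cauchy as the increments tend to 0, and letting [h'] tend to 0
    gives the quadratic remainder. *)
Lemma derivable_cauchy_quotient H x v (del C : R) : 0 < del -> 0 < C ->
  (forall h h' : R, h != 0 -> h' != 0 -> `|h| < del -> `|h'| < del ->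
     `|h' * (H (x + h *: v) - H x) - h * (H (x + h' *: v) - H x)| <=
       C * `|h| * `|h'| * (`|h| + `|h'|)) ->
  derivable H x v /\
  forall h : R, `|h| < del -> `|H (x + h *: v) - H x - h * 'D_v H x| <= C * `|h| ^+ 2.
Proof.
move=> del0 C0 HC.
have dH : derivable H x v.
  apply: cauchy_cvg; apply: cauchy_exP => e e0.
  have eC : 0 < e / (2 * C) by rewrite divr_gt0 // mulr_gt0.
  have [h0 [h00 hdel he]] := pos_lt_both _ _ del0 eC.
  exists (h0^-1 * (H (x + h0 *: v) - H x)).
  rewrite nbhs_simpl /=; near=> h.
  have hn0 : h != 0 by near: h; exact: nbhs_dnbhs_neq.
  have hh0 : `|h| < h0 by near: h; exact: dnbhs0_lt.
  rewrite /ball /= (addrC (h *: v)) -[h^-1 *: _]/(h^-1 * _).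
  have -> : h0^-1 * (H (x + h0 *: v) - H x) - h^-1 * (H (x + h *: v) - H x) =
     (h * (H (x + h0 *: v) - H x) - h0 * (H (x + h *: v) - H x)) / (h * h0).
    by field; rewrite hn0 gt_eqF.
  have hh : 0 < `|h * h0| by rewrite normr_gt0 mulf_neq0 // gt_eqF.
  rewrite normf_div ltr_pdivrMr //.
  have := HC h0 h; rewrite (gtr0_norm h00) => /(_ (lt0r_neq0 h00) hn0 hdel (lt_trans hh0 hdel)) /le_lt_trans; apply.
  have -> : C * h0 * `|h| * (h0 + `|h|) = (C * (h0 + `|h|)) * `|h * h0|.
    by rewrite normrM (gtr0_norm h00); ring.
  rewrite ltr_pM2r //; move: he; rewrite ltr_pdivlMr ?mulr_gt0 // => he.
  have : C * (h0 + `|h|) <= C * (h0 + h0) by rewrite ler_pM2l // lerD2l ltW.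
  by move=> /le_lt_trans; apply; lra.
split=> // h hd; have [->|h0] := eqVneq h 0.
  by rewrite scale0r addr0 subrr mul0r subrr !normr0 expr0n mulr0.
apply/ler_addgt0Pr => e e0.
(* [K] collects the two errors of replacing the limit by a small increment [h1], the difference
   quotient at [h1] and the extra C |h| h1^2, so that together they cost exactly [e]. *)
pose K := `|h| * (C * `|h| + 1 ).
have hp : 0 < `|h| by rewrite normr_gt0.
have Ch : 0 < C * `|h| by rewrite mulr_gt0.
have K0 : 0 < K by rewrite mulr_gt0 // addr_gt0.
pose eta := e / K; have eta0 : 0 < eta by rewrite divr_gt0.
have [r r0 Hr] := (is_deriveP _ _ _ _ _).1 (derivableP dH) _ eta0.
have [h2 [h20 h2r h2d]] := pos_lt_both _ _ r0 del0.
have [h1 [h10 h12 h1e]] := pos_lt_both _ _ h20 (mulr_gt0 eta0 hp).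
have [h1r h1d] := (lt_trans h12 h2r, lt_trans h12 h2d).
have nh1 : `|h1| = h1 by rewrite gtr0_norm.
have := HC h h1 h0 (lt0r_neq0 h10) hd; rewrite nh1 => /(_ h1d) A1.
have := Hr h1; rewrite nh1 => /(_ h1r) A2.
rewrite -(@ler_pM2r _ h1) // -[X in _ * X <= _]nh1 -normrM.
set a := H (x + h *: v) in A1 *; set b := H (x + h1 *: v) in A1 A2.
set d := derive H x v in A2 *.
have -> : (a - H x - h * d) * h1 = (h1 * (a - H x) - h * (b - H x)) + h * (b - H x - h1 * d).
  by ring.
apply: (le_trans (ler_normD _ _)); rewrite [X in _ + X]normrM.
have A3 : `|h| * `|b - H x - h1 * d| <= `|h| * (eta * h1) by rewrite ler_pM2l.
apply: (le_trans (lerD A1 A3)).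
have -> : (C * `|h| ^+ 2 + e) * h1 = C * `|h| ^+ 2 * h1 + eta * K * h1.
  by rewrite /eta divfK ?gt_eqF //; ring.
have A4 : C * `|h| * h1 * h1 <= C * `|h| * h1 * (eta * `|h|).
  by rewrite ler_pM2l ?mulr_gt0 // ltW.
by rewrite /K; lra.
Unshelve. all: by end_near. Qed.

(** [g] is a uniform limit of the continuous difference quotients of [H]. One fixed increment below
    e / (4 C) suffices, with the error split into four parts. *)
Lemma continuous_quotient_limit H (g : V -> R) p v (r del C : R) :
  0 < r -> 0 < del -> 0 < C ->
  (forall h : R, `|h| < del -> {for p + h *: v, continuous H}) ->
  (forall x (h : R), `|x - p| < r -> `|h| < del ->
     `|H (x + h *: v) - H x - h * g x| <= C * `|h| ^+ 2) ->
  {for p, continuous g}.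
Proof.
move=> r0 del0 C0 cH HC; apply/continuousP_norm => e e0.
have eC : 0 < e / (4 * C) by rewrite divr_gt0 // mulr_gt0.
have [h [h0 hdel]] := pos_lt_both _ _ del0 eC; rewrite ltr_pdivlMr ?mulr_gt0 // => he.
have nh : `|h| = h by rewrite gtr0_norm.
have eh : 0 < e * h / 4 by rewrite divr_gt0 // mulr_gt0.
have [|r1 r10 H1] := (continuousP_norm _ _ _).1 (cH h _) _ eh; first by rewrite nh.
have [|r2 r20 H2] := (continuousP_norm _ _ _).1 (cH 0 _) _ eh; first by rewrite normr0.
exists (Num.min r (Num.min r1 r2)); first by rewrite !lt_min r0 r10.
move=> x; rewrite !lt_min => /andP[xr /andP[x1 x2]].
have := HC x h xr; rewrite nh => /(_ hdel) A1.
have := HC p h; rewrite subrr normr0 nh => /(_ r0 hdel) A2.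
have := H1 (x + h *: v); rewrite opprD addrACA subrr addr0 => /(_ x1) A3.
have := H2 x; rewrite scale0r addr0 => /(_ x2) A4.
rewrite -(@ler_pM2r _ h) // -[X in _ * X <= _]nh -normrM.
set a := H (x + h *: v) in A1 A3; set b := H (p + h *: v) in A2 A3.
have -> : (g x - g p) * h = (a - b) - (H x - H p) - (a - H x - h * g x) + (b - H p - h * g p).
  by ring.
apply: (le_trans (ler_normD _ _)).
apply: (le_trans (lerD (ler_normB _ _) (lexx _))).
apply: (le_trans (lerD (lerD (ler_normB _ _) (lexx _)) (lexx _))).
apply: (le_trans (lerD (lerD (lerD A3 A4) A1) A2)).
have : h * (h * (4 * C)) < h * e by rewrite ltr_pM2l.
by lra.
Qed.

End Quotients.

Section HarmonicRegularity.
Context {R : realType} {m : nat}.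
Implicit Types (x y z p : 'rV[R]_m) (u w : 'rV[R]_m -> R) (i j k : 'I_m) (U : set 'rV[R]_m).
Local Notation E i := (@dirvec R m i).

Lemma eq_open_D U i u w x : open U -> U x -> (forall y, U y -> u y = w y) -> pd i u x = pd i w x.
Proof.
move=> /openP_norm oU /oU[r r0 Hr] H; apply: (eq_near_D _ _ _ _ _ r0) => y /Hr; exact: H.
Qed.

Lemma eq_open_is_derive U v u w x d : open U -> U x -> (forall y, U y -> u y = w y) ->
  is_derive x v u d -> is_derive x v w d.
Proof.
move=> /openP_norm oU /oU[r r0 Hr] H; apply: (eq_near_is_derive _ _ _ _ _ _ r0) => y /Hr; exact: H.
Qed.

Lemma eq_open_continuous U u w x : open U -> U x -> (forall y, U y -> u y = w y) ->
  {for x, continuous u} -> {for x, continuous w}.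
Proof.
move=> oU Ux H /continuousP_norm cu; apply/continuousP_norm => e /cu[r r0 Hr].
have [r' r'0 Hr'] := (openP_norm _ _).1 oU _ Ux.
exists (Num.min r r'); first by rewrite lt_min r0.
by move=> y; rewrite lt_min => /andP[/Hr ? /Hr' ?]; rewrite -!H.
Qed.

Lemma is_derive_shift_rV v u (t0 : 'rV[R]_m) x d :
  is_derive (x + t0) v u d -> is_derive x v (fun x => u (x + t0)) d.
Proof.
apply: (@is_derive_affine _ _ _ _ u (fun x => x + t0)) => h; by rewrite -addrA.
Qed.

Lemma continuous_shift_rV u (t0 : 'rV[R]_m) x :
  {for x + t0, continuous u} -> {for x, continuous (fun x => u (x + t0))}.
Proof.
move=> /continuousP_norm H; apply/continuousP_norm => e /H[r r0 Hr]; exists r => // y yx.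
by apply: Hr; rewrite opprD addrACA subrr addr0.
Qed.

Lemma harm_shift U u (t0 : 'rV[R]_m) : harm U u -> harm (fun x => U (x + t0)) (fun x => u (x + t0)).
Proof.
move=> Hu x Ux; have [c1 d1 d2 l] := Hu _ Ux; split.
- exact: continuous_shift_rV.
- move=> i; have [a b] := d1 i; rewrite pd_shift; split; last exact: continuous_shift_rV.
  by have [] := is_derive_shift_rV _ _ _ _ _ (derivableP a).
- move=> i j; have [a b] := d2 i j; rewrite !pd_shift; split; last exact: continuous_shift_rV.
  by have [] := is_derive_shift_rV _ _ _ _ _ (derivableP a).
- by rewrite -[RHS]l; apply: eq_bigr => i _; rewrite !pd_shift.
Qed.

Lemma is_derive_lin v u w x (a b d d' : R) : is_derive x v u d -> is_derive x v w d' ->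
  is_derive x v (fun x => a * u x + b * w x) (a * d + b * d').
Proof.
move=> H1 H2; have -> : (fun x => a * u x + b * w x) = a *: u + b *: w by apply/funext.
exact: is_deriveD.
Qed.

Lemma continuous_lin u w x (a b : R) : {for x, continuous u} -> {for x, continuous w} ->
  {for x, continuous (fun x => a * u x + b * w x)}.
Proof.
move=> H1 H2; apply: (@continuousD _ _ _ (fun x => a * u x) (fun x => b * w x)).
  by apply: (@continuousM _ _ (fun=> a)) => //; exact: cst_continuous.
by apply: (@continuousM _ _ (fun=> b)) => //; exact: cst_continuous.
Qed.

Lemma harm_lin U u w (a b : R) : open U -> harm U u -> harm U w ->
  harm U (fun x => a * u x + b * w x).
Proof.
move=> oU Hu Hw.
have D1 i y : U y -> pd i (fun x => a * u x + b * w x) y = a * pd i u y + b * pd i w y.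
  move=> Uy; apply: D_val; apply: is_derive_lin; apply: is_derive_D.
    by have [_ /(_ i)[]] := Hu _ Uy.
  by have [_ /(_ i)[]] := Hw _ Uy.
have D1' i y : U y -> a * pd i u y + b * pd i w y = pd i (fun x => a * u x + b * w x) y.
  by move=> Uy; rewrite D1.
have isD2 i j y : U y -> is_derive y (E j) (pd i (fun x => a * u x + b * w x))
    (a * pd j (pd i u) y + b * pd j (pd i w) y).
  move=> Uy; apply: (eq_open_is_derive _ _ _ _ _ _ oU Uy (D1' i)).
  apply: is_derive_lin; apply: is_derive_D.
    by have [_ _ /(_ i j)[]] := Hu _ Uy.
  by have [_ _ /(_ i j)[]] := Hw _ Uy.
move=> x Ux; have [c1 d1 d2 l1] := Hu _ Ux; have [c1' d1' d2' l1'] := Hw _ Ux; split.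
- exact: continuous_lin.
- move=> i; have [e1 e2] := d1 i; have [e1' e2'] := d1' i; split.
    by have [] := is_derive_lin _ _ _ _ a b _ _ (derivableP e1) (derivableP e1').
  apply: (eq_open_continuous _ _ _ _ oU Ux (D1' i)); exact: continuous_lin.
- move=> i j; have [] := isD2 i j _ Ux; split => //.
  have H y : U y -> a * pd j (pd i u) y + b * pd j (pd i w) y =
      pd j (pd i (fun x => a * u x + b * w x)) y.
    by move=> Uy; rewrite (D_val _ _ _ _ (isD2 i j y Uy)).
  apply: (eq_open_continuous _ _ _ _ oU Ux H); apply: continuous_lin.
    by have [] := d2 i j.
  by have [] := d2' i j.
- rewrite (eq_bigr (fun i => a * pd i (pd i u) x + b * pd i (pd i w) x)).
    by rewrite big_split /= -!mulr_sumr l1 l1' !mulr0 addr0.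
  by move=> i _; rewrite (D_val _ _ _ _ (isD2 i i x Ux)).
Qed.

Lemma harm_sub U U' u : (forall x, U' x -> U x) -> harm U u -> harm U' u.
Proof. by move=> H Hu x /H /Hu. Qed.

Lemma open_norm_ball p (r : R) : open [set x | `|x - p| < r].
Proof.
apply/openP_norm => x /= xr; exists (r - `|x - p|); first by rewrite subr_gt0.
move=> y yx; rewrite -[y](subrK x) -addrA.
by apply: (le_lt_trans (ler_normD _ _)); lra.
Qed.

(** The m + 1 comes from the barrier; the 2 is lost by fitting a closed cube of half side r / 2 into
    an open ball of radius r. *)
Definition grad_cst : R := 2 * m.+1%:R.
Lemma grad_cst_gt0 : 0 < grad_cst. Proof. by rewrite mulr_gt0. Qed.

Lemma harm_grad_bound U u p (r M : R) i : 0 < r -> 0 < M -> harm U u ->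
  (forall x, `|x - p| < r -> U x /\ `|u x| <= M) ->
  `|pd i u p| <= grad_cst * M / r.
Proof.
move=> r0 M0 Hu HM; pose V := [set x : 'rV[R]_m | `|x - p| < r].
have oV : open V := open_norm_ball _ _.
have HV : harm V u by apply: harm_sub Hu => x /HM[].
have HV' : harm V (fun x => -1 * u x + 0 * u x) by exact: harm_lin.
have r2 : 0 < r / 2 by rewrite divr_gt0.
have HM' x : `|x - p| <= r / 2 -> V x /\ `|u x| <= M.
  move=> xr; have xr' : `|x - p| < r by lra.
  by split => //; have [] := HM _ xr'.
have E1 : grad_cst * M / r = m.+1%:R * M / (r / 2) by rewrite /grad_cst; field; rewrite gt_eqF.
rewrite E1 ler_norml; apply/andP; split; last exact: (harm_partial_le _ _ _ _ _ _ r2 M0 HV HM').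
have pV : V p by rewrite /V /= subrr normr0.
rewrite lerNl; have := harm_partial_le _ _ p _ _ i r2 M0 HV'.
have -> : pd i (fun x => -1 * u x + 0 * u x) p = - pd i u p.
  transitivity (-1 * pd i u p + 0 * pd i u p); last by ring.
  apply: D_val.
  by apply: is_derive_lin; apply: is_derive_D; have [_ /(_ i)[]] := HV _ pV.
by apply=> x /HM'[? ?]; split; rewrite // mulN1r mul0r addr0 normrN.
Qed.

(** The gradient bound cannot be applied to [pd j u], which is not yet known to be harmonic. It is
    applied to the translation difference u(x + s e_i) - u(x), which is harmonic and at most |s|
    times the gradient bound; dividing by s gives the second derivative. *)
Lemma harm_hess_bound U u p (r M : R) i j : 0 < r -> 0 < M -> harm U u ->
  (forall x, `|x - p| < 2 * r -> U x /\ `|u x| <= M) ->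
  `|pd i (pd j u) p| <= 2 * grad_cst ^+ 2 / r ^+ 2 * M.
Proof.
move=> r0 M0 Hu HM; pose K := grad_cst * M / r.
have K0 : 0 < K by rewrite divr_gt0 // mulr_gt0 // grad_cst_gt0.
have gradK x k : `|x - p| < r -> `|pd k u x| <= K.
  move=> xr; apply: (harm_grad_bound U) => // y yx; apply: HM.
  by rewrite -[y](subrK x) -addrA; apply: (le_lt_trans (ler_normD _ _)); lra.
have [|Up _] := HM p; first by rewrite subrr normr0; lra.
have r2 : 0 < r / 2 by rewrite divr_gt0.
have dij : is_derive p (E i) (pd j u) (pd i (pd j u) p).
  by apply: is_derive_D; have [_ _ /(_ j i)[]] := Hu _ Up.
apply: (norm_derive_le _ _ _ _ _ _ r2 dij) => s sr.
have [->|s0] := eqVneq s 0; first by rewrite scale0r addr0 subrr !normr0 mulr0.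
pose V := [set x : 'rV[R]_m | `|x - p| < r / 2].
have oV : open V := open_norm_ball _ _.
have shiftr x : `|x - p| < r / 2 -> `|x + s *: E i - p| < r.
  move=> xr; have := norm_shift_lt _ _ _ _ _ xr (norm_dirvec_le i s); lra.
have H1 : harm V (fun x => u (x + s *: E i)).
  apply: harm_sub (harm_shift _ _ (s *: E i) Hu) => x /shiftr xr.
  by have [] := HM (x + s *: E i); first by lra.
have H2 : harm V u.
  by apply: harm_sub Hu => x xr; have [] := HM x => //; move: xr; rewrite /V /=; lra.
have H3 := harm_lin _ _ _ 1 (-1) oV H1 H2.
have sK : 0 < `|s| * K by rewrite mulr_gt0 ?normr_gt0.
have := harm_grad_bound _ _ p (r / 2) (`|s| * K) j r2 sK H3.
have -> : pd j (fun x => 1 * u (x + s *: E i) + -1 * u x) p = pd j u (p + s *: E i) - pd j u p.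
  transitivity (1 * pd j u (p + s *: E i) + -1 * pd j u p); last by ring.
  apply: D_val.
  have Vp : V p by rewrite /V /= subrr normr0.
  apply: is_derive_lin; last by apply: is_derive_D; have [_ /(_ j)[]] := H2 _ Vp.
  apply: is_derive_shift_rV; apply: is_derive_D.
  have [|Us _] := HM (p + s *: E i); first by have := shiftr p Vp; lra.
  by have [_ /(_ j)[]] := Hu _ Us.
move=> H; apply: le_trans (H _) _; last first.
  by rewrite /K; apply/eq_ler; field; rewrite gt_eqF.
move=> x xr; split => //; rewrite mul1r mulN1r.
have inr (c : R) : 0 <= c <= 1 -> `|x + (c * s) *: E i - p| < r.
  move=> /andP[c00 c1]; have := norm_shift_lt _ _ _ _ _ xr (norm_dirvec_le i (c * s)).
  by rewrite normrM (ger0_norm c00); have := ler_piMl (normr_ge0 s) c1; lra.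
have [c c01|c c01 ->] := @MVT_line R _ u x (s *: E i) (fun c => s * pd i u (x + (c * s) *: E i)).
  rewrite scalerA; apply: is_deriveZv; apply: is_derive_D.
  have [|Us _] := HM (x + (c * s) *: E i); first by have := inr _ c01; lra.
  by have [_ /(_ i)[]] := Hu _ Us.
by rewrite normrM ler_wpM2l //; apply: gradK; exact: inr.
Qed.

(* The remainders u(x + h e_j) - u(x) - h d_j u(x) are O(h^2); two of them combine into a
   harmonic function, and the Hessian estimate for it says that the difference quotients
   of [pd i (pd k u)] are Cauchy. *)
Lemma harm_third U u : open U -> harm U u -> forall p i k j, U p ->
  derivable (pd i (pd k u)) p (E j) /\ {for p, continuous (pd j (pd i (pd k u)))}.
Proof.
move=> oU Hu p i k j Up.
have [r1 r10 HU] := (openP_norm _ _).1 oU _ Up.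
have [_ _ d2 _] := Hu _ Up; have [B [r2 [B0 r20 HB]]] := locally_bounded_at _ _ _ (d2 j j).2.
(* Room for [x] within r of [p], a ball of radius 2 r around [x] for the Hessian bound, and a
   translation shorter than r. *)
pose r := Num.min r1 r2 / 5.
have m0 : 0 < Num.min r1 r2 by rewrite lt_min r10.
have r0 : 0 < r by rewrite divr_gt0.
have r5 x : `|x - p| < 5 * r -> U x /\ `|pd j (pd j u) x| <= B.
  have -> : 5 * r = Num.min r1 r2 by rewrite /r; field.
  by rewrite lt_min => /andP[/HU ? /HB].
pose dl (h : R) x := u (x + h *: E j) - u x - h * pd j u x.
have shiftr x (h c : R) (q : R) : 0 <= c <= 1 -> `|h| < r -> `|x - p| < q ->
    `|x + (c * h) *: E j - p| < q + r.
  move=> /andP[c00 c1] hr xq; have := norm_shift_lt _ _ _ _ _ xq (norm_dirvec_le j (c * h)).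
  by rewrite normrM (ger0_norm c00); have := ler_piMl (normr_ge0 h) c1; lra.
have dlB (h : R) x : `|h| < r -> `|x - p| < 3 * r -> `|dl h x| <= B * `|h| ^+ 2.
  move=> hr xr.
  have [c c01|c c01 Ec] := @MVT_line R _ u x (h *: E j) (fun c => h * pd j u (x + (c * h) *: E j)).
    rewrite scalerA; apply: is_deriveZv; apply: is_derive_D.
    have [|Us _] := r5 (x + (c * h) *: E j); first by have := shiftr _ _ _ _ c01 hr xr; lra.
    by have [_ /(_ j)[]] := Hu _ Us.
  have r5' c' : 0 <= c' <= 1 -> U (x + (c' * (c * h)) *: E j) /\
      `|pd j (pd j u) (x + (c' * (c * h)) *: E j)| <= B.
    move=> c'01; apply: r5; have cc : 0 <= c' * c <= 1.
      move: c01 c'01 => /andP[a b] /andP[a' b']; rewrite mulr_ge0 //=.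
      by apply: (le_trans (ler_piMl a b')).
    by rewrite mulrA; have := shiftr _ _ _ _ cc hr xr; lra.
  have [c' c'01|c' c'01 Ec'] := @MVT_line R _ (pd j u) x ((c * h) *: E j)
      (fun c' => c * h * pd j (pd j u) (x + (c' * (c * h)) *: E j)).
    rewrite scalerA; apply: is_deriveZv; apply: is_derive_D.
    by have [Us _] := r5' c' c'01; have [_ _ /(_ j j)[]] := Hu _ Us.
  rewrite /dl Ec -mulrBr Ec' !normrM expr2.
  have [_ Bs] := r5' c' c'01.
  move: c01 => /andP[a b]; rewrite (ger0_norm a) [leRHS]mulrCA ler_wpM2l //.
  rewrite -mulrA mulrCA [leRHS]mulrC ler_wpM2l //.
  by apply: (le_trans (ler_wpM2l a Bs)); rewrite ler_piMl // ltW.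
pose H := pd i (pd k u).
pose C := 2 * grad_cst ^+ 2 / r ^+ 2 * B.
have C0 : 0 < C.
  by rewrite mulr_gt0 // divr_gt0 ?exprn_gt0 // mulr_gt0 // exprn_gt0 // grad_cst_gt0.
have key x : `|x - p| < r -> forall h h' : R, h != 0 -> h' != 0 -> `|h| < r -> `|h'| < r ->
   `|h' * (H (x + h *: E j) - H x) - h * (H (x + h' *: E j) - H x)| <=
       C * `|h| * `|h'| * (`|h| + `|h'|).
  move=> xr h h' h0 h'0 hr h'r.
  pose V := [set x : 'rV[R]_m | `|x - p| < 3 * r].
  have oV : open V := open_norm_ball _ _.
  have HVU (s : R) y : `|s| < r -> V y -> U (y + s *: E j).
    move=> sr yr; have [] // := r5 (y + s *: E j).
    have c11 : 0 <= (1 : R) <= 1 by rewrite ler01 lexx.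
    by have := shiftr y s 1 _ c11 sr yr; rewrite mul1r; lra.
  have HV (s : R) : `|s| < r -> harm V (fun x => u (x + s *: E j)).
    by move=> sr; apply: harm_sub (harm_shift _ _ (s *: E j) Hu) => y yr; exact: HVU.
  have HV0 : harm V u.
    by apply: harm_sub Hu => y yr; have [] // := r5 y; move: yr; rewrite /V /=; lra.
  (* The combination h' dl(h) - h dl(h') of remainders loses its terms in [pd j u]. What is left,
     [w], involves translates of [u] only, so its harmonicity needs no derivative of [u] to be
     harmonic, while the remainders still bound it by B |h| |h'| (|h| + |h'|). *)
  have W1 := harm_lin _ _ _ h' (- h) oV (HV _ hr) (HV _ h'r).
  have W := harm_lin _ _ _ 1 (h - h') oV W1 HV0.
  set w := fun x => _ in W.
  have M0 : 0 < B * `|h| * `|h'| * (`|h| + `|h'|).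
    by rewrite !mulr_gt0 ?normr_gt0 // addr_gt0 ?normr_gt0.
  have ball2 y : `|y - x| < 2 * r -> V y.
    by rewrite /V /= -[y - p](subrKA x) => yr; apply: (le_lt_trans (ler_normD _ _)); lra.
  have Vx : V x by rewrite /V /=; lra.
  have := harm_hess_bound _ _ x r _ i k r0 M0 W.
  have -> : pd i (pd k w) x = h' * (H (x + h *: E j) - H x) - h * (H (x + h' *: E j) - H x).
    have Dk y : V y -> h' * pd k u (y + h *: E j) + - h * pd k u (y + h' *: E j)
         + (h - h') * pd k u y = pd k w y.
      move=> Vy; apply/esym/D_val; rewrite -[X in X + _]mul1r; apply: is_derive_lin.
        apply: is_derive_lin; apply: is_derive_shift_rV; apply: is_derive_D.
          by have [_ /(_ k)[]] := Hu _ (HVU _ _ hr Vy).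
        by have [_ /(_ k)[]] := Hu _ (HVU _ _ h'r Vy).
      by apply: is_derive_D; have [_ /(_ k)[]] := HV0 _ Vy.
    rewrite -(eq_open_D V i _ _ x oV Vx Dk).
    have -> : h' * (H (x + h *: E j) - H x) - h * (H (x + h' *: E j) - H x) =
      1 * (h' * H (x + h *: E j) + - h * H (x + h' *: E j)) + (h - h') * H x by ring.
    apply: D_val.
    have -> : (fun y => h' * pd k u (y + h *: E j) + - h * pd k u (y + h' *: E j)
         + (h - h') * pd k u y) = (fun y => 1 * (h' * pd k u (y + h *: E j)
          + - h * pd k u (y + h' *: E j)) + (h - h') * pd k u y).
      by apply/funext => y; ring.
    apply: is_derive_lin; last by apply: is_derive_D; have [_ _ /(_ k i)[]] := HV0 _ Vx.
    apply: is_derive_lin; apply: is_derive_shift_rV; apply: is_derive_D.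
      by have [_ _ /(_ k i)[]] := Hu _ (HVU _ _ hr Vx).
    by have [_ _ /(_ k i)[]] := Hu _ (HVU _ _ h'r Vx).
  move=> A; apply: (le_trans (A _)); last first.
    by rewrite /C; apply/eq_ler; ring.
  move=> y /ball2 Vy; split => //.
  have -> : w y = h' * dl h y - h * dl h' y by rewrite /w /dl; ring.
  apply: (le_trans (ler_normB _ _)); rewrite !normrM.
  have A1 := ler_wpM2l (normr_ge0 h') (dlB _ _ hr Vy).
  have A2 := ler_wpM2l (normr_ge0 h) (dlB _ _ h'r Vy).
  by apply: (le_trans (lerD A1 A2)); apply/eq_ler; ring.
have pr : `|p - p| < r by rewrite subrr normr0.
split; first by have [] := derivable_cauchy_quotient _ _ _ _ _ r0 C0 (key p pr).
apply: (continuous_quotient_limit H _ p (E j) r r C r0 r0 C0).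
  move=> h hr; have [|Us _] := r5 (p + h *: E j).
    have := norm_shift_lt _ _ _ _ _ pr (norm_dirvec_le j h); lra.
  by have [_ _ /(_ k i)[]] := Hu _ Us.
move=> x h xr hr.
by rewrite pdE; have [_ /(_ h hr)] := derivable_cauchy_quotient _ _ _ _ _ r0 C0 (key x xr).
Qed.

Lemma D_comm U u i j x : open U -> U x ->
  (forall y k, U y -> derivable u y (E k)) ->
  (forall y, U y -> derivable (pd i u) y (E j)) ->
  {for x, continuous (pd j (pd i u))} -> pd i (pd j u) x = pd j (pd i u) x.
Proof.
move=> oU Ux d1 d2 c2; apply: D_val.
have [r r0 Hr] := (openP_norm _ _).1 oU _ Ux.
apply: (is_derive_schwarz _ u (pd i u) (pd j u) _ _ _ _ r r0 _ _ _ c2) => z /Hr Uz;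
  apply: is_derive_D; [exact: d1 | exact: d1 | exact: d2].
Qed.

(** Third derivatives exist and are continuous, so Schwarz's theorem moves [pd j] outside the
    Laplacian, where it differentiates the zero function. *)
Lemma harm_D U u j : open U -> harm U u -> harm U (pd j u).
Proof.
move=> oU Hu x Ux; have [c1 d1 d2 l] := Hu _ Ux; split.
- by have [] := d1 j.
- by move=> i; have [] := d2 j i.
- by move=> i k; apply: (harm_third U).
have cm i k y : U y -> pd i (pd k u) y = pd k (pd i u) y.
  move=> Uy; apply: (D_comm U) => //.
  - by move=> z q /Hu[_ /(_ q)[]].
  - by move=> z /Hu[_ _ /(_ i k)[]].
  - by have [_ _ /(_ i k)[]] := Hu _ Uy.
have step i : pd i (pd i (pd j u)) x = pd j (pd i (pd i u)) x.
  rewrite (eq_open_D U i _ (pd j (pd i u))) //; last by move=> y Uy; rewrite cm.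
  apply: (D_comm U) => //.
  - by move=> z q /Hu[_ _ /(_ i q)[]].
  - by move=> z Uz; have [] := harm_third U u oU Hu z i i j Uz.
  - by have [] := harm_third U u oU Hu x i i j Ux.
rewrite (eq_bigr (fun i => pd j (pd i (pd i u)) x)) //.
have H : is_derive x (E j) (\sum_i pd i (pd i u)) (\sum_i pd j (pd i (pd i u)) x).
  apply: is_derive_sum => i; apply: is_derive_D.
  by have [] := harm_third U u oU Hu x i i j Ux.
rewrite -(D_val _ _ _ _ H) (eq_open_D U j _ (fun=> 0)) //; first exact: pd_cst.
by move=> y Uy; rewrite fct_sumE; have [_ _ _ ->] := Hu _ Uy.
Qed.

(** Words instead of multi-indices: the order of differentiation is kept, the head of the word being
    applied last, and estimates can be proved without commuting derivatives. *)
Definition Dw (w : seq 'I_m) u := foldr pd u w.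

Lemma harm_Dw U u (w : seq 'I_m) : open U -> harm U u -> harm U (Dw w u).
Proof. by move=> oU Hu; elim: w => //= i w IH; exact: harm_D. Qed.

(** One gradient estimate for each letter, each on a ball of radius [d]; the domain shrinks by [d]
    every time. *)
Lemma harm_Dw_bound U u p (r d M : R) (w : seq 'I_m) : open U -> harm U u -> 0 < d -> 0 < M ->
  (forall x, `|x - p| < r + (size w)%:R * d -> U x /\ `|u x| <= M) ->
  forall x, `|x - p| < r -> `|Dw w u x| <= (grad_cst / d) ^+ size w * M.
Proof.
move=> oU Hu d0 M0; elim: w r => [|i w IH] r HM x xr /=.
  by rewrite mul1r; have [] := HM x; rewrite ?mul0r ?addr0.
have cd : 0 < grad_cst / d by rewrite divr_gt0 // grad_cst_gt0.
have -> : (grad_cst / d) ^+ (size w).+1 * M = grad_cst * ((grad_cst / d) ^+ size w * M) / d.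
  by rewrite exprS; field; rewrite gt_eqF.
apply: (harm_grad_bound U) => //; first by rewrite mulr_gt0 // exprn_gt0.
  exact: harm_Dw.
move=> y yx; have yr : `|y - p| < r + d.
  by rewrite -[y - p](subrKA x); apply: (le_lt_trans (ler_normD _ _)); lra.
have E1 : r + d + (size w)%:R * d = r + (size w).+1%:R * d by rewrite -natr1; ring.
split; last by apply: (IH (r + d)) yr => z; rewrite E1; exact: HM.
have [] // := HM y; apply: (lt_le_trans yr); rewrite -E1 lerDl.
by rewrite mulr_ge0 // ltW.
Qed.

End HarmonicRegularity.

(** A substitute for Stirling's formula: k^k is at most the falling factorial of 2 k of length k,
    that is binomial(2 k, k) k!, and the binomial is at most (1 + 1)^(2 k). *)
Lemma expn_self_le_fact k : (k ^ k <= 4 ^ k * k`!)%N.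
Proof.
have H1 : (k ^ k <= (2 * k) ^_ k)%N.
  have {1}-> : (k ^ k = \prod_(i < k) k)%N by rewrite prod_nat_const card_ord.
  rewrite ffact_prod.
  apply: leq_prod => i _; have := ltn_ord i; lia.
have H2 : ('C(2 * k, k) <= 4 ^ k)%N.
  have -> : (4 ^ k = (1 + 1) ^ (2 * k))%N by rewrite expnM.
  have kk : (k < (2 * k).+1)%N by lia.
  by rewrite expnDn (bigD1 (Ordinal kk)) //= !exp1n !muln1 leq_addr.
by apply: (leq_trans H1); rewrite -bin_ffact leq_mul2r H2 orbT.
Qed.

Section AnalyticClass.
Context {R : realType} {m : nat}.
Implicit Types (x y z p : 'rV[R]_m) (u : 'rV[R]_m -> R) (i j k : 'I_m) (U : set 'rV[R]_m).
Local Notation E i := (@dirvec R m i).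

(* Real analyticity, encoded by Cauchy estimates: this form is stable under division
   by a coordinate, and it is what the maximum principle gives for harmonic functions. *)
Definition An_at u p := exists r C M : R, [/\ 0 < r, 0 < C, 0 < M &
  forall x, `|x - p| < r -> forall w : seq 'I_m,
    (forall i, derivable (Dw w u) x (E i)) /\
    `|Dw w u x| <= C * M ^+ size w * (size w)`!%:R].
Definition An U u := forall p, U p -> An_at u p.

Lemma Dw_rcons u (w : seq 'I_m) i : Dw (rcons w i) u = Dw w (pd i u).
Proof. by rewrite /Dw foldr_rcons. Qed.

Lemma eq_Dw U u u' (w : seq 'I_m) x : open U -> (forall y, U y -> u y = u' y) -> U x ->
  Dw w u x = Dw w u' x.
Proof.
move=> oU H; elim: w x => [|i w IH] x Ux /=; first exact: H.
by apply: (eq_open_D U) => // y; exact: IH.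
Qed.

Lemma eq_An_at u u' p (r : R) : 0 < r -> (forall x, `|x - p| < r -> u x = u' x) ->
  An_at u p -> An_at u' p.
Proof.
move=> r0 H [r1 [C [M [r10 C0 M0 Hu]]]].
exists (Num.min r r1), C, M; split => //; first by rewrite lt_min r0.
move=> x; rewrite lt_min => /andP[xr xr1] w; have [d b] := Hu x xr1 w.
have oV := open_norm_ball p r.
have E1 w' y : `|y - p| < r -> Dw w' u y = Dw w' u' y by move=> yr; exact: (eq_Dw _ _ _ _ _ oV H).
split=> [i|]; last by rewrite -E1.
have [] // := eq_open_is_derive _ _ _ (Dw w u') _ _ oV xr (E1 w) (derivableP (d i)).
Qed.

Lemma An_at_near u p : An_at u p -> exists2 r : R, 0 < r & forall x, `|x - p| < r -> An_at u x.
Proof.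
move=> [r [C [M [r0 C0 M0 Hu]]]]; exists (r / 2) => [|x xr]; first by rewrite divr_gt0.
exists (r / 2), C, M; split => //; first by rewrite divr_gt0.
move=> y yx; apply: Hu; rewrite -[y - p](subrKA x).
by apply: (le_lt_trans (ler_normD _ _)); lra.
Qed.

Lemma An_at_derivable u p (w : seq 'I_m) i : An_at u p -> derivable (Dw w u) p (E i).
Proof.
by move=> [r [C [M [r0 C0 M0 Hu]]]]; have [] := Hu p _ w; rewrite ?subrr ?normr0.
Qed.

Lemma An_at_continuous u p (w : seq 'I_m) : An_at u p -> {for p, continuous (Dw w u)}.
Proof.
move=> [r [C [M [r0 C0 M0 Hu]]]].
apply: (@continuous_of_partials _ _ _ (fun i => Dw (i :: w) u) p r
         (C * M ^+ (size w).+1 * ((size w).+1)`!%:R) r0) => z i zr.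
  by apply: is_derive_D; have [/(_ i)] := Hu z zr w.
by have [_] := Hu z zr (i :: w).
Qed.

(** A derivative turns the factorial k! into (k + 1)!; the factor k + 1 is at most 2^k and is paid
    by doubling [M]. *)
Lemma An_at_pd u p i : An_at u p -> An_at (pd i u) p.
Proof.
move=> [r [C [M [r0 C0 M0 Hu]]]]; exists r, (C * M), (2 * M); split; rewrite ?mulr_gt0 //.
move=> x xr w; rewrite -Dw_rcons; have [d b] := Hu x xr (rcons w i); split => //.
apply: (le_trans b); rewrite size_rcons factS natrM exprS exprMn.
have H1 : ((size w).+1%:R : R) <= 2 ^+ size w by rewrite -natrX ler_nat ltn_expl.
have -> : C * (M * M ^+ size w) * ((size w).+1%:R * (size w)`!%:R) =
  (size w).+1%:R * (C * M * M ^+ size w * (size w)`!%:R) by ring.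
have -> : C * M * (2 ^+ size w * M ^+ size w) * (size w)`!%:R =
  2 ^+ size w * (C * M * M ^+ size w * (size w)`!%:R) by ring.
by rewrite ler_wpM2r // !mulr_ge0 ?ltW // ?exprn_gt0 ?ltr0n ?fact_gt0.
Qed.

Lemma An_at_pd_comm u p i j : An_at u p -> pd i (pd j u) p = pd j (pd i u) p.
Proof.
move=> Hu; have [r r0 Hr] := An_at_near _ _ Hu.
apply: (D_comm [set x | `|x - p| < r]); first exact: open_norm_ball.
- by rewrite /= subrr normr0.
- move=> y k /Hr Hy; exact: (An_at_derivable _ _ [::]).
- move=> y /Hr Hy; exact: (An_at_derivable _ _ [:: i]).
- exact: (An_at_continuous _ _ [:: j; i]).
Qed.

Lemma harm_An U u : open U -> harm U u -> An U u.
Proof.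
move=> oU Hu p Up.
have [r1 r10 HU] := (openP_norm _ _).1 oU _ Up.
have [cu _ _ _] := Hu _ Up; have [B [r2 [B0 r20 HB]]] := locally_bounded_at _ _ _ cu.
pose r := Num.min r1 r2 / 2.
have m0 : 0 < Num.min r1 r2 by rewrite lt_min r10.
have r0 : 0 < r by rewrite divr_gt0.
have r5 x : `|x - p| < r + r -> U x /\ `|u x| <= B.
  by rewrite /r -splitr lt_min => /andP[/HU ? /HB].
have g0 : 0 < @grad_cst R m := grad_cst_gt0.
exists r, B, (4 * @grad_cst R m / r); split; rewrite ?divr_gt0 ?mulr_gt0 //.
move=> x xr w; have [Ux ux] : U x /\ `|u x| <= B by apply: r5; lra.
have [_ d1 _ _] := harm_Dw _ _ w oU Hu _ Ux.
split=> [i|]; first by have [] := d1 i.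
have [w0|wn0] := posnP (size w).
  by move/size0nil: w0 => -> /=; rewrite expr0 mulr1 fact0 mulr1.
have k0 : 0 < (size w)%:R :> R by rewrite ltr0n.
(* A word of length k is estimated with step r / k, so that the total loss is r whatever the length.
   The resulting k^k is absorbed by 4^k k!. *)
have d0 : 0 < r / (size w)%:R by rewrite divr_gt0.
have := harm_Dw_bound U u p r _ B w oU Hu d0 B0.
rewrite mulrCA divff ?gt_eqF // mulr1 => /(_ r5 x xr) /le_trans; apply.
have -> : @grad_cst R m / (r / (size w)%:R) = @grad_cst R m / r * (size w)%:R.
  by field; rewrite !gt_eqF.
rewrite exprMn [leLHS]mulrC -mulrA (ler_wpM2l (ltW B0)) //.
have -> : (4 * @grad_cst R m / r) ^+ size w = (@grad_cst R m / r) ^+ size w * 4 ^+ size w.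
  by rewrite -exprMn; congr (_ ^+ _); ring.
have gr0 : 0 <= (@grad_cst R m / r) ^+ size w by rewrite exprn_ge0 // divr_ge0 // ltW.
rewrite -[leRHS]mulrA (ler_wpM2l gr0) //.
by rewrite -!natrX -natrM ler_nat expn_self_le_fact.
Qed.

(** Subtracting the linear part leaves a function [G] whose partial derivatives are small near [z],
    hence one with a small Lipschitz constant. *)
Lemma is_derive_gradient u z v (r : R) : 0 < r ->
  (forall x i, `|x - z| < r -> derivable u x (E i)) ->
  (forall i, {for z, continuous (pd i u)}) ->
  is_derive z v u (\sum_i v ord0 i * pd i u z).
Proof.
move=> r0 du cu; apply/is_deriveP => e e0.
pose K := m%:R * `|v| + 1.
have K0 : 0 < K by rewrite /K; have := mulr_ge0 (ler0n R m) (normr_ge0 v); lra.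
have eK : 0 < e / K by rewrite divr_gt0.
have [q q0 Hq] : exists2 q : R, 0 < q & forall x i, `|x - z| < q -> `|pd i u x - pd i u z| <= e / K.
  have H i : exists q : R, 0 < q /\ forall x, `|x - z| < q -> `|pd i u x - pd i u z| <= e / K.
    by have [q q0 Hq] := (continuousP_norm _ _ _).1 (cu i) _ eK; exists q.
  have /choice[q Hq] := H.
  exists (\big[Num.min/1]_i q i).
    by apply: lt_bigmin => // i _; have [] := Hq i.
  move=> x i xq; have [_] := Hq i; apply; apply: (lt_le_trans xq); exact: bigmin_le_cond.
pose G x := u x - \sum_i x ord0 i * pd i u z.
have dG x i : `|x - z| < Num.min r q -> is_derive x (E i) G (pd i u x - pd i u z).
  rewrite lt_min => /andP[xr _]; apply: is_deriveB; first exact/is_derive_D/du.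
  apply/is_deriveP => e' e'0; exists 1 => // h _.
  have -> : \sum_k (x + h *: E i) ord0 k * pd k u z - \sum_k x ord0 k * pd k u z - h * pd i u z = 0.
    rewrite -sumrB (bigD1 i) //= shift_dirvecE eqxx mulr1 big1 => [|k ki]; first by ring.
    by rewrite shift_dirvecE (negbTE ki) mulr0; ring.
  by rewrite normr0 mulr_ge0 // ltW.
have lip := lipschitz_of_partials _ _ _ _ (e / K) dG.
have v1 : 0 < `|v| + 1 by have := normr_ge0 v; lra.
exists (Num.min r q / (`|v| + 1)); first by rewrite divr_gt0 // lt_min r0.
move=> h; rewrite ltr_pdivlMr // => hh.
have hv : `|z + h *: v - z| < Num.min r q.
  rewrite addrC addKr normrZ; apply: le_lt_trans hh.
  by rewrite ler_wpM2l // lerDl.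
have zz : `|z - z| < Num.min r q by rewrite subrr normr0 lt_min r0.
have bG x i : `|x - z| < Num.min r q -> `|pd i u x - pd i u z| <= e / K.
  by rewrite lt_min => /andP[_ /Hq].
have := lip bG z (z + h *: v) zz hv.
rewrite [z + _ - z]addrC addKr normrZ.
have -> : G (z + h *: v) - G z = u (z + h *: v) - u z - h * \sum_i v ord0 i * pd i u z.
  rewrite /G (eq_bigr (fun i => z ord0 i * pd i u z + h * (v ord0 i * pd i u z))); last first.
    by move=> i _; rewrite !mxE; ring.
  by rewrite big_split /= -mulr_sumr; ring.
move=> /le_trans; apply.
have -> : m%:R * (e / K) * (`|h| * `|v|) = e * `|h| * (m%:R * `|v| / K) by ring.
rewrite ler_piMr ?mulr_ge0 ?(ltW e0) // ler_pdivrMr // mul1r /K; lra.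
Qed.

End AnalyticClass.

(** * Cauchy estimates and power series *)

Section Taylor.
Context {R : realType}.
Implicit Types (s B : R) (phi : nat -> R -> R).

Lemma is_derive_expterm (a s : R) n :
  is_derive s 1 (fun s : R => a * (s ^+ n.+1 / n.+1`!%:R)) (a * (s ^+ n / n`!%:R)).
Proof.
have H1 : is_derive s 1 (fun s : R => s ^+ n.+1) (n.+1%:R * s ^+ n).
  split; first exact: exprn_derivable.
  by rewrite exp_derive /= -[_ *: 1]/(_ * 1) mulr1.
have -> : (fun s : R => a * (s ^+ n.+1 / n.+1`!%:R)) = (a / n.+1`!%:R) *: (fun s : R => s ^+ n.+1).
  by apply/funext => r; rewrite -[RHS]/(_ * _); ring.
have -> : a * (s ^+ n / n`!%:R) = (a / n.+1`!%:R) *: (n.+1%:R * s ^+ n).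
  rewrite -[RHS]/(_ * _) factS natrM.
  have key (N f : R) : N != 0 -> f != 0 -> a * (s ^+ n / f) = a / (N * f) * (N * s ^+ n).
    by move=> N0 f0; field; rewrite f0 N0.
  by apply: key; rewrite pnatr_eq0 // -lt0n fact_gt0.
exact: is_deriveZ.
Qed.

Lemma is_derive_expsum (a : nat -> R) n s :
  is_derive s 1 (fun s : R => \sum_(k < n.+1) a k * (s ^+ k / k`!%:R))
            (\sum_(k < n) a k.+1 * (s ^+ k / k`!%:R)).
Proof.
elim: n => [|n IH].
  rewrite big_ord0 (_ : (fun _ => _) = cst (a 0%N)); first exact: is_derive_cst.
  by apply/funext => r; rewrite big_ord1 expr0 fact0 divr1 mulr1.
rewrite big_ord_recr /=.
have -> : (fun s : R => \sum_(k < n.+2) a k * (s ^+ k / k`!%:R)) =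
   (fun s : R => \sum_(k < n.+1) a k * (s ^+ k / k`!%:R)) +
   (fun s : R => a n.+1 * (s ^+ n.+1 / n.+1`!%:R)).
  by apply/funext => r; rewrite big_ord_recr.
exact: (is_deriveD IH (is_derive_expterm _ _ _)).
Qed.

Lemma ge0_of_derive_ge0 (F dF : R -> R) s : 0 <= s ->
  (forall c : R, 0 <= c <= s -> is_derive c 1 F (dF c)) ->
  (forall c, 0 <= c <= s -> 0 <= dF c) -> 0 <= F s - F 0.
Proof.
move=> s0 HF HdF; have [||c cs ->] := @MVT_segment R F dF 0 s s0.
- by move=> c; rewrite in_itv /= => /andP[/ltW a /ltW b]; apply: HF; rewrite a b.
- apply: continuous_in_subspaceT => c; rewrite inE /= in_itv /= => /HF.
  exact: is_derive_cont1.
- by rewrite subr0 mulr_ge0 // HdF //; rewrite in_itv /= in cs.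
Qed.

(** Induction on the order, with no integral: the remainder [psi] has the remainder of the
    derivative as its derivative, so both sums of B s^(n+1) / (n+1)! with plus or minus [psi] are
    nondecreasing and vanish at 0. *)
Lemma taylor_bound n phi B :
  (forall k s, 0 <= s <= 1 -> is_derive (s : R) 1 (phi k) (phi k.+1 s)) ->
  (forall s, 0 <= s <= 1 -> `|phi n s| <= B) ->
  forall s, 0 <= s <= 1 ->
    `|phi 0%N s - \sum_(k < n) phi k 0 * (s ^+ k / k`!%:R)| <= B * (s ^+ n / n`!%:R).
Proof.
elim: n phi => [|n IH] phi Hd HB s s01.
  by rewrite big_ord0 subr0 expr0 fact0 divr1 mulr1; exact: HB.
have Hd' k c : 0 <= c <= 1 -> is_derive (c : R) 1 (phi k.+1) (phi k.+2 c) by exact: Hd.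
have {}IH := IH (fun k => phi k.+1) Hd' HB.
pose psi (s : R) := phi 0%N s - \sum_(k < n.+1) phi k 0 * (s ^+ k / k`!%:R).
pose dpsi (s : R) := phi 1%N s - \sum_(k < n) phi k.+1 0 * (s ^+ k / k`!%:R).
have Hpsi (c : R) : 0 <= c <= 1 -> is_derive c 1 psi (dpsi c).
  by move=> c01; exact: (is_deriveB (Hd _ _ c01) (is_derive_expsum (fun k => phi k 0) _ _)).
have psi0 : psi 0 = 0.
  rewrite /psi big_ord_recl /= expr0 fact0 divr1 mulr1 big1 ?addr0 ?subrr // => k _.
  by rewrite expr0n /= mul0r mulr0.
have [s0 s1] := andP s01.
have le1 (c : R) : 0 <= c <= s -> 0 <= c <= 1.
  by move=> /andP[-> cs] /=; exact: le_trans s1.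
have chi := is_derive_expterm B ^~ n.
have chi0 : B * (0 ^+ n.+1 / n.+1`!%:R) = 0 :> R by rewrite expr0n /= mul0r mulr0.
rewrite -/(psi s) ler_norml; apply/andP; split.
- have : 0 <= B * (s ^+ n.+1 / n.+1`!%:R) + psi s - (B * (0 ^+ n.+1 / n.+1`!%:R) + psi 0).
    apply: (@ge0_of_derive_ge0 ((fun s : R => B * (s ^+ n.+1 / n.+1`!%:R)) + psi)
       (fun c => B * (c ^+ n / n`!%:R) + dpsi c) s s0) => c cs.
      exact: (is_deriveD (chi c) (Hpsi _ (le1 _ cs))).
    by have := IH _ (le1 _ cs); rewrite ler_norml -/(dpsi c) => /andP[? _]; lra.
  by rewrite psi0 chi0; lra.
- have : 0 <= B * (s ^+ n.+1 / n.+1`!%:R) - psi s - (B * (0 ^+ n.+1 / n.+1`!%:R) - psi 0).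
    apply: (@ge0_of_derive_ge0 ((fun s : R => B * (s ^+ n.+1 / n.+1`!%:R)) - psi)
       (fun c => B * (c ^+ n / n`!%:R) - dpsi c) s s0) => c cs.
      exact: (is_deriveB (chi c) (Hpsi _ (le1 _ cs))).
    by have := IH _ (le1 _ cs); rewrite ler_norml -/(dpsi c) => /andP[_ ?]; lra.
  by rewrite psi0 chi0; lra.
Qed.

End Taylor.

Section WordSums.
Context {R : realType} {m : nat}.
Implicit Types (h : 'I_m -> R) (f : seq 'I_m -> R).

(** With [f] w = [Dw] w u p this is the k-th derivative of u at p along the vector [h]. *)
Definition wsum h k f : R := \sum_(w : k.-tuple 'I_m) (\prod_(i <- w) h i) * f w.

Lemma wsum0 h f : wsum h 0 f = f [::].
Proof.
rewrite /wsum (big_pred1 [tuple]); first by rewrite big_nil mul1r.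
by move=> w; symmetry; apply/eqP; exact: tuple0.
Qed.

Lemma wsumS h k f : wsum h k.+1 f = \sum_i h i * wsum h k (fun w => f (i :: w)).
Proof.
rewrite /wsum; under [RHS]eq_bigr do rewrite mulr_sumr.
rewrite pair_big /=.
rewrite (reindex (fun x : 'I_m * k.-tuple 'I_m => [tuple of x.1 :: x.2])) /=.
  by apply: eq_bigr => -[i w] _ /=; rewrite big_cons mulrA.
exists (fun w : k.+1.-tuple 'I_m => (thead w, [tuple of behead w])) => [[i w] _|w _].
  by congr pair; exact: val_inj.
by case/tupleP: w => i w; apply: val_inj; rewrite /= theadE.
Qed.

Lemma wsum_lin h k (f : 'I_m -> seq 'I_m -> R) (a : 'I_m -> R) :
  wsum h k (fun w => \sum_i a i * f i w) = \sum_i a i * wsum h k (f i).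
Proof.
rewrite /wsum; under [RHS]eq_bigr do rewrite mulr_sumr.
rewrite exchange_big /=; apply: eq_bigr => w _.
by rewrite mulr_sumr; apply: eq_bigr => i _; rewrite mulrCA.
Qed.

Lemma wsum_cst h k : wsum h k (fun=> 1) = (\sum_i h i) ^+ k.
Proof.
elim: k => [|k IH]; first by rewrite wsum0.
by rewrite wsumS exprS mulr_suml; apply: eq_bigr => i _; rewrite IH.
Qed.

Lemma le_wsum h k f (B : R) : (forall w : seq 'I_m, size w = k -> `|f w| <= B) ->
  `|wsum h k f| <= B * (\sum_i `|h i|) ^+ k.
Proof.
move=> HB; rewrite -wsum_cst /wsum mulr_sumr.
apply: (le_trans (ler_norm_sum _ _ _)); apply: ler_sum => w _.
rewrite normrM mulr1 mulrC normr_prod ler_wpM2r //.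
  by apply: prodr_ge0.
by apply: HB; rewrite size_tuple.
Qed.

Lemma prod_count h (w : seq 'I_m) : \prod_i h i ^+ count_mem i w = \prod_(i <- w) h i.
Proof.
elim: w => [|j w IH]; first by rewrite big_nil big1 // => i _; rewrite expr0.
rewrite big_cons -IH (bigD1 j) //= eqxx exprS -mulrA; congr (_ * _).
rewrite [in RHS](bigD1 j) //=; congr (_ * _); apply: eq_bigr => i ij.
by rewrite eq_sym (negbTE ij).
Qed.

Definition content_coef k (f : seq 'I_m -> R) (a : 'I_m -> nat) : R :=
  \sum_(w : k.-tuple 'I_m | [forall i, count_mem i w == a i]) f w.

Lemma wsum_content h k f :
  \sum_(a : {ffun 'I_m -> 'I_k.+1} | (\sum_(i < m) val (a i) == k)%N)
     content_coef k f (fun i => val (a i)) * \prod_(i < m) h i ^+ val (a i) = wsum h k f.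
Proof.
pose ct (w : k.-tuple 'I_m) : {ffun 'I_m -> 'I_k.+1} := [ffun i => inord (count_mem i w)].
have ctE w i : val (ct w i) = count_mem i w.
  by rewrite ffunE /= inordK // ltnS -[X in (_ <= X)%N](size_tuple w) count_size.
rewrite /wsum (partition_big ct (fun a : {ffun 'I_m -> 'I_k.+1} => (\sum_(i < m) val (a i) == k)%N)) /=.
  apply: eq_bigr => a _; rewrite /content_coef mulr_suml; apply: eq_big => w.
    apply/forallP/eqP => [H|<- i]; last by rewrite ctE.
    by apply/ffunP => i; apply: val_inj; rewrite ctE (eqP (H i)).
  move=> /forallP H; rewrite mulrC; congr (_ * _); rewrite -[RHS]prod_count.
  by apply: eq_bigr => i _; rewrite (eqP (H i)).
move=> w _; rewrite (eq_bigr (fun i => count_mem i w)) => [|i _]; last exact: ctE.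
have /eqP := sum1_size (tval w); rewrite size_tuple eq_sym => /eqP {2}->.
rewrite (eq_bigr (fun i => \sum_(j <- w | j == i) 1)%N) => [|i _]; last by rewrite sum1_count.
rewrite (exchange_big_dep xpredT) //=; apply/eqP; apply: eq_bigr => j _.
by rewrite (big_pred1 j) // => i /=; rewrite eq_sym.
Qed.

End WordSums.

Lemma is_derive_bigsum {R : realType} {V : normedModType R} {I : Type} (r : seq I) (P : pred I)
    (f : I -> V -> R) (df : I -> R) x v :
  (forall i, P i -> is_derive x v (f i) (df i)) ->
  is_derive x v (fun y => \sum_(i <- r | P i) f i y) (\sum_(i <- r | P i) df i).
Proof.
move=> H; elim: r => [|i r IH].
  rewrite big_nil (_ : (fun _ => _) = cst 0); first exact: is_derive_cst.
  by apply/funext => y; rewrite big_nil.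
rewrite big_cons; have [Pi|Pi] := boolP (P i); last first.
  by rewrite (_ : (fun _ => _) = (fun y => \sum_(j <- r | P j) f j y)) //;
    apply/funext => y; rewrite big_cons (negbTE Pi).
rewrite (_ : (fun _ => _) = f i + (fun y => \sum_(j <- r | P j) f j y)).
  exact: (is_deriveD (H _ Pi) IH).
by apply/funext => y; rewrite big_cons Pi.
Qed.

Section AnalyticOfEstimates.
Context {R : realType} {m : nat}.
Implicit Types (x y z p : 'rV[R]_m) (u : 'rV[R]_m -> R).
Local Notation E i := (@dirvec R m i).

Lemma An_at_analytic u p : An_at u p -> analytic_at m u p.
Proof.
move=> [r [C [M [r0 C0 M0 Hu]]]].
(* The second radius makes M times the sum of the |h_i| at most 1/2, so the part of degree k is at
   most C 2^-k. Using m + 1 keeps the radius meaningful for m = 0. *)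
pose q := Num.min r (2 * m.+1%:R * M)^-1.
have q0 : 0 < q by rewrite lt_min r0 invr_gt0 !mulr_gt0.
pose f w := Dw w u p.
pose c (a : 'I_m -> nat) : R :=
  content_coef (\sum_i a i)%N f a / (\sum_i a i)%N`!%:R.
exists q; split => //; exists c => x pxq.
have {pxq} xq : `|x - p| < q by move: pxq; rewrite mx_norm_ball /= distrC.
have [xr xM] : `|x - p| < r /\ `|x - p| < (2 * m.+1%:R * M)^-1.
  by move: xq; rewrite lt_min => /andP[].
pose h (i : 'I_m) := x ord0 i - p ord0 i.
have hE i : h i = (x - p) ord0 i by rewrite !mxE.
have hM : M * (\sum_i `|h i|) <= 2^-1.
  have H1 : \sum_i `|h i| <= m.+1%:R * `|x - p|.
    apply: (@le_trans _ _ (\sum_(i < m) `|x - p|)).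
      by apply: ler_sum => i _; rewrite hE coord_le_norm.
    by rewrite sumr_const card_ord -[leLHS]mulr_natl ler_wpM2r // ler_nat.
  apply: (le_trans (ler_wpM2l (ltW M0) H1)); rewrite mulrA.
  have mM : 0 < M * m.+1%:R by rewrite mulr_gt0.
  rewrite -ler_pdivlMl // -invfM; apply: ltW; apply: (lt_le_trans xM).
  by apply/eq_ler; congr (_^-1); ring.
have fact_neq0 n : n`!%:R != 0 :> R by rewrite pnatr_eq0 -lt0n fact_gt0.
have fact_pos n : 0 < n`!%:R :> R by rewrite ltr0n fact_gt0.
have monoE k : mono_term m c p x k = wsum h k f / k`!%:R.
  rewrite /mono_term -wsum_content mulr_suml; apply: eq_bigr => a /eqP ak.
  by rewrite /c ak mulrAC.
have Sge0 : 0 <= M * (\sum_i `|h i|) by rewrite mulr_ge0 ?(ltW M0) // sumr_ge0.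
have pw k : (M * (\sum_i `|h i|)) ^+ k <= 2^-1 ^+ k by apply: lerXn2r; rewrite ?nnegrE.
have Dp (s : R) w : 0 <= s <= 1 ->
    (forall i : 'I_m, derivable (Dw w u) (p + s *: (x - p)) (E i)) /\
    `|Dw w u (p + s *: (x - p))| <= C * M ^+ size w * (size w)`!%:R.
  move=> /andP[s0 s1]; suff /Hu/(_ w)[] : `|p + s *: (x - p) - p| < r by [].
  rewrite [p + _]addrC addrK normrZ (ger0_norm s0).
  by apply: le_lt_trans xr; rewrite ler_piMl.
have absE k : 0 <= abs_mono_term m c p x k <= C * 2^-1 ^+ k.
  apply/andP; split.
    by apply: sumr_ge0 => a _; rewrite mulr_ge0 // prodr_ge0 // => i _; rewrite exprn_ge0.
  apply: (@le_trans _ _ (wsum (fun i => `|h i|) k (fun w => `|f w| / k`!%:R))).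
    rewrite -wsum_content; apply: ler_sum => a /eqP ak.
    apply: ler_wpM2r; first by apply: prodr_ge0 => i _; rewrite exprn_ge0.
    rewrite /c ak normrM normfV (gtr0_norm (fact_pos k)) /content_coef.
    by rewrite -mulr_suml ler_wpM2r ?invr_ge0 ?(ltW (fact_pos _)) // ler_norm_sum.
  apply: (@le_trans _ _ (C * M ^+ k * (\sum_i `|h i|) ^+ k)).
    apply: le_trans (ler_norm _) _.
    rewrite (eq_bigr (fun i => `| `|h i| |)) => [|i _]; last by rewrite normr_id.
    apply: le_wsum => w wk; rewrite ger0_norm ?divr_ge0 // ler_pdivrMr // -wk.
    have := Dp 0 w; rewrite scale0r addr0 lexx ler01 => /(_ isT)[_]; exact.
  by rewrite -mulrA ler_pM2l // -exprMn.
split.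
  apply: (@series_le_cvg _ _ (geometric C 2^-1)).
  - by move=> n; have /andP[] := absE n.
  - by move=> n; rewrite /= mulr_ge0 ?(ltW C0) // exprn_ge0.
  - by move=> n; have /andP[] := absE n.
  - by apply/cvg_ex; eexists; apply: cvg_geometric_series; rewrite ger0_norm // invf_lt1 // ltr1n.
(* The successive derivatives of u along the segment from [p] to [x]; at s = 0 they give the
   homogeneous parts of the series, and Taylor's bound at s = 1 gives the remainder. *)
pose phi k (s : R) := wsum h k (fun w => Dw w u (p + s *: (x - p))).
have Hphi k s : 0 <= s <= 1 -> is_derive (s : R) 1 (phi k) (phi k.+1 s).
  move=> s01; rewrite {2}/phi wsumS -wsum_lin /wsum.
  apply: is_derive_bigsum => w _.
  have H1 : is_derive s 1 (fun s : R => Dw w u (p + s *: (x - p)))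
      (\sum_i h i * Dw (i :: w) u (p + s *: (x - p))).
    apply: is_derive_line; rewrite (eq_bigr (fun i => (x - p) ord0 i * pd i (Dw w u) (p + s *: (x - p)))).
      have sx : `|p + s *: (x - p) - p| < r.
        move: s01 => /andP[s0 s1]; rewrite [p + _]addrC addrK normrZ (ger0_norm s0).
        by apply: le_lt_trans xr; rewrite ler_piMl.
      have [d d0 Hd] := (openP_norm _ _).1 (open_norm_ball p r) _ sx.
      apply: (is_derive_gradient _ _ _ d) => //.
        by move=> y i /Hd yr; have [] := Hu y yr w.
      move=> i; apply: (An_at_continuous u _ (i :: w)).
      exists d, C, M; split => // y /Hd yr; exact: Hu.
    by move=> i _; rewrite hE.
  have -> : (fun y : R => (\prod_(i <- w) h i) * Dw w u (p + y *: (x - p))) =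
     (\prod_(i <- w) h i) *: (fun s : R => Dw w u (p + s *: (x - p))) by apply/funext.
  exact: is_deriveZ.
have Bphi n s : 0 <= s <= 1 -> `|phi n s| <= C * M ^+ n * n`!%:R * (\sum_i `|h i|) ^+ n.
  by move=> s01; apply: le_wsum => w wn; have [_] := Dp s w s01; rewrite wn.
have T n : `|u x - series (mono_term m c p x) n| <= C * 2^-1 ^+ n.
  have := taylor_bound n phi _ Hphi (Bphi n) 1; rewrite ler01 lexx => /(_ isT).
  rewrite /phi wsum0 scale1r [p + _]addrC subrK /series /= big_mkord.
  rewrite (eq_bigr (fun k : 'I_n => mono_term m c p x k)); last first.
    by move=> k _; rewrite monoE scale0r addr0 expr1n div1r.
  move=> /le_trans; apply; rewrite expr1n.
  have -> : C * M ^+ n * n`!%:R * (\sum_i `|h i|) ^+ n * (1 / n`!%:R) =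
    C * (M * (\sum_i `|h i|)) ^+ n.
    by rewrite exprMn; field; exact: fact_neq0.
  by rewrite ler_pM2l.
apply/cvgrPdist_le => e e0.
have /cvgrPdist_le/(_ e e0) : geometric C 2^-1 @ \oo --> (0 : R).
  by apply: cvg_geometric; rewrite ger0_norm // invf_lt1 // ltr1n.
apply: filterS => n; rewrite sub0r normrN => H; apply: (le_trans (T n)).
by apply: le_trans H; exact: ler_norm.
Qed.

End AnalyticOfEstimates.

(** * Division by a coordinate *)

Section UnitInterval.
Context {R : realType}.
Implicit Types (f F : R -> R) (s K : R).

Definition int01 f : R := \int[lebesgue_measure]_(s in `[0, 1]) f s.

Lemma integrable01 f : (forall s, 0 <= s <= 1 -> {for s, continuous f}) ->
  lebesgue_measure.-integrable `[0 : R, 1] (EFin \o f).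
Proof.
move=> cf; apply: continuous_compact_integrable; first exact: segment_compact.
by apply: continuous_in_subspaceT => s; rewrite inE /= in_itv /=; exact: cf.
Qed.

Lemma int01_FTC f F : (forall s, 0 <= s <= 1 -> {for s, continuous f}) ->
  (forall s : R, 0 <= s <= 1 -> is_derive s 1 F (f s)) -> int01 f = F 1 - F 0.
Proof.
move=> cf dF; rewrite /int01 /Rintegral.
rewrite (@continuous_FTC2 _ f F 0 1 ltr01) //.
- by apply: continuous_in_subspaceT => s; rewrite inE /= in_itv /=; exact: cf.
- split.
  + by move=> s; rewrite in_itv /= => /andP[/ltW s0 /ltW s1]; have [] := dF s; rewrite ?s0 ?s1.
  + apply: cvg_at_right_filter; apply: is_derive_cont1; apply: dF.
    by rewrite lexx ler01.
  + apply: cvg_at_left_filter; apply: is_derive_cont1; apply: dF.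
    by rewrite lexx ler01.
- move=> s; rewrite in_itv /= => /andP[/ltW s0 /ltW s1]; rewrite derive1E.
  by have [] := dF s; rewrite ?s0 ?s1.
Qed.

Lemma int01_cst (c : R) : int01 (fun=> c) = c.
Proof.
have H : int01 (fun=> c) = c * 1 - c * 0.
  apply: (int01_FTC _ (fun s => c * s)) => s _; first exact: cst_continuous.
  rewrite (_ : (fun s => c * s) = c *: (id : R -> R)); last exact/funext.
  by rewrite -[X in is_derive _ _ _ X]mulr1; exact: is_deriveZ.
by rewrite H mulr1 mulr0 subr0.
Qed.

Lemma int01_le f K : (forall s, 0 <= s <= 1 -> {for s, continuous f}) ->
  (forall s, 0 <= s <= 1 -> `|f s| <= K) -> `|int01 f| <= K.
Proof.
move=> cf fK; rewrite -[K]int01_cst /int01.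
apply: (le_trans (le_normr_Rintegral _ (integrable01 _ cf))) => //.
apply: le_Rintegral => //.
  apply: integrable01 => s /cf cfs.
  by apply: (@continuous_comp _ _ _ f (fun x => `|x|)) => //; exact: norm_continuous.
by apply: integrable01 => s _; exact: cst_continuous.
Qed.

Lemma is_derive_int01 (phi dphi : R -> R -> R) (del K : R) : 0 < del ->
  (forall h s, `|h| < del -> 0 <= s <= 1 -> {for s, continuous (phi h)}) ->
  (forall h s : R, `|h| < del -> 0 <= s <= 1 -> is_derive h 1 (phi^~ s) (dphi h s)) ->
  (forall h s, `|h| < del -> 0 <= s <= 1 -> `|dphi h s| <= K) ->
  is_derive (0 : R) 1 (fun h => int01 (phi h)) (int01 (dphi 0)).
Proof.
move=> del0 cphi dp Kp.
have I0 : (`]- del, del[%classic : set R) 0 by rewrite /= in_itv /= oppr_lt0 del0.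
have H1 : forall x, (`]- del, del[%classic : set R) x ->
    lebesgue_measure.-integrable `[0 : R, 1] (EFin \o phi x).
  move=> x; rewrite /= in_itv /= -ltr_norml => xd.
  by apply: integrable01 => s; exact: cphi.
have H2 : forall x y : R, (`]- del, del[%classic : set R) x -> (`[0, 1]%classic : set R) y ->
    derivable (phi^~ y) x 1.
  move=> x y; rewrite /= !in_itv /= -ltr_norml => xd yy.
  by have [] := dp x y xd yy.
have K0 (y : R) : 0 <= `|K| by [].
have H3 : lebesgue_measure.-integrable `[0 : R, 1] (EFin \o (fun=> `|K|)).
  by apply: integrable01 => s _; exact: cst_continuous.
have H4 : forall x y : R, (`]- del, del[%classic : set R) x -> (`[0, 1]%classic : set R) y ->
    `|partial1of2 phi x y| <= `|K|.
  move=> x y; rewrite /= !in_itv /= -ltr_norml => xd yy; rewrite partial1of2E.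
  have [_ ->] := dp x y xd yy; apply: le_trans (Kp _ _ xd yy) _; exact: ler_norm.
have m01 : measurable (`[0 : R, 1]%classic : set (measurableTypeR R)) by exact: measurable_itv.
split.
  exact: (@derivable_under_integral R _ _ lebesgue_measure phi _ m01 0 (- del) del I0 H1 H2 (fun=> `|K|) K0 H3 H4).
rewrite -derive1E.
rewrite (@differentiation_under_integral R _ _ lebesgue_measure phi _ m01 0 (- del) del I0 H1 H2 (fun=> `|K|) K0 H3 H4).
apply: eq_Rintegral => s; rewrite inE /= in_itv /= => s01; rewrite partial1of2E.
have h0 : `|0 : R| < del by rewrite normr0.
by have [_ ->] := dp 0 s h0 s01.
Qed.

End UnitInterval.

Section Families.
Context {R : realType} {m : nat}.
Implicit Types (x y z p : 'rV[R]_m) (f g u : 'rV[R]_m -> R) (i j : 'I_m) (V U : set 'rV[R]_m).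
Local Notation E i := (@dirvec R m i).

Lemma Dw_lin V f g (a1 a2 : R) (w : seq 'I_m) : open V ->
  (forall (w2 : seq 'I_m) x i, (size w2 < size w)%N -> V x ->
     derivable (Dw w2 f) x (E i) /\ derivable (Dw w2 g) x (E i)) ->
  forall x, V x -> Dw w (fun x => a1 * f x + a2 * g x) x = a1 * Dw w f x + a2 * Dw w g x.
Proof.
move=> oV; elim: w => [//|i w IH] H x Vx /=.
rewrite (eq_open_D V i _ (fun y => a1 * Dw w f y + a2 * Dw w g y)) //; last first.
  by move=> y Vy; apply: IH => // w2 z k wk; apply: H; rewrite /= ltnS ltnW.
apply: D_val; have [|d1 d2] := H w x i _ Vx; first exact: ltnSn.
by apply: is_derive_lin; exact: is_derive_D.
Qed.

(* A family closed under partial derivatives, up to two-term linear combinations,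
   inherits any bound [B] compatible with the recursion. *)
Lemma family_bound {I : Type} (T : I -> 'rV[R]_m -> R) V (B : nat -> I -> R) : open V ->
  (forall k i, exists (k1 k2 : I) (a1 a2 : R),
     (forall x, V x -> is_derive x (E i) (T k) (a1 * T k1 x + a2 * T k2 x)) /\
     forall n, `|a1| * B n k1 + `|a2| * B n k2 <= B n.+1 k) ->
  (forall k x, V x -> `|T k x| <= B 0%N k) ->
  forall (w : seq 'I_m) k x, V x ->
    (forall i, derivable (Dw w (T k)) x (E i)) /\ `|Dw w (T k) x| <= B (size w) k.
Proof.
move=> oV HT HB w; have [n] := ubnP (size w); elim: n w => // n IH w.
case/lastP: w => [_ k x Vx|w i].
  split=> [i|]; last exact: HB.
  by have [k1 [k2 [a1 [a2 [/(_ x Vx)[]]]]]] := HT k i.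
rewrite size_rcons ltnS => wn k x Vx; rewrite Dw_rcons.
have [k1 [k2 [a1 [a2 [HD Hn]]]]] := HT k i.
have E1 y : V y -> a1 * Dw w (T k1) y + a2 * Dw w (T k2) y = Dw w (pd i (T k)) y.
  move=> Vy; rewrite -(Dw_lin V) //; last first.
    move=> w2 z l w2w Vz; have w2n : (size w2 < n)%N by apply: leq_trans wn; rewrite ltnW.
    by have [d1 _] := IH w2 w2n k1 z Vz; have [d2 _] := IH w2 w2n k2 z Vz.
  apply: (eq_Dw V) => // z Vz; symmetry; exact: D_val (HD z Vz).
have [d1 b1] := IH w wn k1 x Vx; have [d2 b2] := IH w wn k2 x Vx.
split=> [l|].
  have [] // := eq_open_is_derive _ (E l) _ _ _ _ oV Vx E1
     (is_derive_lin _ _ _ _ a1 a2 _ _ (derivableP (d1 l)) (derivableP (d2 l))).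
rewrite -E1 //; apply: (le_trans (ler_normD _ _)); rewrite !normrM.
by apply: le_trans (Hn _); apply: lerD; rewrite ler_wpM2l.
Qed.

Lemma is_derive_coord x i (b : 'I_m) : is_derive x (E i) (fun x : 'rV[R]_m => x ord0 b) (b == i)%:R.
Proof.
apply/is_deriveP => e e0; exists 1 => // h _.
rewrite shift_dirvecE [X in `|X|](_ : _ = 0); last by ring.
by rewrite normr0 mulr_ge0 // ltW.
Qed.

Lemma is_derive_mul x v f g (df dg : R) : is_derive x v f df -> is_derive x v g dg ->
  is_derive x v (fun x => f x * g x) (f x * dg + df * g x).
Proof. by move=> H1 H2; rewrite (mulrC df); exact: is_deriveM. Qed.

Lemma is_derive_inv x v f (df : R) : f x != 0 -> is_derive x v f df ->
  is_derive x v (fun x => (f x)^-1) (- (df / f x ^+ 2)).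
Proof.
move=> fx [d1 <-]; split; first exact: derivableV.
by rewrite deriveV // -[_ *: _]/(_ * _); ring.
Qed.

Lemma is_derive_expr x v f (df : R) n : is_derive x v f df ->
  is_derive x v (fun x => f x ^+ n) (n%:R * f x ^+ n.-1 * df).
Proof.
move=> H; have := is_deriveX n H; rewrite -[_ *: df]/(_ * _).
by have -> : f ^+ n = (fun x => f x ^+ n) by apply/funext => y; rewrite exprfctE.
Qed.

Lemma is_derive_coord_invX x i (b : 'I_m) n : x ord0 b != 0 ->
  is_derive x (E i) (fun x : 'rV[R]_m => (x ord0 b ^+ n)^-1)
     (- (n%:R * (b == i)%:R * (x ord0 b ^+ n.+1)^-1)).
Proof.
move=> xb.
have := is_derive_inv _ _ _ _ (expf_neq0 n xb) (is_derive_expr _ _ _ _ n (is_derive_coord x i b)).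
congr is_derive; congr (- _); case: n => [|n] /=; first by rewrite !mul0r.
have key (N d a y : R) : a != 0 -> y != 0 -> N * y * d / (a * y) ^+ 2 = N * d * (a * (a * y))^-1.
  by move=> a0 y0; field; rewrite y0 a0.
by rewrite [_ ^+ n.+2]exprS [_ ^+ n.+1]exprS; apply: key => //; exact: expf_neq0.
Qed.

(** The products of a derivative of g with a negative power of x_b form a family closed under
    partial derivatives, with two terms at each step, so that [family_bound] applies. *)
Lemma An_at_div_neq0 g p (b : 'I_m) : p ord0 b != 0 -> An_at g p ->
  An_at (fun x => g x / x ord0 b) p.
Proof.
move=> pb [r [C [M [r0 C0 M0 Hg]]]].
pose b0 := `|p ord0 b| / 2.
have b00 : 0 < b0 by rewrite divr_gt0 // normr_gt0.
pose rho := Num.min r b0.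
have rho0 : 0 < rho by rewrite lt_min r0.
pose V := [set x : 'rV[R]_m | `|x - p| < rho].
have oV : open V := open_norm_ball p rho.
have VP x : V x -> `|x - p| < r /\ b0 <= `|x ord0 b|.
  rewrite /V /= lt_min => /andP[xr xb]; split => //.
  have := coord_le_norm (x - p) b; rewrite !mxE => xpb.
  have := ler_normB (x ord0 b) (x ord0 b - p ord0 b).
  rewrite opprB addrC subrK => H.
  have e : `|p ord0 b| = 2 * b0 by rewrite /b0; field.
  by lra.
have Vb x : V x -> x ord0 b != 0.
  by move=> /VP[_ H]; rewrite -normr_gt0; exact: lt_le_trans H.
pose X := M + b0^-1.
have ib0 : 0 < b0^-1 by rewrite invr_gt0.
have X0 : 0 < X by rewrite addr_gt0.
have fact_pos n : 0 < n`!%:R :> R by rewrite ltr0n fact_gt0.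
pose T (k : seq 'I_m * nat) x := Dw k.1 g x * (x ord0 b ^+ k.2.+1)^-1.
(* Differentiating the power of x_b produces a factor j + 1, absorbed by j! in the denominator. Each
   of the two terms then equals half of the next bound, whence 2^n. *)
pose B n (k : seq 'I_m * nat) : R := C / b0 * 2 ^+ n * X ^+ (n + size k.1 + k.2)
   * (n + size k.1 + k.2)`!%:R / k.2`!%:R.
have H := @family_bound _ T V B oV.
have An0 : forall (w : seq 'I_m) x, V x -> (forall i, derivable (Dw w (T ([::], 0%N))) x (E i)) /\
   `|Dw w (T ([::], 0%N)) x| <= B (size w) ([::], 0%N).
  move=> w x; apply: H => {w x}.
  - move=> [w j] i; exists (i :: w, j), (w, j.+1), 1, (- (j.+1%:R * (b == i)%:R)); split.
      move=> x Vx; have [xr _] := VP _ Vx.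
      have H1 : is_derive x (E i) (Dw w g) (pd i (Dw w g) x).
        by apply: is_derive_D; have [] := Hg x xr w.
      have := is_derive_mul _ _ _ _ _ _ H1 (is_derive_coord_invX x i b j.+1 (Vb _ Vx)).
      by congr is_derive; rewrite /T /=; ring.
    move=> n.
    have E1 : B n (i :: w, j) = B n.+1 (w, j) / 2.
      rewrite /B /= addnS !addSn [2 ^+ n.+1]exprS.
      by move: (_ `!%:R) (X ^+ _) => F Y; field; rewrite !gt_eqF.
    have E2 : j.+1%:R * B n (w, j.+1) = B n.+1 (w, j) / 2.
      rewrite /B /= addnS !addSn [2 ^+ n.+1]exprS (factS j) natrM.
      have j1 : j.+1%:R != 0 :> R by rewrite pnatr_eq0.
      move: ((n + size w + j).+1`!%:R) (X ^+ _) => F Y.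
      move: (j.+1%:R) (j`!%:R) j1 (lt0r_neq0 (fact_pos j)) => J J' j1 j2.
      by field; rewrite j1 j2 gt_eqF.
    have B0 : 0 <= B n (w, j.+1).
      rewrite /B !mulr_ge0 ?exprn_ge0 ?invr_ge0 ?(ltW C0) ?(ltW b00) ?(ltW X0) //.
    rewrite normr1 mul1r E1 normrN [X in _ + X <= _](_ : _ = (b == i)%:R * (j.+1%:R * B n (w, j.+1))).
      rewrite E2 [leRHS](splitr) lerD2l; case: (b == i); rewrite ?mul1r ?mul0r //.
      by rewrite -E2 mulr_ge0.
    by rewrite normrM !normr_nat; ring.
  - move=> [w j] x Vx; have [xr xb] := VP _ Vx; have [_ bw] := Hg x xr w.
    rewrite /T /B /= expr0 mulr1 add0n normrM normfV normrX.
    have I1 : `|x ord0 b|^-1 <= b0^-1 by rewrite lef_pV2 // posrE //; exact: lt_le_trans xb.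
    have I2 : (`|x ord0 b| ^+ j.+1)^-1 <= b0^-1 * X ^+ j.
      rewrite exprS invfM -exprVn; apply: ler_pM => //; rewrite ?invr_ge0 ?exprn_ge0 ?invr_ge0 //.
      apply: lerXn2r; rewrite ?nnegrE ?invr_ge0 ?(ltW X0) //.
      by apply: (le_trans I1); rewrite /X lerDr ltW.
    have I3 : C * M ^+ size w * (size w)`!%:R <= C * X ^+ size w * (size w)`!%:R.
      rewrite ler_wpM2r // ler_pM2l //; apply: lerXn2r; rewrite ?nnegrE ?ltW //.
      by rewrite /X ltrDl.
    have I4 : (size w)`!%:R <= (size w + j)`!%:R / j`!%:R :> R.
      rewrite ler_pdivlMr // -natrM ler_nat.
      have := bin_fact (leq_addr j (size w)); rewrite addKn => <-.
      by rewrite leq_pmull // bin_gt0 leq_addr.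
    apply: (@le_trans _ _ (C * X ^+ size w * (size w)`!%:R * (b0^-1 * X ^+ j))).
      by apply: ler_pM => //; exact: le_trans I3.
    have -> : C * X ^+ size w * (size w)`!%:R * (b0^-1 * X ^+ j) =
      (C / b0 * X ^+ (size w + j)) * (size w)`!%:R by rewrite exprD; ring.
    rewrite -[leRHS]mulrA ler_wpM2l // !mulr_ge0 ?exprn_ge0 ?(ltW C0) ?(ltW X0) ?(ltW ib0) //.
apply: (eq_An_at (T ([::], 0%N)) _ p rho rho0).
  by move=> x _; rewrite /T /= expr1.
have Cb : 0 < C / b0 by rewrite mulr_gt0.
exists rho, (C / b0), (2 * X); split; rewrite ?mulr_gt0 //.
move=> x xr w; have [d1 b1] := An0 w x xr; split => //.
apply: (le_trans b1); rewrite /B /= !addn0 fact0 divr1 exprMn.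
by apply/eq_ler; ring.
Qed.

End Families.

Section Division.
Context {R : realType} {m : nat}.
Implicit Types (x y z p : 'rV[R]_m) (f g u q : 'rV[R]_m -> R) (i j b : 'I_m) (V U : set 'rV[R]_m).
Local Notation E i := (@dirvec R m i).

(** Coordinate [b] multiplied by [s], the path in Hadamard's formula: if g vanishes on x_b = 0, then
    g / x_b is the integral over s in [0, 1] of [pd b g] at [squeeze b s x]. It is written as a
    shift along [E b] for the line lemmas. *)
Definition squeeze b (s : R) x := x + ((s - 1) * x ord0 b) *: E b.

Lemma squeeze_coord b s x i : squeeze b s x ord0 i = (if i == b then s else 1) * x ord0 i.
Proof. by rewrite shift_dirvecE; case: eqP => [->|_] /=; ring. Qed.

Lemma squeeze_shift b s x i (h : R) :
  squeeze b s (x + h *: E i) = squeeze b s x + (h * (if i == b then s else 1)) *: E i.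
Proof.
apply/rowP => k; rewrite squeeze_coord [RHS]mxE [X in _ = _ + X]mxE dirvecE squeeze_coord shift_dirvecE.
by have [->|_] := eqVneq k i => /=; case: (_ == b); ring.
Qed.

Lemma squeeze0_line b s x : squeeze b 0 x + s *: (x ord0 b *: E b) = squeeze b s x.
Proof. by rewrite /squeeze scalerA -addrA -scalerDl; congr (x + _ *: _); ring. Qed.

Lemma squeeze_near b s x p (r : R) : p ord0 b = 0 -> 0 <= s <= 1 -> `|x - p| < r ->
  `|squeeze b s x - p| < r.
Proof.
move=> pb /andP[s0 s1] xr; apply: norm_rV_lt; first exact: le_lt_trans xr.
move=> i; rewrite mxE [X in _ + X]mxE squeeze_coord.
have := le_lt_trans (coord_le_norm _ i) xr; rewrite mxE [X in _ + X]mxE.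
case: eqP => [->|_]; last by rewrite mul1r.
rewrite pb !subr0 normrM (ger0_norm s0); apply: le_lt_trans; exact: ler_piMl.
Qed.

Lemma squeeze_path_continuous b x g (s : R) : {for squeeze b s x, continuous g} ->
  {for s, continuous (fun s => g (squeeze b s x))}.
Proof.
move=> /continuousP_norm cg; apply/continuousP_norm => e /cg[r r0 Hr].
have x1 : 0 < `|x ord0 b| + 1 by have := normr_ge0 (x ord0 b); lra.
exists (r / (`|x ord0 b| + 1)); first by rewrite divr_gt0.
move=> s'; rewrite ltr_pdivlMr // => ss; apply: Hr.
have -> : squeeze b s' x - squeeze b s x = ((s' - s) * x ord0 b) *: E b.
  apply/rowP => i; rewrite mxE [X in _ + X]mxE !squeeze_coord mxE dirvecE.
  by case: eqP => [->|_] /=; ring.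
apply: (le_lt_trans (norm_dirvec_le _ _)); apply: le_lt_trans ss.
by rewrite normrM ler_wpM2l // lerDl.
Qed.

(** Differentiation under the integral sign keeps the family of integrals of s^j times a squeezed
    derivative of g. As p_b = 0, the ball around [p] is stable under squeezing, and s^j <= 1
    preserves the estimates of g. *)
Lemma An_at_squeeze_int g p b : p ord0 b = 0 -> An_at g p ->
  An_at (fun x => int01 (fun s => g (squeeze b s x))) p.
Proof.
move=> pb [r [C [M [r0 C0 M0 Hg]]]].
pose V := [set x : 'rV[R]_m | `|x - p| < r].
have oV : open V := open_norm_ball p r.
have Vs x s : V x -> 0 <= s <= 1 -> V (squeeze b s x).
  by move=> Vx s01; exact: squeeze_near.
have An_V x : V x -> An_at g x.
  move=> Vx; have [d d0 Hd] := (openP_norm _ _).1 oV _ Vx.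
  by exists d, C, M; split => // y /Hd; exact: Hg.
pose T (k : seq 'I_m * nat) x := int01 (fun s => s ^+ k.2 * Dw k.1 g (squeeze b s x)).
pose B n (k : seq 'I_m * nat) : R := C * M ^+ (n + size k.1) * (n + size k.1)`!%:R.
have cT w (j : nat) x : V x -> forall s : R, 0 <= s <= 1 ->
    {for s, continuous (fun s : R => s ^+ j * Dw w g (squeeze b s x))}.
  move=> Vx s s01; apply: (@continuousM _ _ (fun s : R => s ^+ j)).
    exact: exprn_continuous.
  by apply: squeeze_path_continuous; apply: An_at_continuous; apply: An_V; exact: Vs.
have sp (s : R) (j : nat) : 0 <= s <= 1 -> `|s ^+ j| <= 1.
  by move=> /andP[s0 s1]; rewrite ger0_norm ?exprn_ge0 // exprn_ile1.
have bT w (j : nat) x : V x -> forall s : R, 0 <= s <= 1 ->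
    `|s ^+ j * Dw w g (squeeze b s x)| <= C * M ^+ size w * (size w)`!%:R.
  move=> Vx s s01; have [_ H] := Hg _ (Vs _ _ Vx s01) w; rewrite normrM.
  by apply: le_trans H; rewrite ler_piMl // sp.
have H : forall (w : seq 'I_m) x, V x -> (forall i, derivable (Dw w (T ([::], 0%N))) x (E i)) /\
   `|Dw w (T ([::], 0%N)) x| <= B (size w) ([::], 0%N).
  move=> w x; apply: (@family_bound _ _ _ T V B oV) => {w x}.
  (* Only differentiation along [b] sees the squeezing and brings out a further factor s. One term
     is enough, so the second coefficient is 0. *)
  - move=> [w j] i; pose j' := (if i == b then j.+1 else j).
    exists (i :: w, j'), (i :: w, j'), 1, 0; split; last first.
      by move=> n; rewrite normr1 mul1r normr0 mul0r addr0 /B /= addnS addSn.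
    move=> x Vx; rewrite mul1r mul0r addr0; apply: is_derive_line0.
    have [d d0 Hd] := (openP_norm _ _).1 oV _ Vx.
    have Vh (h : R) : `|h| < d -> V (x + h *: E i).
      move=> hd; apply: Hd; rewrite addrC addKr; exact: le_lt_trans (norm_dirvec_le _ _) hd.
    have -> : T (i :: w, j') x = int01 (fun s => s ^+ j' * Dw (i :: w) g (squeeze b s (x + 0 *: E i))).
      by rewrite scale0r addr0.
    apply: (@is_derive_int01 R (fun h s => s ^+ j * Dw w g (squeeze b s (x + h *: E i)))
       (fun h s => s ^+ j' * Dw (i :: w) g (squeeze b s (x + h *: E i))) d
       (C * M ^+ (size w).+1 * (size w).+1`!%:R) d0).
    + by move=> h s /Vh Vxh s01; exact: cT.
    + move=> h s /Vh Vxh s01.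
      pose c := if i == b then s else 1.
      have -> : s ^+ j' * Dw (i :: w) g (squeeze b s (x + h *: E i)) =
         s ^+ j * (c * Dw (i :: w) g (squeeze b s x + h *: (c *: E i))).
        rewrite /j' /c squeeze_shift scalerA; case: eqP => _; rewrite ?mul1r //.
        by rewrite exprS mulrA (mulrC s).
      have -> : (fun h => s ^+ j * Dw w g (squeeze b s (x + h *: E i))) =
          (s ^+ j) *: (fun h : R => Dw w g (squeeze b s x + h *: (c *: E i))).
        apply/funext => h'.
        rewrite -[RHS]/(s ^+ j * Dw w g (squeeze b s x + h' *: (c *: E i))).
        by rewrite squeeze_shift scalerA.
      apply: is_deriveZ; apply: is_derive_line; apply: is_deriveZv; apply: is_derive_D.
      by rewrite scalerA -squeeze_shift; have [] := Hg _ (Vs _ _ Vxh s01) w.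
    + by move=> h s /Vh Vxh s01; exact: (bT (i :: w)).
  - move=> [w j] x Vx; rewrite /T /B /= add0n.
    by apply: int01_le; [exact: cT | exact: bT].
apply: (eq_An_at (T ([::], 0%N)) _ p r r0).
  by move=> x _; rewrite /T /=; congr int01; apply/funext => s; rewrite expr0 mul1r.
exists r, C, M; split => // x xr w; have [d1 b1] := H w x xr; split => //.
by move: b1; rewrite /B /= addn0.
Qed.

Definition quo b g x : R := if x ord0 b == 0 then pd b g x else g x / x ord0 b.

Lemma mul_quo U b g x : (forall y, U y -> y ord0 b = 0 -> g y = 0) -> U x ->
  x ord0 b * quo b g x = g x.
Proof.
move=> H Ux; rewrite /quo; case: eqP => [xb|/eqP xb]; last by rewrite mulrC divfK.
by rewrite xb mul0r H.
Qed.

(** At points with p_b != 0 this is division by a nonvanishing coordinate; at points of the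
    hyperplane it is Hadamard's integral, whose value on x_b = 0 is the derivative chosen in
    [quo]. *)
Lemma An_quo U b g : open U -> An U g -> (forall x, U x -> x ord0 b = 0 -> g x = 0) ->
  An U (quo b g).
Proof.
move=> oU Hg g0 p Up; have [pb|pb] := eqVneq (p ord0 b) 0; last first.
  apply: (eq_An_at (fun x => g x / x ord0 b) _ p `|p ord0 b|); rewrite ?normr_gt0 //.
    move=> x xp; rewrite /quo ifF //; apply/eqP => xb.
    have := le_lt_trans (coord_le_norm _ b) xp; rewrite mxE [X in _ + X]mxE xb sub0r normrN.
    by rewrite ltxx.
  by apply: An_at_div_neq0 => //; exact: Hg.
have [r r0 Hr] := (openP_norm _ _).1 oU _ Up.
apply: (eq_An_at (fun x => int01 (fun s => pd b g (squeeze b s x))) _ p r r0); last first.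
  by apply: An_at_squeeze_int => //; apply: An_at_pd; exact: Hg.
move=> x xr; rewrite /quo; case: eqP => [xb|/eqP xb].
  rewrite -[RHS]int01_cst; congr int01; apply/funext => s.
  by rewrite /squeeze xb mulr0 scale0r addr0.
have US s : 0 <= s <= 1 -> U (squeeze b s x) by move=> s01; apply: Hr; exact: squeeze_near.
have -> : g x / x ord0 b = (x ord0 b)^-1 * g (squeeze b 1 x) - (x ord0 b)^-1 * g (squeeze b 0 x).
  rewrite (g0 (squeeze b 0 x)); last by rewrite squeeze_coord eqxx mul0r.
    by rewrite mulr0 subr0 /squeeze subrr mul0r scale0r addr0 mulrC.
  by apply: US; rewrite lexx ler01.
apply: (int01_FTC _ (fun s => (x ord0 b)^-1 * g (squeeze b s x))) => s s01.
  by apply: squeeze_path_continuous; apply: (An_at_continuous g _ [:: b]); exact/Hg/US.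
have -> : (fun s => (x ord0 b)^-1 * g (squeeze b s x)) =
   (x ord0 b)^-1 *: (fun s : R => g (squeeze b 0 x + s *: (x ord0 b *: E b))).
  apply/funext => s'.
  rewrite -[RHS]/((x ord0 b)^-1 * g (squeeze b 0 x + s' *: (x ord0 b *: E b))).
  by rewrite squeeze0_line.
have -> : pd b g (squeeze b s x) =
    (x ord0 b)^-1 *: (x ord0 b * pd b g (squeeze b 0 x + s *: (x ord0 b *: E b))).
  by rewrite -[RHS]/(_ * _) mulKf // squeeze0_line.
apply: is_deriveZ; apply: is_derive_line; apply: is_deriveZv; apply: is_derive_D.
by rewrite squeeze0_line; apply: (An_at_derivable g _ [::]); exact/Hg/US.
Qed.

End Division.

(** * Parity and towers *)

Section Reflections.
Context {R : realType} {m : nat}.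
Implicit Types (x y z p : 'rV[R]_m) (f g u q : 'rV[R]_m -> R) (i j b k : 'I_m) (V U : set 'rV[R]_m).
Local Notation E i := (@dirvec R m i).

Definition rfl k x : 'rV[R]_m := \row_j (if j == k then - x ord0 j else x ord0 j).

Lemma rflE k x j : rfl k x ord0 j = if j == k then - x ord0 j else x ord0 j.
Proof. by rewrite mxE. Qed.

Lemma rflK k x : rfl k (rfl k x) = x.
Proof. by apply/rowP => j; rewrite !mxE; case: eqP => //; rewrite opprK. Qed.

Lemma rfl_id k x : x ord0 k = 0 -> rfl k x = x.
Proof. by move=> xk; apply/rowP => j; rewrite !mxE; case: eqP => // ->; rewrite xk oppr0. Qed.

Lemma rfl_shift k x i (h : R) :
  rfl k (h *: E i + x) = h *: ((if i == k then -1 else 1 : R) *: E i) + rfl k x.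
Proof.
rewrite (addrC _ (rfl k x)) (addrC _ x) scalerA.
apply/rowP => j; rewrite rflE [RHS]shift_dirvecE rflE shift_dirvecE.
by have [->|ji] := eqVneq j i => /=; case: (_ == k); ring.
Qed.

Definition par U k (s : R) u := forall x, U x -> u (rfl k x) = s * u x.

Lemma par_pd U k s u i : open U -> (forall x, U x -> U (rfl k x)) -> s * s = 1 ->
  (forall x, U x -> derivable u x (E i)) -> par U k s u ->
  par U k ((if i == k then -1 else 1) * s) (pd i u).
Proof.
move=> oU Uk ss du Hu x Ux; set e := if i == k then _ else _.
apply: D_val.
have H1 z : U z -> s * u (rfl k z) = u z.
  by move=> Uz; rewrite Hu // mulrA ss mul1r.
apply: (eq_open_is_derive U _ _ _ _ _ oU (Uk _ Ux) H1).
rewrite (_ : (fun _ => _) = s *: (u \o rfl k)); last exact/funext.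
rewrite (mulrC e) -mulrA -[s * _]/(s *: _); apply: is_deriveZ.
apply: (@is_derive_affine _ _ _ _ u (rfl k) _ _ (e *: E i)); first by move=> h; exact: rfl_shift.
by apply: is_deriveZv; rewrite rflK; apply: is_derive_D; exact: du.
Qed.

Lemma par_odd_eq0 U k u x : par U k (-1) u -> U x -> x ord0 k = 0 -> u x = 0.
Proof.
move=> Hu Ux xk; have := Hu x Ux; rewrite rfl_id // mulN1r => /eqP.
by rewrite -subr_eq0 opprK -mulr2n mulrn_eq0 => /eqP.
Qed.

Lemma par_quo_self U b g : par U b (-1) g -> par U b 1 (quo b g).
Proof.
move=> Hg x Ux; rewrite mul1r; have [xb|xb] := eqVneq (x ord0 b) 0; first by rewrite rfl_id.
by rewrite /quo !mxE eqxx oppr_eq0 (negbTE xb) Hg // mulN1r invrN mulrNN.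
Qed.

(** The parity of [pd b g] is a separate hypothesis because it is the value of the quotient on the
    hyperplane. *)
Lemma par_quo U b k s g : k != b -> par U k s g -> par U k s (pd b g) -> par U k s (quo b g).
Proof.
move=> kb Hg Hdg x Ux; rewrite /quo rflE [b == k]eq_sym (negbTE kb); case: eqP => _; first exact: Hdg.
by rewrite Hg // mulrA.
Qed.

End Reflections.

Section Towers.
Context {R : realType} {m : nat}.
Implicit Types (x y z p : 'rV[R]_m) (f g u q : 'rV[R]_m -> R) (i j b k : 'I_m) (V U : set 'rV[R]_m).
Implicit Types (a : nat -> 'rV[R]_m -> R).
Local Notation E i := (@dirvec R m i).

(* The functions ((1 / x_b) d/dx_b)^n (a 0), extended analytically across x_b = 0. *)
Definition tower U b a :=
  (forall n, An U (a n)) /\ forall n x, U x -> x ord0 b * a n.+1 x = pd b (a n) x.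

Definition tw b u n := iter n (fun v => quo b (pd b v)) u.

Lemma An_pd U i u : An U u -> An U (pd i u).
Proof. by move=> H p Up; apply: An_at_pd; exact: H. Qed.

Lemma An_derivable U u x i : An U u -> U x -> derivable u x (E i).
Proof. by move=> H Ux; exact: (An_at_derivable u _ [::] i (H _ Ux)). Qed.

Lemma An_continuous U u x : An U u -> U x -> {for x, continuous u}.
Proof. by move=> H Ux; exact: (An_at_continuous u _ [::] (H _ Ux)). Qed.

Lemma An_comm U u i j x : An U u -> U x -> pd i (pd j u) x = pd j (pd i u) x.
Proof. by move=> H Ux; exact: An_at_pd_comm (H _ Ux). Qed.

Lemma par_pd_even U b u : open U -> (forall x, U x -> U (rfl b x)) -> An U u ->
  par U b 1 u -> par U b (-1) (pd b u).
Proof.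
move=> oU Ub Au Pu; rewrite -[-1]mulr1; have := par_pd U b 1 u b oU Ub (mulr1 1).
by rewrite eqxx; apply=> // x Ux; exact: An_derivable Au Ux.
Qed.

(** An even function has an odd derivative, which vanishes on x_b = 0; hence the quotient is
    analytic there and even again, and the construction repeats. *)
Lemma tw_even U b u : open U -> (forall x, U x -> U (rfl b x)) -> An U u -> par U b 1 u ->
  forall n, An U (tw b u n) /\ par U b 1 (tw b u n).
Proof.
move=> oU Ub Au Pu; elim=> [//|n [An1 Pn]].
have Podd : par U b (-1) (pd b (tw b u n)) by exact: par_pd_even.
split; last exact: par_quo_self.
apply: An_quo => //; first exact: An_pd.
by move=> x Ux; exact: par_odd_eq0 Podd Ux.
Qed.

Lemma tw_tower U b u : open U -> (forall x, U x -> U (rfl b x)) -> An U u -> par U b 1 u ->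
  tower U b (tw b u).
Proof.
move=> oU Ub Au Pu; split=> n; first by have [] := tw_even U b u oU Ub Au Pu n.
move=> x Ux; have [An1 Pn] := tw_even U b u oU Ub Au Pu n.
by apply: (mul_quo U) => // y Uy; apply: (par_odd_eq0 U) => //; exact: par_pd_even.
Qed.

Lemma tw_par U b u k (s : R) : open U -> (forall x, U x -> U (rfl b x)) ->
  (forall x, U x -> U (rfl k x)) -> An U u -> par U b 1 u -> k != b -> s * s = 1 ->
  par U k s u -> forall n, par U k s (tw b u n).
Proof.
move=> oU Ub Uk Au Pu kb ss Pk; elim=> [//|n IH].
have [An1 Pn] := tw_even U b u oU Ub Au Pu n.
have kb' : (b == k) = false by rewrite eq_sym; exact: negbTE.
have P1 : par U k s (pd b (tw b u n)).
  have := par_pd U k s (tw b u n) b oU Uk ss; rewrite kb' mul1r; apply => //.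
  by move=> x Ux; exact: An_derivable An1 Ux.
apply: par_quo => //.
have := par_pd U k s (pd b (tw b u n)) b oU Uk ss; rewrite kb' mul1r; apply => //.
by move=> x Ux; exact: An_derivable (An_pd _ b _ An1) Ux.
Qed.

(** Off the hyperplane the coordinate cancels; on it the value is a limit of values at shifts along
    [E b]. This lets identities be divided by x_b. *)
Lemma cancel_coord U b f : open U -> (forall x, U x -> {for x, continuous f}) ->
  (forall x, U x -> x ord0 b * f x = 0) -> forall x, U x -> f x = 0.
Proof.
move=> oU cf H x Ux; have [xb|xb] := eqVneq (x ord0 b) 0; last first.
  by apply/eqP; have /eqP := H x Ux; rewrite mulf_eq0 (negbTE xb).
apply/eqP; rewrite -normr_le0; apply/ler_addgt0Pr => e e0; rewrite add0r.
have [r r0 Hr] := (continuousP_norm _ _ _).1 (cf x Ux) _ e0.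
have [r' r'0 Hr'] := (openP_norm _ _).1 oU _ Ux.
have [h [h0 hr hr']] := pos_lt_both _ _ r0 r'0.
have hx : `|x + h *: E b - x| <= h.
  by rewrite addrC addKr; apply: (le_trans (norm_dirvec_le _ _)); rewrite gtr0_norm.
have := Hr _ (le_lt_trans hx hr).
have := H _ (Hr' _ (le_lt_trans hx hr')); rewrite shift_dirvecE eqxx mulr1 xb add0r.
by move=> /eqP; rewrite mulf_eq0 gt_eqF //= => /eqP ->; rewrite sub0r normrN.
Qed.

Lemma pd_mulcoord i b u x : derivable u x (E i) ->
  is_derive x (E i) (fun y => y ord0 b * u y) ((b == i)%:R * u x + x ord0 b * pd i u x).
Proof.
move=> du; rewrite addrC; apply: is_derive_mul; [exact: is_derive_coord | exact: is_derive_D].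
Qed.

Lemma pd2_mulcoord U i b u v x : open U -> An U u -> i != b -> U x ->
  (forall y, U y -> y ord0 b * u y = v y) -> pd i (pd i v) x = x ord0 b * pd i (pd i u) x.
Proof.
move=> oU Au ib Ux H; have bi : (b == i) = false by rewrite eq_sym; exact: negbTE.
have step w w' y : An U w -> (forall y, U y -> y ord0 b * w y = w' y) -> U y ->
    pd i w' y = y ord0 b * pd i w y.
  move=> Aw Hw Uy; rewrite -(eq_open_D U i _ _ y oU Uy Hw).
  have := D_val _ _ _ _ (pd_mulcoord i b w y (An_derivable _ _ _ _ Aw Uy)).
  by rewrite bi mul0r add0r.
apply: (step _ _ _ _ _ Ux); first exact: An_pd.
by move=> y Uy; rewrite (step u v).
Qed.

Lemma tower_pd2 U b a n x : open U -> tower U b a -> U x ->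
  pd b (pd b (a n)) x = a n.+1 x + x ord0 b ^+ 2 * a n.+2 x.
Proof.
move=> oU [Aa Ha] Ux; rewrite -(eq_open_D U b _ _ x oU Ux (Ha n)).
have := D_val _ _ _ _ (pd_mulcoord b b (a n.+1) x (An_derivable _ _ _ _ (Aa n.+1) Ux)).
by rewrite eqxx mul1r -Ha // => ->; ring.
Qed.

(* Laplace's equation for [a 0] (with c = 1) or for [x_b * a 0] (with c = 3), as it
   propagates along the tower. *)
Definition tower_eq U b a (c : R) n := forall x, U x ->
  \sum_(i | i != b) pd i (pd i (a n)) x + (2 * n%:R + c) * a n.+1 x + x ord0 b ^+ 2 * a n.+2 x = 0.

Lemma continuous_tower_eq U b a (c : R) n x : tower U b a -> U x ->
  {for x, continuous (fun x => \sum_(i | i != b) pd i (pd i (a n)) x +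
     (c * a n.+1 x + x ord0 b ^+ 2 * a n.+2 x))}.
Proof.
move=> [Aa _] Ux.
apply: (@continuousD _ _ _ (fun x => \sum_(i | i != b) pd i (pd i (a n)) x)).
  apply: (@cvg_big _ _ _ _ _ _ _ (nbhs x)) => [|k _]; first exact: add_continuous.
  by apply: An_continuous Ux; do 2!apply: An_pd.
apply: (@continuousD _ _ _ (fun x => c * a n.+1 x)).
  apply: (@continuousM _ _ (fun=> _)); [exact: cst_continuous | exact: An_continuous Ux].
apply: (@continuousM _ _ (fun x : 'rV[R]_m => x ord0 b ^+ 2)); last exact: An_continuous Ux.
apply: (@continuousM _ _ (fun x : 'rV[R]_m => x ord0 b)); exact: coord_continuous.
Qed.

(** Differentiate the n-th equation in x_b and divide by x_b: every a_k becomes a_(k+1), and the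
    derivative of the square of x_b adds 2 to the middle coefficient. *)
Lemma tower_eq_step U b a (c : R) n : open U -> tower U b a ->
  tower_eq U b a c n -> tower_eq U b a c n.+1.
Proof.
move=> oU [Aa Ha] Hn.
pose G (k : nat) x := \sum_(i | i != b) pd i (pd i (a k)) x + ((2 * k%:R + c) * a k.+1 x +
     x ord0 b ^+ 2 * a k.+2 x).
have G0 y : U y -> 0 = G n y by move=> Uy; rewrite /G addrA Hn.
suff H x : U x -> G n.+1 x = 0 by move=> x Ux; rewrite -[RHS](H x Ux) /G addrA.
move: x; apply: (cancel_coord U b) => // x Ux.
  exact: continuous_tower_eq (conj Aa Ha) Ux.
have H1 : is_derive x (E b) (G n) (\sum_(i | i != b) x ord0 b * pd i (pd i (a n.+1)) x +
   ((2 * n%:R + c) * (x ord0 b * a n.+2 x) +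
    (x ord0 b ^+ 2 * (x ord0 b * a n.+3 x) + (2%:R * x ord0 b) * a n.+2 x))).
  apply: is_deriveD; last apply: is_deriveD.
  - apply: is_derive_bigsum => i ib.
    rewrite -(pd2_mulcoord U i b (a n.+1) (pd b (a n))) //; last by move=> y Uy; rewrite Ha.
    have -> : pd i (pd i (pd b (a n))) x = pd b (pd i (pd i (a n))) x.
      rewrite (eq_open_D U i _ (pd b (pd i (a n))) x oU Ux); last first.
        by move=> y Uy; exact: An_comm (Aa n) Uy.
      by apply: An_comm Ux; exact: An_pd.
    by apply: is_derive_D; apply: An_derivable Ux; do 2!apply: An_pd.
  - rewrite Ha // (_ : (fun _ => _) = (2 * n%:R + c) *: a n.+1); last exact/funext.
    by apply: is_deriveZ; apply: is_derive_D; exact: An_derivable Ux.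
  - apply: is_derive_mul.
      have := is_derive_expr _ _ _ _ 2 (is_derive_coord x b b).
      by rewrite eqxx mulr1 expr1.
    by rewrite Ha //; apply: is_derive_D; exact: An_derivable Ux.
have := D_val _ _ _ _ H1; rewrite -(eq_open_D U b _ _ x oU Ux G0) pd_cst => H2.
rewrite [RHS]H2 /G mulrDr mulr_sumr; congr (_ + _).
by rewrite -natr1; ring.
Qed.

Lemma tower_eqE U b a (c : R) : open U -> tower U b a -> tower_eq U b a c 0 ->
  forall n, tower_eq U b a c n.
Proof. by move=> oU ta H0; elim=> // n; exact: tower_eq_step. Qed.

Lemma tower_eq_even U b a : open U -> tower U b a ->
  (forall x, U x -> \sum_i pd i (pd i (a 0%N)) x = 0) -> tower_eq U b a 1 0.
Proof.
move=> oU ta H x Ux; rewrite -[RHS](H x Ux) [RHS](bigD1 b) //= (tower_pd2 U b a) //.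
by rewrite mulr0 add0r mul1r -addrA addrC.
Qed.

(** Here 3 is 1 + 2: the second derivative of x_b a_0 takes a_1 from one derivative and twice x_b
    a_1 from the square in a_0 + x_b^2 a_1. A factor x_b is then cancelled from the whole
    equation. *)
Lemma tower_eq_odd U b a O : open U -> tower U b a ->
  (forall x, U x -> x ord0 b * a 0%N x = O x) ->
  (forall x, U x -> \sum_i pd i (pd i O) x = 0) -> tower_eq U b a 3 0.
Proof.
move=> oU ta HO H; have [Aa Ha] := ta.
pose G x := \sum_(i | i != b) pd i (pd i (a 0%N)) x + (3 * a 1%N x + x ord0 b ^+ 2 * a 2%N x).
suff G0 x : U x -> G x = 0.
  by move=> x Ux; rewrite -[RHS](G0 x Ux) /G mulr0 add0r addrA.
move: x; apply: (cancel_coord U b) => // x Ux.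
  exact: continuous_tower_eq ta Ux.
have H1 y : U y -> a 0%N y + y ord0 b ^+ 2 * a 1%N y = pd b O y.
  move=> Uy; rewrite -(eq_open_D U b _ _ y oU Uy HO).
  have := D_val _ _ _ _ (pd_mulcoord b b (a 0%N) y (An_derivable _ _ _ _ (Aa 0%N) Uy)).
  by rewrite eqxx mul1r -Ha // => ->; ring.
have H2 : pd b (pd b O) x = x ord0 b * (3 * a 1%N x + x ord0 b ^+ 2 * a 2%N x).
  rewrite -(eq_open_D U b _ _ x oU Ux H1); apply: D_val.
  have -> : x ord0 b * (3 * a 1%N x + x ord0 b ^+ 2 * a 2%N x) = pd b (a 0%N) x +
     (x ord0 b ^+ 2 * pd b (a 1%N) x + (2%:R * x ord0 b) * a 1%N x) by rewrite -!Ha //; ring.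
  apply: is_deriveD; first by apply: is_derive_D; exact: An_derivable Ux.
  apply: is_derive_mul; last by apply: is_derive_D; exact: An_derivable Ux.
  have := is_derive_expr _ _ _ _ 2 (is_derive_coord x b b).
  by rewrite eqxx mulr1 expr1.
rewrite -[RHS](H x Ux) (bigD1 b) //= H2 /G mulrDr addrC; congr (_ + _).
rewrite mulr_sumr; apply: eq_bigr => i ib.
by rewrite -(pd2_mulcoord U i b (a 0%N) O).
Qed.

End Towers.

(** * The numbers b_(n,l), signed coefficients of the reverse Bessel polynomials *)

Section BesselNumbers.
Context {R : realType}.

Let fact_pos n : 0 < n`!%:R :> R. Proof. by rewrite ltr0n fact_gt0. Qed.

(** The comparison of coefficients when (1 / x) d/dx acts on a sum of b_(n,l) x^-(2n+1-l) times l-th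
    derivatives: one term raises the derivative, the other differentiates the power. *)
Lemma bnum_rec n l : (l < n)%N ->
  bnum R n.+1 l.+1 = bnum R n l - (2 * n + 1 - l.+1)%:R * bnum R n l.+1.
Proof.
move=> ln; have [k nE] : exists k, n = (l.+1 + k)%N by exists (n - l.+1)%N; lia.
rewrite /bnum.
have -> : (n.+1 + l.+1 = (n + l).+2)%N by lia.
have -> : (n.+1 - l.+1 = k.+1)%N by lia.
have -> : (n - l = k.+1)%N by lia.
have -> : (n - l.+1 = k)%N by lia.
have -> : (n + l.+1 = (n + l).+1)%N by lia.
have -> : (2 * n.+1 - l.+1 = (2 * n - l.+1).+2)%N by lia.
have -> : (2 * n - l = (2 * n - l.+1).+1)%N by lia.
have -> : (2 * n + 1 - l.+1 = (2 * n - l.+1).+1)%N by lia.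
have kE : ((2 * n - l.+1)%:R : R) = l%:R + 2 * k%:R + 1.
  have -> : (2 * n - l.+1 = l + 2 * k + 1)%N by lia.
  by rewrite (natrD _ (l + 2 * k)) (natrD _ l) natrM.
have S1 j : (j.+1%:R : R) = j%:R + 1 by rewrite natr1.
rewrite !factS !natrM !exprS (S1 (2 * n - l.+1).+1) (S1 (2 * n - l.+1)%N) (S1 l) (S1 k) kE.
have l1 : l%:R + 1 != 0 :> R by rewrite natr1 pnatr_eq0.
have k1 : k%:R + 1 != 0 :> R by rewrite natr1 pnatr_eq0.
have t1 : 2 ^+ k != 0 :> R by rewrite expf_neq0.
move: (lt0r_neq0 (fact_pos l)) (lt0r_neq0 (fact_pos k)) t1 l1 k1.
move: (l`!%:R) (k`!%:R) (2 ^+ k) ((-1) ^+ (n + l)) ((2 * n - l.+1)`!%:R) (l%:R) (k%:R).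
by move=> fl fk tk s F L K fl0 fk0 tk0 L1 K1; field; rewrite fl0 fk0 tk0 L1 K1.
Qed.

Lemma bnum_rec0 n : bnum R n.+1 0 = - ((2 * n + 1)%:R * bnum R n 0).
Proof.
rewrite /bnum !addn0 !subn0 fact0 !mul1r (_ : (2 * n.+1 = (2 * n).+2)%N); last by lia.
have S1 j : (j.+1%:R : R) = j%:R + 1 by rewrite natr1.
rewrite !factS !natrM !exprS (S1 (2 * n).+1) (S1 (2 * n)%N) (S1 n) (natrD _ (2 * n)) natrM.
have n1 : n%:R + 1 != 0 :> R by rewrite natr1 pnatr_eq0.
have t1 : 2 ^+ n != 0 :> R by rewrite expf_neq0.
move: (lt0r_neq0 (fact_pos n)) t1 n1.
move: (n`!%:R) (2 ^+ n) ((-1) ^+ n) ((2 * n)`!%:R) (n%:R).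
by move=> f t s F N f0 t0 N1; field; rewrite f0 t0 N1.
Qed.

Lemma bnum_diag n : bnum R n n = 1.
Proof.
rewrite /bnum subnn expr0 fact0 mulr1 addnn -mul2n exprM sqrrN expr1n expr1n divr1 mul1r.
by rewrite (_ : (2 * n - n = n)%N) ?divff ?lt0r_neq0 //; lia.
Qed.

Section Formula.
Context {m : nat}.
Implicit Types (x y z p : 'rV[R]_m) (u O : 'rV[R]_m -> R) (b : 'I_m) (U : set 'rV[R]_m).
Local Notation E i := (@dirvec R m i).

Lemma An_iter U b u l : An U u -> An U (iter l (pd b) u).
Proof. by move=> Au; elim: l => //= l; exact: An_pd. Qed.

Lemma open_coord_neq0 U b : open U -> open [set x | U x /\ x ord0 b != 0].
Proof.
move=> /openP_norm oU; apply/openP_norm => x /= [Ux xb]; have [r r0 Hr] := oU _ Ux.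
exists (Num.min r `|x ord0 b|); first by rewrite lt_min r0 normr_gt0.
move=> y; rewrite lt_min => /andP[/Hr Uy yb]; split => //; apply/eqP => yb0.
have := le_lt_trans (coord_le_norm _ b) yb; rewrite mxE [X in _ + X]mxE yb0 sub0r normrN.
by rewrite ltxx.
Qed.

(** The exponent is 2 n + 1 - l because the tower starts at O / x_b. Multiplying by x_b gives the
    formula for subsets containing 1; taking for O a first derivative gives the shifted one. *)
Lemma tower_formula U b a O : open U -> tower U b a -> An U O ->
  (forall x, U x -> x ord0 b * a 0%N x = O x) ->
  forall n x, U x -> x ord0 b != 0 ->
    a n x = \sum_(l < n.+1) bnum R n l / x ord0 b ^+ (2 * n + 1 - l) * iter l (pd b) O x.
Proof.
move=> oU [Aa Ha] AO HO; have oU' := open_coord_neq0 U b oU.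
elim=> [x Ux xb|n IH x Ux xb].
  by rewrite big_ord1 /= (bnum_diag 0) div1r -HO // mulKf.
apply: (mulfI xb); rewrite Ha //.
have E1 y : U y /\ y ord0 b != 0 -> \sum_(l < n.+1) bnum R n l *
    ((y ord0 b ^+ (2 * n + 1 - l))^-1 * iter l (pd b) O y) = a n y.
  by move=> [Uy yb]; rewrite IH //; apply: eq_bigr => l _; rewrite mulrA.
rewrite -(eq_open_D _ b _ _ x oU' (conj Ux xb) E1).
set d := fun l => iter l (pd b) O x.
pose y := (x ord0 b)^-1.
have H1 : is_derive x (E b) (fun y => \sum_(l < n.+1) bnum R n l *
    ((y ord0 b ^+ (2 * n + 1 - l))^-1 * iter l (pd b) O y))
    (\sum_(l < n.+1) bnum R n l * (y ^+ (2 * n + 1 - l) * d l.+1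
        - (2 * n + 1 - l)%:R * y ^+ (2 * n + 2 - l) * d l)).
  apply: is_derive_bigsum => l _.
  have H2 := is_derive_coord_invX x b b (2 * n + 1 - l) xb.
  have H3 : is_derive x (E b) (iter l (pd b) O) (d l.+1).
    by apply: is_derive_D; apply: An_derivable Ux; exact: An_iter.
  rewrite (_ : (fun _ => _) = bnum R n l *: (fun y : 'rV[R]_m => (y ord0 b ^+ (2 * n + 1 - l))^-1 * iter l (pd b) O y)); last exact/funext.
  apply: is_deriveZ; have := is_derive_mul _ _ _ _ _ _ H2 H3; congr is_derive.
  rewrite eqxx mulr1 /y -!exprVn /d.
  have -> : (2 * n + 2 - l = (2 * n + 1 - l).+1)%N by have := ltn_ord l; lia.
  by ring.
rewrite (D_val _ _ _ _ H1).
have -> : x ord0 b * (\sum_(l < n.+2) bnum R n.+1 l / x ord0 b ^+ (2 * n.+1 + 1 - l) * d l) =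
  \sum_(l < n.+2) bnum R n.+1 l * (y ^+ (2 * n + 2 - l) * d l).
  rewrite mulr_sumr; apply: eq_bigr => l _; rewrite /y exprVn.
  have -> : (2 * n.+1 + 1 - l = (2 * n + 2 - l).+1)%N by have := ltn_ord l; lia.
  by rewrite exprS; field; rewrite xb expf_neq0.
rewrite (eq_bigr (fun l : 'I_n.+1 => bnum R n l * y ^+ (2 * n + 1 - l) * d l.+1 +
   - ((2 * n + 1 - l)%:R * bnum R n l) * y ^+ (2 * n + 2 - l) * d l)); last by move=> l _; ring.
(* The extreme indices 0 and n + 1 each receive a single contribution and are split off; the
   remaining ones are matched by [bnum_rec]. *)
rewrite big_split /= [X in _ + X = _]big_ord_recl [X in X + _ = _]big_ord_recr /=.
rewrite [RHS]big_ord_recl [X in _ = _ + X]big_ord_recr /= !bnum_diag !subn0 bnum_rec0.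
rewrite (eq_bigr (fun l : 'I_n => bnum R n l * y ^+ (2 * n + 1 - l) * d l.+1 +
   - ((2 * n + 1 - l.+1)%:R * bnum R n l.+1) * y ^+ (2 * n + 2 - l.+1) * d l.+1) (P := xpredT)
   (F1 := fun l : 'I_n => bnum R n.+1 (bump 0 l) * (y ^+ (2 * n + 2 - bump 0 l) * d (bump 0 l)))); last first.
  move=> l _; rewrite /bump leq0n add1n bnum_rec //.
  have -> : (2 * n + 2 - l.+1 = 2 * n + 1 - l)%N by have := ltn_ord l; lia.
  by ring.
rewrite big_split /= /bump /=.
have -> : (2 * n + 2 - (1 + n) = 2 * n + 1 - n)%N by lia.
rewrite add1n.
have -> : \sum_(i < n) - ((2 * n + 1 - (1 + i))%:R * bnum R n (1 + i)) * y ^+ (2 * n + 2 - (1 + i)) * d (1 + i)%N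
  = \sum_(i < n) - ((2 * n + 1 - i.+1)%:R * bnum R n i.+1) * y ^+ (2 * n + 2 - i.+1) * d i.+1 by [].
by ring.
Qed.

End Formula.
End BesselNumbers.

(** * The radial substitution *)

Section Coordinates.
Context {R : realType} {m : nat}.

Lemma rcoord_ord (q : 'rV[R]_m) (i : 'I_m) : rcoord m q i = q ord0 i.
Proof. by rewrite /rcoord (big_pred1 i) // => j; rewrite /= (inj_eq val_inj). Qed.

Lemma rcoordE (q : 'rV[R]_m) k (km : (k < m)%N) : rcoord m q k = q ord0 (Ordinal km).
Proof. by rewrite -rcoord_ord. Qed.

Lemma rcoord_shift (q : 'rV[R]_m) (i : 'I_m) (h : R) k :
  rcoord m (q + h *: dirvec m i) k = rcoord m q k + h * (k == i)%:R.
Proof.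
have [km|km] := ltnP k m.
  by rewrite !(rcoordE _ _ km) shift_dirvecE.
have ne (j : 'I_m) : (val j == k) = false by apply: ltn_eqF; exact: leq_trans (ltn_ord j) km.
by rewrite /rcoord !big_pred0 // eq_sym ne mulr0 addr0.
Qed.

End Coordinates.

Section Radial.
Context {R : realType}.
Variables (t : nat -> nat) (tau : nat).
Hypothesis t01 : (t 0 < t 1)%N.
Local Notation d0 := (t 0%N).+1.
Local Notation d1 := (t 1%N).+1.
Local Notation m := (d0 + tau.+1)%N.
Local Notation M := (d1 + tau)%N.
Local Notation toD := (@toD R t tau.+1).
Implicit Types (q : 'rV[R]_M) (p : 'rV[R]_m) (i k : 'I_M).
Local Notation E i := (@dirvec R m i).
Local Notation EE i := (@dirvec R M i).

Let b_lt : (d0 < m)%N. Proof. by rewrite -addSnnS leq_addr. Qed.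
Definition bidx : 'I_m := Ordinal b_lt.
Local Notation b := bidx.

(* [toD] collapses the coordinates in [midx] to their Euclidean norm, which becomes
   coordinate [b]; [dnx] and [upx] match the remaining ones. *)
Definition midx (k : nat) := (d0 <= k < d1)%N.
Definition dnx (k : nat) := (if k < d0 then k else k - d1 + d0.+1)%N.
Definition upx (k : nat) := (if k < d0 then k else k - d0 - 1 + d1)%N.

Lemma dnx_lt (k : 'I_M) : ~~ midx k -> (dnx k < m)%N.
Proof. by have := ltn_ord k; rewrite /midx /dnx; case: ifP => ?; lia. Qed.

Lemma upx_lt (j : 'I_m) : j != b -> (upx j < M)%N.
Proof.
move=> jb; have jb' : (j : nat) <> d0 by move=> e; case/eqP: jb; apply: val_inj.
by have := ltn_ord j; rewrite /upx; case: ifP => ?; lia.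
Qed.

(** The default in [insubd] only makes the map total: the value has a meaning off the middle block
    alone, where it is inverse to [up]. *)
Definition dn (k : 'I_M) : 'I_m := insubd b (dnx k).
Lemma dnE k : ~~ midx k -> val (dn k) = dnx k.
Proof. by move=> mk; rewrite /dn val_insubd dnx_lt. Qed.

Lemma dn_neq_b k : ~~ midx k -> dn k != b.
Proof.
move=> mk; apply/eqP => /(congr1 val); rewrite dnE //= /dnx; move: mk; rewrite /midx.
by case: ifP => ?; lia.
Qed.

Lemma M_gt0 : (0 < M)%N. Proof. by []. Qed.
Definition up (j : 'I_m) : 'I_M := insubd (Ordinal M_gt0) (upx j).
Lemma upE j : j != b -> val (up j) = upx j.
Proof. by move=> jb; rewrite /up val_insubd upx_lt. Qed.

Lemma up_not_mid j : j != b -> ~~ midx (up j).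
Proof.
move=> jb; rewrite -[nat_of_ord _]/(val _) upE // /midx /upx.
have jb' : (j : nat) <> d0 by move=> e; case/eqP: jb; apply: val_inj.
by case: ifP => ?; lia.
Qed.

Lemma upK j : j != b -> dn (up j) = j.
Proof.
move=> jb; apply: val_inj; rewrite dnE ?up_not_mid // -[nat_of_ord (up j)]/(val _) upE //.
have jb' : (j : nat) <> d0 by move=> e; case/eqP: jb; apply: val_inj.
by rewrite /= /dnx /upx; case: (ltnP j d0) => ?; case: ifP => ?; lia.
Qed.

Lemma dnK k : ~~ midx k -> up (dn k) = k.
Proof.
move=> mk; apply: val_inj; rewrite upE ?dn_neq_b // -[nat_of_ord (dn k)]/(val _) dnE //.
by move: mk; rewrite /= /dnx /upx /midx; case: (ltnP k d0) => ?; case: ifP => ?; lia.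
Qed.

Definition rho2 q : R := \sum_(d0 <= s < d1) rcoord M q s ^+ 2.
Definition rho q : R := Num.sqrt (rho2 q).

Lemma rho2_ge0 q : 0 <= rho2 q.
Proof. by apply: sumr_ge0 => s _; exact: sqr_ge0. Qed.

Lemma sqr_rho q : rho q ^+ 2 = rho2 q.
Proof. by rewrite sqr_sqrtr // rho2_ge0. Qed.

Lemma toD_b q : toD q ord0 b = rho q.
Proof. by rewrite mxE /= ltnn eqxx. Qed.

Lemma toD_other q (j : 'I_m) : j != b -> toD q ord0 j = q ord0 (up j).
Proof.
move=> jb; rewrite mxE -(inj_eq val_inj) in jb *; rewrite (negbTE jb) -rcoord_ord.
rewrite -[nat_of_ord (up j)]/(val _) upE; last by rewrite -(inj_eq val_inj).
by rewrite /upx; case: ifP.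
Qed.

Lemma toD_out q k (h : R) : ~~ midx k -> toD (h *: EE k + q) = h *: E (dn k) + toD q.
Proof.
move=> mk; rewrite [_ + q]addrC [RHS]addrC; apply/rowP => j; rewrite shift_dirvecE.
have [->|jb] := eqVneq j b.
  rewrite !toD_b (_ : (b == dn k) = false) ?mulr0 ?addr0; last first.
    by rewrite eq_sym; exact/negbTE/dn_neq_b.
  congr Num.sqrt; apply: eq_big_nat => s sm; rewrite rcoord_shift.
  rewrite (_ : (s == k) = false) ?mulr0 ?addr0 //; apply/eqP => sk.
  by move: mk; rewrite -sk /midx sm.
rewrite !toD_other // shift_dirvecE; congr (_ + _ * _%:R); congr nat_of_bool.
by apply/eqP/eqP => [<-|->]; [rewrite upK | rewrite dnK].
Qed.

Lemma toD_mid q k (h : R) : midx k -> toD (q + h *: EE k) = toD q + (rho (q + h *: EE k) - rho q) *: E b.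
Proof.
move=> mk; apply/rowP => j; rewrite shift_dirvecE.
have [->|jb] := eqVneq j b; first by rewrite !toD_b /= mulr1; ring.
rewrite !toD_other // shift_dirvecE /= mulr0 addr0.
rewrite (_ : (up j == k) = false) ?mulr0 ?addr0 //; apply/eqP => upj.
by have := up_not_mid _ jb; rewrite upj mk.
Qed.

Lemma rho2_mid q k (h : R) : midx k ->
  rho2 (q + h *: EE k) = rho2 q + (2 * q ord0 k * h + 1 * h ^+ 2).
Proof.
move=> mk; rewrite /rho2 (bigD1_seq (val k)) ?iota_uniq ?mem_index_iota //=.
rewrite [in RHS](bigD1_seq (val k)) ?iota_uniq ?mem_index_iota //= rcoord_shift eqxx mulr1.
rewrite (eq_bigr (fun s => rcoord M q s ^+ 2)); last first.
  by move=> s /negbTE sk; rewrite rcoord_shift sk mulr0 addr0.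
by rewrite rcoord_ord; ring.
Qed.

Lemma comp_toD_out (a : 'rV[R]_m -> R) q k d : ~~ midx k ->
  is_derive (toD q) (E (dn k)) a d -> is_derive q (EE k) (a \o toD) d.
Proof. by move=> mk; apply: is_derive_affine => h; exact: toD_out. Qed.

(** The derivative of rho along a middle coordinate is q_k / rho, so the factor rho in the
    derivative of [a] cancels the singularity. This is why towers, whose derivative is x_b times the
    next member, compose smoothly with [toD]. *)
Lemma comp_toD_mid (a : 'rV[R]_m -> R) q k (c : R) : midx k ->
  is_derive (toD q) (E b) a (rho q * c) -> is_derive q (EE k) (a \o toD) (q ord0 k * c).
Proof.
move=> mk Ha; apply: is_derive_line0.
(* At rho = 0 there is no chain rule, since rho is |h| along the line. The derivative of [a] is 0
   there, and a first-order expansion in |h| with zero slope is also one in h. *)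
have [r0|r0] := eqVneq (rho q) 0.
  have r20 : rho2 q = 0 by rewrite -sqr_rho r0 expr0n.
  have qk : q ord0 k = 0.
    have : rcoord M q k ^+ 2 <= 0.
      rewrite -r20 /rho2 (bigD1_seq (val k)) ?iota_uniq ?mem_index_iota //= lerDl.
      by apply: sumr_ge0 => s _; exact: sqr_ge0.
    by rewrite rcoord_ord real_exprn_even_le0 ?num_real //= => /eqP.
  rewrite qk mul0r; move: Ha; rewrite r0 mul0r => /is_deriveP Ha.
  apply/is_deriveP => e /Ha[d dpos Hd]; exists d => // h hd.
  rewrite add0r [h *: 1]mulr1 scale0r addr0 /= toD_mid // r0 subr0.
  have -> : rho (q + h *: EE k) = `|h|.
    by rewrite /rho rho2_mid // r20 qk mulr0 mul0r !add0r mul1r sqrtr_sqr.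
  by have := Hd `|h|; rewrite normr_id !mulr0 subr0 => /(_ hd).
have rp : 0 < rho q by rewrite lt0r r0 sqrtr_ge0.
have r2p : 0 < rho2 q by rewrite -sqr_rho exprn_gt0.
have -> : (fun s : R => (a \o toD) (q + s *: EE k)) =
   (fun s : R => a (toD q + s *: E b)) \o (fun h : R => rho (q + h *: EE k) - rho q).
  by apply/funext => h /=; rewrite toD_mid.
have -> : q ord0 k * c = (rho q * c) * ((2 * rho q)^-1 * (2 * q ord0 k + 2 * 1 * 0)).
  by field.
apply: is_derive1_comp.
  rewrite scale0r addr0 subrr; apply: is_derive_line; by rewrite scale0r addr0.
rewrite -[X in is_derive _ _ _ X]subr0.
apply: (@is_deriveB _ _ _ (fun h : R => rho (q + h *: EE k)) (cst (rho q))).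
have -> : (fun h : R => rho (q + h *: EE k)) =
   Num.sqrt \o (fun h : R => rho2 q + (2 * q ord0 k * h + 1 * h ^+ 2)).
  by apply/funext => h /=; rewrite /rho rho2_mid.
apply: is_derive1_comp; last exact: is_derive_quad.
by rewrite mulr0 expr0n /= mulr0 !addr0; exact: is_derive1_sqrt.
Qed.

Lemma continuous_rho q : {for q, continuous rho}.
Proof.
apply: (@continuous_comp _ _ _ rho2 Num.sqrt); last exact: sqrt_continuous.
apply: (@cvg_big _ _ _ _ _ _ _ (nbhs q)) => [|s _]; first exact: add_continuous.
have cs : {for q, continuous (fun q => rcoord M q s)}.
  apply: (@cvg_big _ _ _ _ _ _ _ (nbhs q)) => [|j _]; first exact: add_continuous.
  exact: coord_continuous.
exact: (@continuousM _ _ (fun q => rcoord M q s)).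
Qed.

Lemma toD_near q (e : R) : 0 < e ->
  exists2 d : R, 0 < d & forall q', `|q' - q| < d -> `|toD q' - toD q| < e.
Proof.
move=> e0; have e2 : 0 < e / 2 by rewrite divr_gt0.
have [d d0 Hd] := (continuousP_norm _ _ _).1 (continuous_rho q) _ e2.
exists (Num.min d e); first by rewrite lt_min d0.
move=> q'; rewrite lt_min => /andP[qd qe]; apply: norm_rV_lt => // j.
rewrite mxE [X in _ + X]mxE; have [->|jb] := eqVneq j b.
  by rewrite !toD_b; apply: le_lt_trans (Hd _ qd) _; rewrite ltr_pdivrMr // ltr_pMr // ltrDr.
rewrite !toD_other //; have := coord_le_norm (q' - q) (up j); rewrite mxE [X in _ + X]mxE.
by move=> /le_lt_trans; apply.
Qed.

Lemma continuous_comp_toD (a : 'rV[R]_m -> R) q : {for toD q, continuous a} ->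
  {for q, continuous (a \o toD)}.
Proof.
move=> /continuousP_norm Ha; apply/continuousP_norm => e /Ha[r r0 Hr].
by have [d d0' Hd] := toD_near q r r0; exists d => // q' /Hd; exact: Hr.
Qed.

Lemma open_preimage_toD (D : set 'rV[R]_m) : open D -> open [set q | D (toD q)].
Proof.
move=> /openP_norm oD; apply/openP_norm => q /= /oD[r r0 Hr].
by have [d d0' Hd] := toD_near q r r0; exists d => // q' /Hd; exact: Hr.
Qed.

End Radial.

Section RadialClass.
Context {R : realType}.
Variables (t : nat -> nat) (tau : nat).
Hypothesis t01 : (t 0 < t 1)%N.
Local Notation d0 := (t 0%N).+1.
Local Notation d1 := (t 1%N).+1.
Local Notation m := (d0 + tau.+1)%N.
Local Notation M := (d1 + tau)%N.
Local Notation toD := (@toD R t tau.+1).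
Local Notation b := (bidx t tau).
Local Notation mid := (midx t).
Local Notation dn := (dn t tau).
Local Notation E i := (@dirvec R m i).
Local Notation EE i := (@dirvec R M i).
Variable D : set 'rV[R]_m.
Hypothesis oD : open D.
Local Notation DD := [set q : 'rV[R]_M | D (toD q)].
Implicit Types (q : 'rV[R]_M) (g : 'rV[R]_M -> R) (a : nat -> 'rV[R]_m -> R) (i k : 'I_M).

Let oDD : open DD. Proof. exact: open_preimage_toD. Qed.

Lemma tower_pd (U : set 'rV[R]_m) (c : 'I_m) a (i : 'I_m) : open U -> tower U c a -> i != c ->
  tower U c (fun n => pd i (a n)).
Proof.
move=> oU [Aa Ha] ic; split=> [n|n x Ux]; first exact: An_pd.
rewrite -(An_comm U (a n) i c x (Aa n) Ux) -(eq_open_D U i _ _ x oU Ux (Ha n)).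
have := D_val _ _ _ _ (pd_mulcoord i c (a n.+1) x (An_derivable _ _ _ _ (Aa n.+1) Ux)).
by rewrite eq_sym (negbTE ic) mul0r add0r.
Qed.

(* A class containing every function met below and closed under partial derivatives, so
   that its members are smooth although [toD] is not. *)
Inductive radial : ('rV[R]_M -> R) -> Prop :=
| radial_tower a : tower D b a -> radial (a 0%N \o toD)
| radial_coord i g : radial g -> radial (fun q => q ord0 i * g q)
| radial_lin c g g' : radial g -> radial g' -> radial (fun q => g q + c * g' q).

Lemma radial_tower_n a n : tower D b a -> radial (a n \o toD).
Proof.
move=> [Aa Ha]; have H : tower D b (fun j => a (j + n)%N).
  by split=> [k|k x Dx]; [exact: Aa | exact: Ha].
exact: radial_tower H.
Qed.

Lemma radial_continuous g q : radial g -> DD q -> {for q, continuous g}.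
Proof.
move=> Hg Dq; elim: Hg => [a [Aa _]|i g1 _ IH|c g1 g2 _ IH1 _ IH2].
- by apply: continuous_comp_toD => //; exact: (An_continuous D _ _ (Aa 0%N) Dq).
- by apply: (@continuousM _ _ (fun q : 'rV[R]_M => q ord0 i)) => //; exact: coord_continuous.
- apply: (@continuousD _ _ _ g1) => //.
  by apply: (@continuousM _ _ (fun=> c)) => //; exact: cst_continuous.
Qed.

Lemma is_derive_tower_mid a n q k : tower D b a -> DD q -> mid k ->
  is_derive q (EE k) (a n \o toD) (q ord0 k * a n.+1 (toD q)).
Proof.
move=> [Aa Ha] Dq mk; apply: comp_toD_mid => //.
by rewrite -toD_b Ha //; apply: is_derive_D; exact: (An_derivable D _ _ _ (Aa n) Dq).
Qed.

Lemma is_derive_tower_out a n q k : tower D b a -> DD q -> ~~ mid k ->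
  is_derive q (EE k) (a n \o toD) (pd (dn k) (a n) (toD q)).
Proof.
by move=> [Aa Ha] Dq mk; apply: comp_toD_out => //; apply: is_derive_D; exact: (An_derivable D _ _ _ (Aa n) Dq).
Qed.

Lemma is_derive_coord_mul q g d i k : is_derive q (EE i) g d ->
  is_derive q (EE i) (fun q => q ord0 k * g q) (q ord0 k * d + (k == i)%:R * g q).
Proof. by move=> H; apply: is_derive_mul => //; exact: is_derive_coord. Qed.

Lemma radial_derive g i : radial g -> exists g', radial g' /\
  forall q, DD q -> is_derive q (EE i) g (g' q).
Proof.
move=> Hg; elim: Hg => [a Ha|k g1 Hg1 [g1' [H1 D1]]|c g1 g2 _ [g1' [H1 D1]] _ [g2' [H2 D2]]].
- have [mi|mi] := boolP (mid i).
    exists (fun q => q ord0 i * (a 1%N \o toD) q); split.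
      by apply: (radial_coord i (a 1%N \o toD)); exact: radial_tower_n.
    by move=> q Dq; exact: is_derive_tower_mid.
  exists (pd (dn i) (a 0%N) \o toD); split.
    apply: (radial_tower_n (fun n => pd (dn i) (a n)) 0).
    by apply: tower_pd => //; exact: dn_neq_b.
  by move=> q Dq; exact: is_derive_tower_out.
- exists (fun q => q ord0 k * g1' q + (k == i)%:R * g1 q); split.
    by apply: radial_lin => //; exact: radial_coord.
  by move=> q Dq; apply: is_derive_coord_mul; exact: D1.
- exists (fun q => g1' q + c * g2' q); split; first exact: radial_lin.
  move=> q Dq; have := is_derive_lin _ _ _ _ 1 c _ _ (D1 q Dq) (D2 q Dq).
  by rewrite mul1r; congr is_derive; apply/funext => y; rewrite mul1r.
Qed.

Definition lapl g q := \sum_i pd i (pd i g) q.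

Lemma sum_mid (f : 'I_M -> R) (h : nat -> R) : (forall i : 'I_M, mid i -> f i = h i) ->
  \sum_(i : 'I_M | mid i) f i = \sum_(d0 <= s < d1) h s.
Proof.
move=> fh; rewrite (eq_bigr (fun i : 'I_M => h i)) //.
rewrite -(big_mkord (fun s => mid s) h).
rewrite (@big_cat_nat _ _ _ d1) //=; last exact: leq_addr.
rewrite [X in _ + X]big_nat_cond [X in _ + X]big_pred0 ?addr0; last first.
  by move=> s; rewrite /midx; apply/negbTE; lia.
rewrite (@big_cat_nat _ _ _ d0) //=; last by rewrite ltnS ltnW.
rewrite [X in X + _]big_nat_cond [X in X + _]big_pred0 ?add0r; last first.
  by move=> s; rewrite /midx; apply/negbTE; lia.
by rewrite [LHS]big_nat_cond [RHS]big_nat_cond; apply: eq_bigl => s; rewrite /midx; lia.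
Qed.

(** The t_1 - t_0 middle directions contribute (t_1 - t_0) a_(n+1) + rho^2 a_(n+2); by the tower
    equation the others contribute - (2 n + c) a_(n+1) - rho^2 a_(n+2). *)
Lemma lapl_tower a (c : R) n q : tower D b a -> (forall n, tower_eq D b a c n) -> DD q ->
  lapl (a n \o toD) q = ((t 1%N)%:R - (t 0%N)%:R - c - 2 * n%:R) * a n.+1 (toD q).
Proof.
move=> Ta Teq Dq; rewrite /lapl (bigID (fun i : 'I_M => mid i)) /=.
rewrite (sum_mid _ (fun s => a n.+1 (toD q) + rcoord M q s ^+ 2 * a n.+2 (toD q))); last first.
  move=> i mi.
  have H y : DD y -> y ord0 i * (a n.+1 \o toD) y = pd i (a n \o toD) y.
    by move=> Dy; rewrite (D_val _ _ _ _ (is_derive_tower_mid a n y i Ta Dy mi)).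
  rewrite -(eq_open_D DD i _ _ q oDD Dq H); apply: D_val.
  have := is_derive_coord_mul _ _ _ i i (is_derive_tower_mid a n.+1 q i Ta Dq mi).
  by congr is_derive; rewrite eqxx rcoord_ord /=; ring.
have -> : \sum_(i < M | ~~ mid i) pd i (pd i (a n \o toD)) q =
   \sum_(j | j != b) pd j (pd j (a n)) (toD q).
  rewrite [RHS](reindex_onto dn (up t tau)) /=; last by move=> j jb; exact: upK.
  apply: eq_big => [i|i mi].
    apply/idP/andP => [mi|[dib /eqP upi]]; first by rewrite dn_neq_b // dnK.
    by rewrite -upi; exact: up_not_mid.
  have H y : DD y -> (pd (dn i) (a n) \o toD) y = pd i (a n \o toD) y.
    by move=> Dy; rewrite (D_val _ _ _ _ (is_derive_tower_out a n y i Ta Dy mi)).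
  rewrite -(eq_open_D DD i _ _ q oDD Dq H); apply: D_val.
  apply: (is_derive_tower_out (fun n => pd (dn i) (a n)) n) => //.
  by apply: tower_pd => //; exact: dn_neq_b.
have := Teq n (toD q) Dq; rewrite toD_b sqr_rho /rho2.
rewrite big_split /= -mulr_suml sumr_const_nat subSS.
have -> : a n.+1 (toD q) *+ (t 1 - t 0) = ((t 1%N)%:R - (t 0%N)%:R) * a n.+1 (toD q).
  by rewrite -natrB ?mulr_natl // ltnW.
move: (\sum_(i | i != b) _) => S; move: (\sum_(d0 <= s < d1) _) => S' HS.
by apply/eqP; rewrite -subr_eq0 -HS; apply/eqP; ring.
Qed.

(** The Leibniz cross term is twice the derivative along coordinate [k], namely 2 q_k a_(n+1). This
    added 2 makes c = 3 here yield the weight of c = 1 above. *)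
Lemma lapl_coord_tower a (c : R) n k q : tower D b a -> (forall n, tower_eq D b a c n) -> mid k -> DD q ->
  lapl (fun q => q ord0 k * a n (toD q)) q =
    ((t 1%N)%:R - (t 0%N)%:R - c + 2 - 2 * n%:R) * (q ord0 k * a n.+1 (toD q)).
Proof.
move=> Ta Teq mk Dq; pose g := a n \o toD.
have rg i := radial_derive g i (radial_tower_n a n Ta).
have dg i y : DD y -> derivable g y (EE i) by move=> Dy; have [g' [_ /(_ y Dy)[]]] := rg i.
have ddg i y : DD y -> derivable (pd i g) y (EE i).
  move=> Dy; have [g' [rg' dg']] := rg i; have [g'' [_ dg'']] := radial_derive _ i rg'.
  have H z : DD z -> g' z = pd i g z by move=> Dz; rewrite (D_val _ _ _ _ (dg' z Dz)).
  by have [] := eq_open_is_derive DD _ _ _ _ _ oDD Dy H (dg'' y Dy).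
have step i : pd i (pd i (fun q => q ord0 k * a n (toD q))) q =
   q ord0 k * pd i (pd i g) q + 2 * ((k == i)%:R * pd i g q).
  have H y : DD y -> 1 * (y ord0 k * pd i g y) + (k == i)%:R * g y =
      pd i (fun q => q ord0 k * a n (toD q)) y.
    move=> Dy; rewrite mul1r.
    by rewrite (D_val _ _ _ _ (is_derive_coord_mul _ _ _ i k (is_derive_D _ _ _ (dg i y Dy)))).
  rewrite -(eq_open_D DD i _ _ q oDD Dq H); apply: D_val.
  have := is_derive_lin _ _ _ _ 1 (k == i)%:R _ _
    (is_derive_coord_mul _ _ _ i k (is_derive_D _ _ _ (ddg i q Dq))) (is_derive_D _ _ _ (dg i q Dq)).
  by congr is_derive; ring.
rewrite /lapl (eq_bigr _ (fun i _ => step i)) big_split /= -!mulr_sumr.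
rewrite -/(lapl g q) (lapl_tower a c n) // (bigD1 k) //= eqxx mul1r big1 => [|i ik]; last first.
  by rewrite eq_sym (negbTE ik) mul0r.
by rewrite (D_val _ _ _ _ (is_derive_tower_mid a n q k Ta Dq mk)); ring.
Qed.

End RadialClass.

(** * Slice functions *)

Section AlgebraValued.
Context {R : realType} {A : falgType R}.

Lemma coordAK (x : A) : ofcoordA (coordA x) = x.
Proof.
rewrite /ofcoordA [RHS](coord_vbasis (memvf x)); apply: eq_bigr => i _.
by rewrite mxE.
Qed.

Lemma ofcoordAK (r : 'rV[R]_(@dimA R A)) : coordA (ofcoordA r) = r.
Proof.
apply/rowP => j; rewrite mxE coord_sum_free //.
exact: (basis_free (vbasisP _)).
Qed.

Lemma coordA_inj : injective (@coordA R A).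
Proof. exact: can_inj coordAK. Qed.

Lemma coordAD (x y : A) j : coordA (x + y) ord0 j = coordA x ord0 j + coordA y ord0 j.
Proof. by rewrite !mxE linearD. Qed.

Lemma coordA0 j : coordA (0 : A) ord0 j = 0.
Proof. by rewrite mxE linear0. Qed.

Lemma coordAZ (a : R) (x : A) j : coordA (a *: x) ord0 j = a * coordA x ord0 j.
Proof. by rewrite !mxE linearZ. Qed.

Lemma coordA_sum (I : Type) (r : seq I) (P : pred I) (f : I -> A) j :
  coordA (\sum_(i <- r | P i) f i) ord0 j = \sum_(i <- r | P i) coordA (f i) ord0 j.
Proof.
elim: r => [|i r IH]; first by rewrite !big_nil coordA0.
by rewrite !big_cons; case: ifP => // _; rewrite coordAD IH.
Qed.

Definition lmulc (v : A) (j k : 'I_(@dimA R A)) : R :=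
  coordA (v * (vbasis (@fullv R A))`_k) ord0 j.

Lemma coordA_mul (v x : A) j :
  coordA (v * x) ord0 j = \sum_k coordA x ord0 k * lmulc v j k.
Proof.
rewrite -{1}[x]coordAK /ofcoordA mulr_sumr coordA_sum; apply: eq_bigr => k _.
by rewrite -scalerAr coordAZ.
Qed.

Section Maps.
Context {m : nat}.
Implicit Types (x p : 'rV[R]_m) (G : 'rV[R]_m -> A) (i k : 'I_m) (D : set 'rV[R]_m).
Local Notation E i := (@dirvec R m i).

Definition cf G (j : 'I_(@dimA R A)) : 'rV[R]_m -> R := fun x => coordA (G x) ord0 j.

Lemma derivable_coordA G x v :
  derivable (fun x => coordA (G x)) x v <-> forall j, derivable (cf G j) x v.
Proof.
rewrite derivable_mxP; split=> [H j|H i j]; first exact: H.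
by rewrite (ord1 i); exact: H.
Qed.

Lemma cf_partial G i x j : (forall j, derivable (cf G j) x (E i)) ->
  cf (partial m i G) j x = pd i (cf G j) x.
Proof.
move=> /derivable_coordA H; rewrite /cf /partial ofcoordAK derive_mx // mxE pdE.
by [].
Qed.

Lemma C0onP D G : C0on m D G <-> forall p j, D p -> {for p, continuous (cf G j)}.
Proof.
split=> [H p j /H Hp|H p Dp].
  apply: (@continuous_comp _ _ _ (fun x => coordA (G x)) (fun r => r ord0 j)) => //.
  exact: coord_continuous.
apply/(@cvgrPdist_lt R _ _ (nbhs p)) => e e0.
suff [r r0 Hr] : exists2 r : R, 0 < r & forall y, `|y - p| < r -> `|coordA (G p) - coordA (G y)| < e.
  exact: (nearP_norm _ _ _ r r0 Hr).
have H1 j : exists r : R, 0 < r /\ forall y, `|y - p| < r -> `|cf G j y - cf G j p| <= e / 2.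
  have e2 : 0 < e / 2 by rewrite divr_gt0.
  by have [r r0 Hr] := (continuousP_norm _ _ _).1 (H p j Dp) _ e2; exists r.
have /choice[r Hr] := H1.
exists (\big[Num.min/1]_j r j); first by apply: lt_bigmin => // j _; have [] := Hr j.
move=> y yr; apply: norm_rV_lt => // j; rewrite mxE [X in _ + X]mxE distrC.
have [_ /(_ y)] := Hr j; rewrite /cf => Hj; apply: le_lt_trans (Hj _) _.
  apply: (lt_le_trans yr); exact: bigmin_le_cond.
by rewrite ltr_pdivrMr // ltr_pMr // ltrDr.
Qed.

Lemma eq_open_partial D G G' i x : open D -> D x -> (forall y, D y -> G y = G' y) ->
  partial m i G x = partial m i G' x.
Proof.
move=> oD Dx H; rewrite /partial; congr ofcoordA; apply: near_eq_derive.
have [r r0 Hr] := (openP_norm _ _).1 oD _ Dx.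
by apply: (nearP_norm _ _ _ r r0) => y /Hr Dy; rewrite H.
Qed.

Lemma Ckon2_harm D G : open D -> Ckon m D 2 G ->
  (forall p, D p -> \sum_(i < m) partial m i (partial m i G) p = 0) ->
  forall j, harm D (cf G j).
Proof.
move=> oD [c0 H] lap j.
have d1 i x j' : D x -> derivable (cf G j') x (E i).
  by move=> Dx; have [/(_ x Dx)/derivable_coordA] := H i.
have E1 i j' y : D y -> cf (partial m i G) j' y = pd i (cf G j') y.
  by move=> Dy; apply: cf_partial => k; exact: d1.
have d2 i k x j' : D x -> is_derive x (E k) (pd i (cf G j')) (cf (partial m k (partial m i G)) j' x).
  move=> Dx; have [_ [_ /(_ k)[/(_ x Dx)/derivable_coordA d2 _]]] := H i.
  rewrite cf_partial //.
  exact: (eq_open_is_derive D _ _ _ _ _ oD Dx (E1 i j') (is_derive_D _ _ _ (d2 j'))).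
have E2 i k y : D y -> cf (partial m k (partial m i G)) j y = pd k (pd i (cf G j)) y.
  by move=> Dy; rewrite (D_val _ _ _ _ (d2 i k y j Dy)).
move=> x Dx; split.
- by have /C0onP := c0; apply.
- move=> i; split; first exact: d1.
  have [_ [/C0onP ci _]] := H i.
  exact: (eq_open_continuous D _ _ _ oD Dx (E1 i j) (ci x j Dx)).
- move=> i k; split; first by have [] := d2 i k x j Dx.
  have [_ [_ /(_ k)[_ /C0onP ck]]] := H i.
  exact: (eq_open_continuous D _ _ _ oD Dx (E2 i k) (ck x j Dx)).
- have := congr1 (fun a => coordA a ord0 j) (lap x Dx).
  rewrite /= coordA_sum coordA0 => HH; rewrite -[RHS]HH.
  by apply: eq_bigr => i _; rewrite -E2.
Qed.

(** Smoothness from closure: a class of continuous functions stable under partial derivatives is C^n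
    for every n, by induction, with no derivative computed. *)
Lemma Ckon_class D (P : ('rV[R]_m -> R) -> Prop) : open D ->
  (forall g x, P g -> D x -> {for x, continuous g}) ->
  (forall g i, P g -> exists g', P g' /\ forall x, D x -> is_derive x (E i) g (g' x)) ->
  forall n G, (forall j, exists g, P g /\ forall x, D x -> g x = cf G j x) -> Ckon m D n G.
Proof.
move=> oD cP dP; elim=> [|n IH] G HG.
  apply/C0onP => p j Dp; have [g [Pg Eg]] := HG j.
  exact: (eq_open_continuous D g _ _ oD Dp Eg (cP g p Pg Dp)).
split.
  apply/C0onP => p j Dp; have [g [Pg Eg]] := HG j.
  exact: (eq_open_continuous D g _ _ oD Dp Eg (cP g p Pg Dp)).
move=> i.
have dG j x : D x -> derivable (cf G j) x (E i).
  move=> Dx; have [g [Pg Eg]] := HG j; have [g' [_ Hg']] := dP g i Pg.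
  by have [] := eq_open_is_derive D _ _ _ _ _ oD Dx Eg (Hg' x Dx).
split; first by move=> p Dp; apply/derivable_coordA => j; exact: dG.
apply: IH => j; have [g [Pg Eg]] := HG j; have [g' [Pg' Hg']] := dP g i Pg.
exists g'; split=> // x Dx; rewrite cf_partial; last by move=> k; exact: dG.
by rewrite -(eq_open_D D i _ _ x oD Dx Eg) (D_val _ _ _ _ (Hg' x Dx)).
Qed.

Lemma coordA_lap D (P : ('rV[R]_m -> R) -> Prop) : open D ->
  (forall g i, P g -> exists g', P g' /\ forall x, D x -> is_derive x (E i) g (g' x)) ->
  forall G, (forall j, exists g, P g /\ forall x, D x -> g x = cf G j x) ->
  forall x j, D x -> coordA (\sum_(i < m) partial m i (partial m i G) x) ord0 j =
     \sum_(i < m) pd i (pd i (cf G j)) x.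
Proof.
move=> oD dP G HG x j Dx; rewrite coordA_sum; apply: eq_bigr => i _.
have dG j0 y : D y -> derivable (cf G j0) y (E i).
  move=> Dy; have [g [Pg Eg]] := HG j0; have [g' [_ Hg']] := dP g i Pg.
  by have [] := eq_open_is_derive D _ _ _ _ _ oD Dy Eg (Hg' y Dy).
have E1 j0 y : D y -> pd i (cf G j0) y = cf (partial m i G) j0 y.
  by move=> Dy; rewrite cf_partial // => l; exact: dG.
rewrite -/(cf _ j x) cf_partial; first by rewrite (eq_open_D D i _ _ x oD Dx (E1 j)).
move=> k; have [g [Pg Eg]] := HG k; have [g' [Pg' Hg']] := dP g i Pg.
have [g'' [_ Hg'']] := dP g' i Pg'.
have E2 y : D y -> g' y = cf (partial m i G) k y.
  move=> Dy; rewrite -E1 // -(eq_open_D D i _ _ y oD Dy Eg).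
  by rewrite (D_val _ _ _ _ (Hg' y Dy)).
by have [] := eq_open_is_derive D _ _ _ _ _ oD Dx E2 (Hg'' x Dx).
Qed.

Lemma cf_iter_partial D G (b : 'I_m) l : open D -> (forall j, An D (cf G j)) -> forall j x, D x ->
  cf (iter l (partial m b) G) j x = iter l (pd b) (cf G j) x.
Proof.
move=> oD AG; elim: l => [//|l IH] j x Dx /=.
have AI j' : An D (iter l (pd b) (cf G j')).
  by elim: (l) => [|l' ?] /=; [exact: AG | exact: An_pd].
have IH' j' y : D y -> iter l (pd b) (cf G j') y = cf (iter l (partial m b) G) j' y.
  by move=> Dy; rewrite IH.
rewrite cf_partial; first by rewrite (eq_open_D D b _ _ x oD Dx (IH' j)).
move=> j'; have d1 := An_derivable D _ x b (AI j') Dx.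
by have [] := eq_open_is_derive D _ _ _ _ _ oD Dx (IH' j') (derivableP d1).
Qed.

End Maps.
End AlgebraValued.

(** * Tori, uniqueness of stem functions and existence of induced functions *)

Section Steps.
Context {R : realType} {A : falgType R}.
Variables (v : nat -> A) (N : nat).
Hypothesis vsq : forall s, (1 <= s <= N)%N -> v s * v s = -1.
Hypothesis vac : forall s r, (1 <= s <= N)%N -> (1 <= r <= N)%N -> s != r ->
  v s * v r = - (v r * v s).

Definition inspan (l k : nat) (x : A) := exists y : nat -> R, x = \sum_(l <= s < k.+1) y s *: v s.

Lemma sphere_inspan l k x : sphere v l k x -> inspan l k x.
Proof. by move=> [y [-> _]]; exists y. Qed.

Lemma anticommute_span l k l' k' x x' : (0 < l)%N -> (k < l')%N -> (k' <= N)%N ->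
  inspan l k x -> inspan l' k' x' -> x * x' = - (x' * x).
Proof.
move=> l0 kl kN [y ->] [y' ->]; rewrite mulr_suml mulr_sumr -sumrN.
apply: eq_big_nat => s sk; rewrite mulr_sumr mulr_suml -sumrN.
apply: eq_big_nat => r rk; rewrite -!scalerAl -!scalerAr !scalerA mulrC -scalerN; congr (_ *: _).
by apply: vac; lia.
Qed.

Lemma span_sqr l n (y : nat -> R) : (0 < l)%N -> (n <= N.+1)%N ->
  (\sum_(l <= s < n) y s *: v s) * (\sum_(l <= s < n) y s *: v s) =
  - (\sum_(l <= s < n) y s ^+ 2)%:A.
Proof.
move=> l0; elim: n => [_|n IH nN].
  by rewrite !big_geq // mul0r scale0r oppr0.
have [ln|nl] := leqP l n; last by rewrite !big_geq // mul0r scale0r oppr0.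
rewrite !big_nat_recr //= mulrDl !mulrDr IH; last exact: ltnW.
have n1 : (0 < n)%N by exact: leq_trans ln.
have ac : (\sum_(l <= s < n) y s *: v s) * (y n *: v n) = - (y n *: v n * \sum_(l <= s < n) y s *: v s).
  apply: (anticommute_span l n.-1 n n) => //; first by rewrite prednK.
    by exists y; rewrite prednK.
  by exists y; rewrite big_nat1.
rewrite ac -!scalerAl -!scalerAr vsq ?scalerA; last by rewrite n1.
rewrite scalerDl opprD -scalerN -[- (1 : A)]/(- 1 : A) -expr2.
by rewrite !addrA subrK [X in _ + X]scalerN.
Qed.

Lemma sphere_sqr l k x : (0 < l)%N -> (k <= N)%N -> sphere v l k x -> x * x = -1.
Proof. by move=> l0 kN [y [-> y1]]; rewrite span_sqr // y1 scale1r. Qed.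

Lemma sphereN l k x : sphere v l k x -> sphere v l k (- x).
Proof.
move=> [y [-> y1]]; exists (fun s => - y s); split.
  by rewrite -sumrN; apply: eq_bigr => s _; rewrite scaleNr.
by rewrite -y1; apply: eq_bigr => s _; rewrite sqrrN.
Qed.

Lemma sphere_basis l k : (l <= k)%N -> sphere v l k (v l).
Proof.
move=> lk; exists (fun s => (s == l)%:R); split.
  rewrite (bigD1_seq l) ?iota_uniq ?mem_index_iota ?lexx //= ?leqnn //=.
  rewrite eqxx scale1r big1 ?addr0 // => s /negbTE ->; by rewrite scale0r.
rewrite (bigD1_seq l) ?iota_uniq ?mem_index_iota ?leqnn //= eqxx expr1n.
by rewrite big1 ?addr0 // => s /negbTE ->; rewrite expr0n.
Qed.

Hypothesis vfree : free [seq v s | s <- iota 0 N.+1].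

Lemma free_coef (c : nat -> R) : \sum_(0 <= s < N.+1) c s *: v s = 0 ->
  forall s, (s <= N)%N -> c s = 0.
Proof.
move=> H s sN; have sz : size [seq v s | s <- iota 0 N.+1] = N.+1 by rewrite size_map size_iota.
have /freeP /(_ (fun i => c (val i))) : free (Tuple (introT eqP sz)) := vfree.
move=> /(_ _ (Ordinal (sN : (s < N.+1)%N))); apply.
rewrite -[RHS]H big_mkord; apply: eq_bigr => i _; congr (_ *: _).
by rewrite -[tval _]/[seq v s | s <- iota 0 N.+1] (nth_map 0%N) ?size_iota // nth_iota.
Qed.

Section OneList.
Variables (t : nat -> nat) (tau : nat).
Hypothesis tinc : forall h, (h < tau)%N -> (t h < t h.+1)%N.
Hypothesis ttau : t tau = N.
Local Notation m := ((t 0%N).+1 + tau)%N.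
Implicit Types (p : 'rV[R]_m) (J : nat -> A) (K : {set 'I_tau}) (F : {set 'I_tau} -> 'rV[R]_m -> A).

Lemma t_mono h h' : (h <= h' <= tau)%N -> (t h <= t h')%N.
Proof.
move=> /andP[hh ht]; elim: h' hh ht => [|h' IH] hh ht; first by move: hh; rewrite leqn0 => /eqP ->.
move: hh; rewrite leq_eqVlt => /orP[/eqP -> //|hh].
by apply: leq_trans (ltnW (tinc _ ht)); apply: IH => //; exact: ltnW.
Qed.

Lemma t_leN h : (h <= tau)%N -> (t h <= N)%N.
Proof. by move=> ht; rewrite -ttau t_mono // ht leqnn. Qed.

Lemma torus_sqr J h : torus v t tau J -> (h < tau)%N -> J h * J h = -1.
Proof. by move=> HJ ht; apply: sphere_sqr (HJ h ht) => //; exact: t_leN. Qed.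

Lemma torus_ex : exists J, torus v t tau J.
Proof. by exists (fun h => v (t h).+1) => h ht; apply: sphere_basis; exact: tinc. Qed.

Lemma JK_left_inv J K : torus v t tau J -> exists B, B * JK tau J K = 1.
Proof.
move=> HJ; rewrite /JK; apply: (big_ind (fun x => exists B, B * x = 1)).
- by exists 1; rewrite mulr1.
- move=> x y [B Bx] [C Cy]; exists (C * B).
  by rewrite -mulrA (mulrA B) Bx mul1r.
- by move=> h _; exists (- J h); rewrite mulNr (torus_sqr J) // opprK.
Qed.

Lemma JK_scale (a : nat -> R) J K :
  JK tau (fun h => a h *: J h) K = (\prod_(h < tau | h \in K) a h) *: JK tau J K.
Proof. by rewrite /JK scaler_prod. Qed.

Definition negat (k : nat) (h : nat) : R := if h == k then -1 else 1.

Lemma torus_negat J k : torus v t tau J -> torus v t tau (fun h => negat k h *: J h).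
Proof.
move=> HJ h ht; rewrite /negat; case: eqP => _; rewrite ?scaleN1r ?scale1r; last exact: HJ.
by apply: sphereN; exact: HJ.
Qed.

Lemma JK_negat J K (k : 'I_tau) :
  JK tau (fun h => negat k h *: J h) K = (if k \in K then -1 else 1) *: JK tau J K.
Proof.
rewrite JK_scale; congr (_ *: _); case: ifP => kK.
  rewrite (bigD1 k) //= /negat eqxx big1 ?mulr1 // => h /andP[_ hk].
  by rewrite (inj_eq val_inj) (negbTE hk).
apply: big1 => h hK; rewrite /negat; case: eqP => // /val_inj hk.
by move: kK; rewrite -hk hK.
Qed.

(* Replacing J_k by its opposite separates the subsets containing k from the others. *)
Lemma JK_inj (G : {set 'I_tau} -> A) :
  (forall J, torus v t tau J -> \sum_K JK tau J K * G K = 0) -> forall K, G K = 0.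
Proof.
move=> H K0.
(* The sum over the subsets agreeing with [K0] below k vanishes, by induction on k: the signs of J_k
   give S + S' = 0 and - S + S' = 0. At k = tau only [K0] remains, and J_K0 has a left inverse. *)
pose agree k K := [forall h : 'I_tau, (h < k)%N ==> ((h \in K) == (h \in K0))].
have C k : (k <= tau)%N -> forall J, torus v t tau J -> \sum_(K | agree k K) JK tau J K * G K = 0.
  elim: k => [_ J HJ|k IH kt J HJ].
    rewrite -[RHS](H J HJ); apply: eq_bigl => K.
    by apply/forallP => h; rewrite ltn0.
  pose k' : 'I_tau := Ordinal kt.
  have agS K : agree k.+1 K = agree k K && ((k' \in K) == (k' \in K0)).
    apply/forallP/andP => [Hk|[/forallP Hk kk] h].
      split; last by have := Hk k'; rewrite /= ltnSn.
      by apply/forallP => h; apply/implyP => hk; have := Hk h; rewrite ltnS ltnW.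
    apply/implyP; rewrite ltnS leq_eqVlt => /orP[/eqP hk|hk].
      by have -> : h = k' by exact: val_inj.
    by have := Hk h; rewrite hk.
  have S1 := IH (ltnW kt) J HJ.
  have := IH (ltnW kt) _ (torus_negat J k HJ).
  rewrite (bigID (fun K => k' \in K)) /= in S1; rewrite (bigID (fun K => k' \in K)) /=.
  have -> : \sum_(K | agree k K && (k' \in K)) JK tau (fun h => negat k h *: J h) K * G K =
     - \sum_(K | agree k K && (k' \in K)) JK tau J K * G K.
    rewrite -sumrN; apply: eq_bigr => K /andP[_ kK].
    by rewrite (JK_negat J K k') kK scaleN1r mulNr.
  have -> : \sum_(K | agree k K && (k' \notin K)) JK tau (fun h => negat k h *: J h) K * G K =
     \sum_(K | agree k K && (k' \notin K)) JK tau J K * G K.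
    by apply: eq_bigr => K /andP[_ /negbTE kK]; rewrite (JK_negat J K k') kK scale1r.
  rewrite (eq_bigl _ _ agS).
  move: S1; set S := \sum_(K | agree k K && (k' \in K)) JK tau J K * G K.
  set S' := \sum_(K | agree k K && (k' \notin K)) JK tau J K * G K.
  move=> S1 S2.
  have S'0 : S' = 0.
    apply: (@scalerI _ _ (2 : R)); first by rewrite pnatr_eq0.
    rewrite scaler0 scaler_nat mulr2n -[X in X + _](addKr S) S1 addr0.
    by rewrite S2.
  have S0 : S = 0 by move: S1; rewrite S'0 addr0.
  case: (k' \in K0).
    by rewrite -[RHS]S0; apply: eq_bigl => K; rewrite eqb_id.
  by rewrite -[RHS]S'0; apply: eq_bigl => K; rewrite eqbF_neg.
have [J HJ] := torus_ex; have [B HB] := JK_left_inv J K0 HJ.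
have := C tau (leqnn _) J HJ; rewrite (big_pred1 K0).
  by move=> /(congr1 ( *%R B)); rewrite mulrA HB mul1r mulr0.
move=> K; apply/forallP/eqP => [HK|-> h]; last by rewrite eqxx implybT.
by apply/setP => h; have := HK h; rewrite ltn_ord => /eqP.
Qed.

Lemma induces_inj (D : set 'rV[R]_m) F F' f f' :
  induces v t tau D F f -> induces v t tau D F' f' ->
  (forall x, Omega v t tau D x -> f x = f' x) -> forall K p, D p -> F K p = F' K p.
Proof.
move=> HF HF' ff K p Dp; apply/eqP; rewrite -subr_eq0; apply/eqP.
move: K; apply: (JK_inj (fun K => F K p - F' K p)) => J HJ.
under eq_bigr do rewrite mulrBr.
rewrite sumrB -HF // -HF' // ff ?subrr //.
by exists p, J.
Qed.

Lemma sum_subrange (V : nmodType) (f : nat -> V) l k n : (k <= n)%N ->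
  \sum_(0 <= s < n) (if (l <= s < k)%N then f s else 0) = \sum_(l <= s < k) f s.
Proof.
move=> kn; rewrite -big_mkcond (big_nat_widen _ _ _ _ _ kn) (big_nat_widenl _ _ _ _ _ (leq0n l)).
by apply: eq_bigl => s; rewrite andbC.
Qed.

(** The coordinate of a point along v_s. The blocks are disjoint, so at most one of the terms is
    nonzero. *)
Definition pt_coef p (y : nat -> nat -> R) (s : nat) : R :=
  (if (0 <= s < (t 0).+1)%N then rcoord m p s else 0) +
  \sum_(h < tau) (if ((t h).+1 <= s < (t h.+1).+1)%N then betaof t tau p h * y h s else 0).

Lemma pt_expand p J (y : nat -> nat -> R) :
  (forall h, (h < tau)%N -> J h = \sum_((t h).+1 <= s < (t h.+1).+1) y h s *: v s) ->
  pt v t tau p J = \sum_(0 <= s < N.+1) pt_coef p y s *: v s.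
Proof.
move=> HJ; under eq_bigr do rewrite scalerDl scaler_suml.
rewrite big_split exchange_big /=; congr (_ + _).
  rewrite /alphaof -(big_mkord xpredT (fun s => rcoord m p s *: v s)).
  rewrite -(sum_subrange _ (fun s => rcoord m p s *: v s) _ _ N.+1) ?ltnS ?t_leN //.
  by apply: eq_bigr => s _ /=; case: ifP; rewrite ?scale0r.
apply: eq_bigr => h _; rewrite HJ // scaler_sumr.
rewrite -(sum_subrange _ (fun s => betaof t tau p h *: (y h s *: v s)) _ _ N.+1) ?ltnS ?t_leN //.
by apply: eq_bigr => s _; case: ifP; rewrite ?scale0r ?scalerA.
Qed.

Lemma pt_coef_alpha p y s : (s <= t 0)%N -> pt_coef p y s = rcoord m p s.
Proof.
move=> s0; rewrite /pt_coef ltnS s0 /= big1 ?addr0 // => h _; rewrite ifF //.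
have := t_mono 0 h; rewrite leq0n ltnW //= => /(_ isT) ?; apply/negbTE; lia.
Qed.

Lemma pt_coef_block p y s (h : 'I_tau) : ((t h).+1 <= s < (t h.+1).+1)%N ->
  pt_coef p y s = betaof t tau p h * y h s.
Proof.
move=> sh; rewrite /pt_coef ifF ?add0r; last first.
  have := t_mono 0 h; rewrite leq0n ltnW //= => /(_ isT) ?; apply/negbTE; lia.
rewrite (bigD1 h) //= sh big1 ?addr0 // => h' hh'; rewrite ifF //; apply/negbTE.
have nn : (h' : nat) <> h by move=> e; case/eqP: hh'; exact: val_inj.
have [lt|gt|//] := ltngtP h' h.
  by have := t_mono h'.+1 h; rewrite lt ltnW //= => /(_ isT) ?; lia.
by have := t_mono h.+1 h'; rewrite gt ltnW //= => /(_ isT) ?; lia.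
Qed.

(** Compare coordinates in the free family block by block; summing their squares over a block, where
    J_h has norm 1, gives the squares of beta_h. *)
Lemma pt_eq p p' J J' : torus v t tau J -> torus v t tau J' -> pt v t tau p J = pt v t tau p' J' ->
  (forall s, (s <= t 0)%N -> rcoord m p s = rcoord m p' s) /\
  forall h, (h < tau)%N -> betaof t tau p h *: J h = betaof t tau p' h *: J' h /\
     betaof t tau p h ^+ 2 = betaof t tau p' h ^+ 2.
Proof.
have ch J0 : torus v t tau J0 -> exists y : nat -> nat -> R, forall h, (h < tau)%N ->
    J0 h = \sum_((t h).+1 <= s < (t h.+1).+1) y h s *: v s /\
    \sum_((t h).+1 <= s < (t h.+1).+1) y h s ^+ 2 = 1.
  move=> HJ; have H h : exists y : nat -> R, (h < tau)%N ->
      J0 h = \sum_((t h).+1 <= s < (t h.+1).+1) y s *: v s /\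
      \sum_((t h).+1 <= s < (t h.+1).+1) y s ^+ 2 = 1.
    have [ht|ht] := ltnP h tau; last by exists (fun=> 0).
    by have [y Hy] := HJ h ht; exists y.
  by have /choice[y Hy] := H; exists y.
move=> /ch[y Hy] /ch[y' Hy'] E0.
have ceq s : (s <= N)%N -> pt_coef p y s = pt_coef p' y' s.
  move=> sN; apply/eqP; rewrite -subr_eq0; apply/eqP.
  apply: (free_coef (fun s => pt_coef p y s - pt_coef p' y' s)) sN.
  under eq_bigr do rewrite scalerBl.
  rewrite sumrB -(pt_expand p J) => [|h /Hy[]//]; rewrite -(pt_expand p' J') => [|h /Hy'[]//].
  by rewrite E0 subrr.
split=> [s s0|h ht].
  by rewrite -(pt_coef_alpha p y) // -(pt_coef_alpha p' y') // ceq // (leq_trans s0) // t_leN.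
have [Jh y1] := Hy h ht; have [J'h y1'] := Hy' h ht.
have bl s : ((t h).+1 <= s < (t h.+1).+1)%N ->
    betaof t tau p h * y h s = betaof t tau p' h * y' h s.
  move=> sh; rewrite -(pt_coef_block p y s (Ordinal ht) sh) -(pt_coef_block p' y' s (Ordinal ht) sh).
  by apply: ceq; have := t_leN h.+1 ht; lia.
split.
  rewrite Jh J'h !scaler_sumr; apply: eq_big_nat => s sh.
  by rewrite !scalerA bl.
rewrite -[LHS]mulr1 -y1 -[RHS]mulr1 -y1' !mulr_sumr; apply: eq_big_nat => s sh.
by rewrite -!exprMn bl.
Qed.

Definition stem_val F p J : A := \sum_K JK tau J K * F K p.

Lemma JK_eq J J' K : (forall h : 'I_tau, h \in K -> J h = J' h) -> JK tau J K = JK tau J' K.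
Proof. by move=> H; apply: eq_bigr => h; exact: H. Qed.

Lemma flipE h p (j : 'I_m) :
  flip t tau h p ord0 j = if val j == ((t 0%N).+1 + h)%N then - p ord0 j else p ord0 j.
Proof. by rewrite mxE. Qed.

(* A point determines alpha and every beta_h J_h, hence (beta_h, J_h) up to sign: pass from
   (p, J) to (p', J') one component at a time. *)
Lemma stem_val_wd (D : set 'rV[R]_m) F p p' J J' : reflection_invariant t tau D ->
  is_stem t tau D F -> D p -> D p' -> torus v t tau J -> torus v t tau J' ->
  pt v t tau p J = pt v t tau p' J' -> stem_val F p J = stem_val F p' J'.
Proof.
move=> rD sF Dp Dp' HJ HJ' E0; have [al be] := pt_eq p p' J J' HJ HJ' E0.
(* Hybrids of the two representations, with the first k components already replaced. They lie in [D]
   because each replacement is trivial or a reflection. *)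
pose pk k : 'rV[R]_m := \row_j (if (j < (t 0).+1 + k)%N then p' ord0 j else p ord0 j).
pose Jk k h := if (h < k)%N then J' h else J h.
have pk0 : pk 0%N = p.
  apply/rowP => j; rewrite mxE addn0; case: ifP => // jt.
  by rewrite -!rcoord_ord -al.
have pkt : pk tau = p' by apply/rowP => j; rewrite mxE ltn_ord.
have H k : (k <= tau)%N -> D (pk k) /\ stem_val F (pk k) (Jk k) = stem_val F p J.
  elim: k => [_|k IH kt]; first by rewrite pk0.
  have [Dk Ek] := IH (ltnW kt); rewrite -Ek.
  pose k' : 'I_tau := Ordinal kt.
  have jlt : ((t 0).+1 + k < m)%N by rewrite ltn_add2l.
  pose jk : 'I_m := Ordinal jlt.
  have [bJ b2] := be k kt.
  have bE q : betaof t tau q k = q ord0 jk by rewrite /betaof (rcoordE _ _ jlt).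
  have pkS j : j != jk -> pk k.+1 ord0 j = pk k ord0 j.
    move=> jj; have nn : (j : nat) <> ((t 0).+1 + k)%N by move=> e; case/eqP: jj; exact: val_inj.
    rewrite !mxE (_ : (j < (t 0).+1 + k.+1)%N = (j < (t 0).+1 + k)%N) //.
    by apply/idP/idP; lia.
  have pkSk : pk k.+1 ord0 jk = p' ord0 jk by rewrite mxE /= addnS ltnSn.
  have pkk : pk k ord0 jk = p ord0 jk by rewrite mxE /= ltnn.
  have JkS h : h != k -> Jk k.+1 h = Jk k h.
    move=> hk; rewrite /Jk ltnS leq_eqVlt (negbTE hk) //.
  have JkSk : Jk k.+1 k = J' k by rewrite /Jk ltnSn.
  have Jkk : Jk k k = J k by rewrite /Jk ltnn.
  (* When beta_k = 0 the unit vector J_k is not determined by the point, but the components with k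
     in K are odd in beta_k and vanish, while the others do not involve J_k. *)
  have [bz|bnz] := eqVneq (betaof t tau p k) 0.
    have b'z : betaof t tau p' k = 0.
      by apply/eqP; rewrite -sqrf_eq0 -b2 bz expr0n.
    have pkE : pk k.+1 = pk k.
      apply/rowP => j; have [->|jj] := eqVneq j jk; last exact: pkS.
      by rewrite pkSk pkk -!bE bz b'z.
    rewrite pkE; split=> //; apply: eq_bigr => K _; have [kK|kK] := boolP (k' \in K).
      have -> : F K (pk k) = 0; last by rewrite !mulr0.
      have fl : flip t tau k (pk k) = pk k.
        apply/rowP => j; rewrite flipE; case: eqP => // jj.
        by have -> : j = jk; [exact: val_inj | rewrite pkk -bE bz oppr0].
      have := sF K k' (pk k) Dk; rewrite kK /= fl => Fn.
      apply: (@scalerI _ _ (2 : R)); first by rewrite pnatr_eq0.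
      by rewrite scaler0 scaler_nat mulr2n {1}Fn addNr.
    congr (_ * _); apply: JK_eq => h hK; apply: JkS.
    by apply/eqP => hk; move: kK; rewrite (_ : k' = h) ?hK //; exact: val_inj.
  have /orP[/eqP b'E|/eqP b'E] : (betaof t tau p' k == betaof t tau p k) ||
       (betaof t tau p' k == - betaof t tau p k) by rewrite -eqf_sqr b2.
    have JE : J' k = J k.
      by apply: (@scalerI _ _ (betaof t tau p k)) => //; rewrite bJ b'E.
    have pkE : pk k.+1 = pk k.
      apply/rowP => j; have [->|jj] := eqVneq j jk; last exact: pkS.
      by rewrite pkSk pkk -!bE b'E.
    rewrite pkE; split=> //; apply: eq_bigr => K _; congr (_ * _); apply: JK_eq => h hK.
    by have [->|hk] := eqVneq (val h) k; [rewrite JkSk Jkk | exact: JkS].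
  have JE : J' k = - J k.
    apply: (@scalerI _ _ (betaof t tau p k)) => //.
    by rewrite scalerN bJ b'E scaleNr opprK.
  have pkE : pk k.+1 = flip t tau k (pk k).
    apply/rowP => j; rewrite flipE; have [->|jj] := eqVneq j jk.
      by rewrite eqxx pkSk pkk -!bE b'E.
    rewrite ifF ?pkS //; apply/eqP => e; case/eqP: jj; exact: val_inj.
  rewrite pkE; split; first exact: rD.
  apply: eq_bigr => K _; rewrite (sF K k') //.
  have -> : JK tau (Jk k.+1) K = JK tau (fun h => negat k h *: Jk k h) K.
    apply: JK_eq => h _; rewrite /negat; have [->|hk] := eqVneq (val h) k.
      by rewrite JkSk Jkk JE scaleN1r.
    by rewrite scale1r JkS.
  rewrite (JK_negat (Jk k) K k'); case: ifP => _; last by rewrite scale1r.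
  by rewrite scaleN1r mulrNN.
have [_] := H tau (leqnn _); rewrite pkt => <-.
by apply: eq_bigr => K _; congr (_ * _); apply: JK_eq => h _; rewrite /Jk ltn_ord.
Qed.

(** By choice, since the value depends on the point only; points outside the domain get the value
    0. *)
Lemma induced_exists (D : set 'rV[R]_m) F : reflection_invariant t tau D -> is_stem t tau D F ->
  exists f : A -> A, induces v t tau D F f.
Proof.
move=> rD sF.
have H x : exists y, forall p J, D p -> torus v t tau J -> x = pt v t tau p J -> y = stem_val F p J.
  have [[p [J [Dp [HJ ->]]]]|nx] := pselect (Omega v t tau D x).
    by exists (stem_val F p J) => p' J' Dp' HJ'; exact: (stem_val_wd D).
  by exists 0 => p J Dp HJ xE; case: nx; exists p, J.
have /choice[f Hf] := H.
by exists f => p J Dp HJ; apply: Hf.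
Qed.

End OneList.
End Steps.

Section Splitting.
Context {tau : nat}.
Implicit Types (K : {set 'I_tau.+1}) (L : {set 'I_tau}).

(* A stem index for T is a stem index for T~ together with the membership of 0. *)
Definition lft (c : bool) L : {set 'I_tau.+1} :=
  [set h | if unlift ord0 h is Some h' then h' \in L else c].
Definition rst K : {set 'I_tau} := [set h | lift ord0 h \in K].

Lemma in_lft0 c L : (ord0 \in lft c L) = c.
Proof. by rewrite inE unlift_none. Qed.

Lemma in_lftS c L h : (lift ord0 h \in lft c L) = (h \in L).
Proof. by rewrite inE liftK. Qed.

Lemma lft_rst K : lft (ord0 \in K) (rst K) = K.
Proof.
apply/setP => h; rewrite inE; case: unliftP => [h' ->|-> //].
by rewrite inE.
Qed.

Lemma rst_lft c L : rst (lft c L) = L.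
Proof. by apply/setP => h; rewrite inE in_lftS. Qed.

Lemma sum_lft (V : nmodType) (f : {set 'I_tau.+1} -> V) :
  \sum_K f K = \sum_(L : {set 'I_tau}) (f (lft false L) + f (lft true L)).
Proof.
rewrite (reindex (fun x : bool * {set 'I_tau} => lft x.1 x.2)) /=; last first.
  exists (fun K => (ord0 \in K, rst K)) => [[c L] _|K _] /=; last exact: lft_rst.
  by rewrite in_lft0 rst_lft.
rewrite -(pair_big xpredT xpredT (fun c L => f (lft c L))) /= exchange_big /=.
by apply: eq_bigr => L _; rewrite big_bool addrC.
Qed.

Lemma prod_lft (S : pzRingType) (g : nat -> S) c L :
  \prod_(h < tau.+1 | h \in lft c L) g h =
  (if c then g 0%N else 1) * \prod_(h < tau | h \in L) g h.+1.
Proof.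
rewrite big_mkcond big_ord_recl /= in_lft0 [in RHS]big_mkcond /=; congr (_ * _).
by apply: eq_bigr => h _; rewrite in_lftS.
Qed.

End Splitting.

(** * Passage to the enlarged mirror *)

Section Tilde.
Context {R : realType} {A : falgType R}.
Variables (v : nat -> A) (N : nat).
Hypothesis vac : forall s r, (1 <= s <= N)%N -> (1 <= r <= N)%N -> s != r ->
  v s * v r = - (v r * v s).
Variables (t : nat -> nat) (tau : nat).
Hypothesis tinc : forall h, (h < tau.+1)%N -> (t h < t h.+1)%N.
Hypothesis ttau : t tau.+1 = N.
Local Notation d0 := (t 0%N).+1.
Local Notation d1 := (t 1%N).+1.
Local Notation m := (d0 + tau.+1)%N.
Local Notation M := (d1 + tau)%N.
Local Notation toD := (@toD R t tau.+1).
Local Notation rho := (@rho R t tau).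
Implicit Types (q : 'rV[R]_M) (p : 'rV[R]_m) (K : {set 'I_tau.+1}) (L : {set 'I_tau}) (J : nat -> A).

(* The sign picked up when x^1 moves past J_L. *)
Definition sgK L : R := \prod_(h < tau | h \in L) -1.
Definition xone q : A := \sum_(d0 <= s < d1) rcoord M q s *: v s.
Definition Jcons (x : A) J : nat -> A := fun h => if h is h'.+1 then J h' else x.

Lemma anticomm_prod (x : A) J (r : seq 'I_tau) (P : pred 'I_tau) :
  (forall h : 'I_tau, x * J h = - (J h * x)) ->
  x * \prod_(h <- r | P h) J h = (\prod_(h <- r | P h) (-1 : R)) *: (\prod_(h <- r | P h) J h * x).
Proof.
move=> H; elim: r => [|h r IH]; first by rewrite !big_nil mulr1 mul1r scale1r.
rewrite !big_cons; case: ifP => // _.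
by rewrite mulrA H mulNr -[J h * x * _]mulrA IH -scalerAr -scaleN1r scalerA mulrA.
Qed.

Lemma JK_Jcons x J c L : JK tau.+1 (Jcons x J) (lft c L) = (if c then x else 1) * JK tau J L.
Proof. by rewrite /JK prod_lft. Qed.

Lemma torus_Jcons x J : sphere v d0 (t 1) x -> torus v (ttilde t) tau J ->
  torus v t tau.+1 (Jcons x J).
Proof. by move=> Hx HJ [|h] ht //=; exact: HJ. Qed.

Lemma torus_anticomm x J (h : 'I_tau) : sphere v d0 (t 1) x -> torus v (ttilde t) tau J ->
  x * J h = - (J h * x).
Proof.
move=> Hx HJ; have := anticommute_span v N vac d0 (t 1) (ttilde t h).+1 (ttilde t h.+1) x (J h); apply => //.
- by rewrite /ttilde ltnS; apply: (t_mono t tau.+1 tinc); rewrite /= ltnW // ltnS.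
- by rewrite /ttilde; apply: (t_leN N t tau.+1 tinc ttau); exact: ltn_ord.
- exact: sphere_inspan.
- exact/sphere_inspan/HJ.
Qed.

(** Here r x = X plays beta_1 J_1 = x^1. Moving it to the right past J_L, at the price of the sign
    [sgK L], makes it part of the coefficient, which is the component at L of a stem function for
    the enlarged mirror. *)
Lemma tilde_sum (Phi : {set 'I_tau.+1} -> A) x J (r : R) X :
  sphere v d0 (t 1) x -> torus v (ttilde t) tau J -> r *: x = X ->
  \sum_K JK tau.+1 (Jcons x J) K * (if ord0 \in K then r *: Phi K else Phi K) =
  \sum_(L : {set 'I_tau}) JK tau J L * (Phi (lft false L) + sgK L *: (X * Phi (lft true L))).
Proof.
move=> Hx HJ rx; rewrite sum_lft; apply: eq_bigr => L _.
rewrite !in_lft0 !JK_Jcons mul1r mulrDr; congr (_ + _).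
rewrite anticomm_prod; last by move=> h; exact: torus_anticomm.
by rewrite -rx -/(sgK L) -!scalerAl -!scalerAr mulrA.
Qed.

(** If x^1 = 0 the direction is arbitrary, and a basis vector serves. *)
Lemma unit_direction q : exists2 x, sphere v d0 (t 1) x & rho q *: x = xone q.
Proof.
have [r0|r0] := eqVneq (rho q) 0.
  exists (v d0); first by apply: sphere_basis; exact: tinc.
  have H s : (d0 <= s < d1)%N -> rcoord M q s = 0.
    move=> sd; have : rcoord M q s ^+ 2 <= 0.
      have <- : rho2 t tau q = 0 by rewrite -sqr_rho r0 expr0n.
      rewrite /rho2 (bigD1_seq s) ?iota_uniq ?mem_index_iota //= lerDl.
      by apply: sumr_ge0 => s' _; exact: sqr_ge0.
    by rewrite real_exprn_even_le0 ?num_real //= => /eqP.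
  rewrite r0 scale0r /xone big_nat_cond big1 // => s /andP[sd _].
  by rewrite H // scale0r.
exists ((rho q)^-1 *: xone q); last by rewrite scalerA divff // scale1r.
exists (fun s => (rho q)^-1 * rcoord M q s); split.
  by rewrite /xone scaler_sumr; apply: eq_bigr => s _; rewrite scalerA.
under eq_bigr do rewrite exprMn.
by rewrite -mulr_sumr -/(rho2 t tau q) -sqr_rho exprVn mulVf // expf_neq0.
Qed.

Lemma pt_toD q x J : rho q *: x = xone q ->
  pt v t tau.+1 (toD q) (Jcons x J) = pt v (ttilde t) tau q J.
Proof.
move=> rx; rewrite /pt big_ord_recl /=.
have t01 : (t 0 < t 1)%N by exact: tinc.
have -> : betaof t tau.+1 (toD q) 0 = rho q.
  rewrite /betaof addn0 -(toD_b t tau q) -rcoord_ord //.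
rewrite rx addrA; congr (_ + _).
  rewrite /alphaof -(big_mkord xpredT (fun s => rcoord m (toD q) s *: v s)).
  rewrite -[RHS](big_mkord xpredT (fun s => rcoord M q s *: v s)).
  rewrite [RHS](@big_cat_nat _ _ _ d0) //=; last by rewrite ltnS ltnW.
  congr (_ + _); apply: eq_big_nat => s /andP[_ sd].
  have sm : (s < m)%N by apply: leq_trans sd _; rewrite leq_addr.
  by rewrite (rcoordE _ _ sm) mxE /= sd.
apply: eq_bigr => h _; congr (_ *: _); rewrite /betaof.
have hm : (d0 + bump 0 h < m)%N by rewrite ltn_add2l /bump /= add1n ltnS.
rewrite (rcoordE _ _ hm) mxE /= /bump /= add1n ifF; last by apply/negbTE; lia.
by rewrite ifF; [congr rcoord | apply/negbTE]; rewrite /ttilde; lia.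
Qed.

Lemma Omega_tilde (D : set 'rV[R]_m) x : Omega v (ttilde t) tau [set q | D (toD q)] x ->
  Omega v t tau.+1 D x.
Proof.
move=> [q [J [Dq [HJ ->]]]]; have [y Hy rx] := unit_direction q.
exists (toD q), (Jcons y J); split=> //; split; first exact: torus_Jcons.
by rewrite pt_toD.
Qed.

(** Take x^1 = beta_1 J_1. As [toD] returns |beta_1|, it recovers [p] or its reflection according to
    the sign of beta_1; reflection invariance of [D] covers the second case. *)
Lemma Omega_untilde (D : set 'rV[R]_m) x : reflection_invariant t tau.+1 D ->
  Omega v t tau.+1 D x -> Omega v (ttilde t) tau [set q | D (toD q)] x.
Proof.
move=> rD [p [J [Dp [HJ ->]]]].
have [y [J0 y1]] := HJ 0%N isT.
have t01 : (t 0 < t 1)%N by exact: tinc.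
pose be := betaof t tau.+1 p 0.
pose q : 'rV[R]_M := \row_k (if (k < d0)%N then rcoord m p k
   else if (k < d1)%N then be * y k else rcoord m p (k - d1 + d0.+1)).
have rq s : (d0 <= s < d1)%N -> rcoord M q s = be * y s.
  move=> /andP[sd0 sd1]; have sM : (s < M)%N by apply: leq_trans sd1 _; rewrite leq_addr.
  by rewrite (rcoordE _ _ sM) mxE /= ltnNge sd0 sd1.
have xq : xone q = be *: J 0%N.
  rewrite /xone J0 scaler_sumr; apply: eq_big_nat => s sd.
  by rewrite rq // scalerA.
have rhoq : rho q = `|be|.
  rewrite /rho /rho2 (eq_big_nat _ _ (F2 := fun s => be ^+ 2 * y s ^+ 2)).
    by rewrite -mulr_sumr y1 mulr1 sqrtr_sqr.
  by move=> s sd; rewrite rq // exprMn.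
have toDq : toD q = if 0 <= be then p else flip t tau.+1 0 p.
  apply/rowP => j; have [jb|jb] := eqVneq j (bidx t tau).
    rewrite jb toD_b rhoq; have -> : be = p ord0 (bidx t tau).
      by rewrite /be /betaof addn0 -rcoord_ord.
    case: ifP => [/ger0_norm //|/negbT]; rewrite -ltNge => /ltr0_norm ->.
    by rewrite flipE /= addn0 eqxx.
  have jb' : (j : nat) <> d0 by move=> e; case/eqP: jb; apply: val_inj.
  rewrite toD_other // -rcoord_ord -[nat_of_ord (up _ _ _)]/(val _) upE //.
  have -> : (if 0 <= be then p else flip t tau.+1 0 p) ord0 j = p ord0 j.
    by case: ifP => // _; rewrite flipE addn0 ifF //; exact/eqP.
  rewrite (rcoordE _ _ (upx_lt t tau t01 j jb)) mxE /= -rcoord_ord /upx.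
  have := ltn_ord j; case: (ltnP j d0) => jd0 jm; first by rewrite jd0.
  rewrite ifF; last by apply/negbTE; lia.
  by rewrite ifF; [congr rcoord | apply/negbTE]; lia.
exists q, (fun h => J h.+1); split.
  by rewrite /= toDq; case: ifP => // _; exact: rD.
split; first by move=> h ht; exact: HJ.
rewrite /pt [in LHS]big_ord_recl addrA; congr (_ + _).
  rewrite /alphaof -(big_mkord xpredT (fun s => rcoord m p s *: v s)).
  rewrite -[RHS](big_mkord xpredT (fun s => rcoord M q s *: v s)).
  rewrite [RHS](@big_cat_nat _ _ _ d0) //=; last by rewrite ltnS ltnW.
  congr (_ + _); last by rewrite -/(xone q) xq.
  apply: eq_big_nat => s /andP[_ sd].
  have sM : (s < M)%N by apply: leq_trans sd _; rewrite (leq_trans (ltnW (t01 : (d0 < d1)%N))) // leq_addr.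
  by rewrite (rcoordE _ _ sM) mxE /= sd.
apply: eq_bigr => h _; congr (_ *: _); rewrite /betaof.
have hM : (d1 + h < M)%N by rewrite ltn_add2l.
rewrite -[(ttilde t 0).+1]/d1 (rcoordE _ _ hM) mxE /= ifF; last by apply/negbTE; lia.
by rewrite ifF; [congr rcoord; rewrite /bump /=; lia | apply/negbTE; lia].
Qed.

Lemma toD_flip q (h : 'I_tau) :
  toD (flip (ttilde t) tau h q) = flip t tau.+1 h.+1 (toD q).
Proof.
have t01 : (t 0 < t 1)%N by exact: tinc.
apply/rowP => j; rewrite flipE; have [jb|jb] := eqVneq j (bidx t tau).
  rewrite jb !toD_b ifF; last by apply/negbTE; rewrite /=; lia.
  congr Num.sqrt; apply: eq_big_nat => s /andP[sd0 sd1].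
  have sM : (s < M)%N by apply: leq_trans sd1 _; rewrite leq_addr.
  by rewrite !(rcoordE _ _ sM) flipE /= ifF //; apply/negbTE; rewrite /ttilde; lia.
rewrite !toD_other // flipE -[val (up _ _ _)]/(val _) upE //.
have jb' : (j : nat) <> d0 by move=> e; case/eqP: jb; apply: val_inj.
congr (if _ then _ else _); rewrite /upx /ttilde /=.
by case: ifP => ?; apply/eqP/eqP; lia.
Qed.

Lemma xone_flip q (h : 'I_tau) : xone (flip (ttilde t) tau h q) = xone q.
Proof.
apply: eq_big_nat => s /andP[sd0 sd1]; congr (_ *: _).
have sM : (s < M)%N by apply: leq_trans sd1 _; rewrite leq_addr.
by rewrite !(rcoordE _ _ sM) flipE /= ifF //; apply/negbTE; rewrite /ttilde; lia.
Qed.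

End Tilde.

Section RadialEigen.
Context {R : realType}.
Variables (t : nat -> nat) (tau : nat).
Hypothesis t01 : (t 0 < t 1)%N.
Local Notation m := ((t 0%N).+1 + tau.+1)%N.
Local Notation M := ((t 1%N).+1 + tau)%N.
Local Notation toD := (@toD R t tau.+1).
Local Notation b := (bidx t tau).
Local Notation EE i := (@dirvec R M i).
Variable D : set 'rV[R]_m.
Hypothesis oD : open D.
Local Notation DD := [set q : 'rV[R]_M | D (toD q)].
Local Notation lam n := ((t 1%N)%:R - (t 0%N)%:R - 1 - 2 * n%:R : R).

(* Sequences on which the Laplacian of the enlarged mirror acts as a weighted shift. *)
Definition lapl_shift (B : nat -> 'rV[R]_M -> R) :=
  (forall n, radial t tau D (B n)) /\
  forall n q, DD q -> lapl t tau (B n) q = lam n * B n.+1 q.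

Lemma lapl_shift_even a : tower D b a -> (forall n, tower_eq D b a 1 n) ->
  lapl_shift (fun n q => a n (toD q)).
Proof.
move=> Ta Teq; split=> n; first exact: (radial_tower_n t tau D a n Ta).
move=> q Dq; exact: (lapl_tower t tau t01 D oD a 1 n q Ta Teq Dq).
Qed.

Lemma lapl_shift_odd a k : tower D b a -> (forall n, tower_eq D b a 3 n) -> midx t (val k) ->
  lapl_shift (fun n q => q ord0 k * a n (toD q)).
Proof.
move=> Ta Teq mk; split=> n.
  by apply: (radial_coord t tau D k (a n \o toD)); exact: radial_tower_n.
move=> q Dq; rewrite (lapl_coord_tower t tau t01 D oD a 3 n k q Ta Teq mk Dq).
by ring.
Qed.

Lemma lapl_lin g g' (c : R) q : radial t tau D g -> radial t tau D g' -> DD q ->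
  lapl t tau (fun q => g q + c * g' q) q = lapl t tau g q + c * lapl t tau g' q.
Proof.
move=> rg rg' Dq; have oDD := open_preimage_toD t tau t01 D oD.
rewrite /lapl mulr_sumr -big_split /=; apply: eq_bigr => i _.
have [g1 [rg1 d1]] := radial_derive t tau t01 D oD g i rg.
have [g2 [_ d2]] := radial_derive t tau t01 D oD g1 i rg1.
have [h1 [rh1 e1]] := radial_derive t tau t01 D oD g' i rg'.
have [h2 [_ e2]] := radial_derive t tau t01 D oD h1 i rh1.
have lin1 y (u u' : 'rV[R]_M -> R) (du du' : R) : is_derive y (EE i) u du -> is_derive y (EE i) u' du' ->
    is_derive y (EE i) (fun q => u q + c * u' q) (du + c * du').
  move=> H1 H2; have := is_derive_lin _ _ _ _ 1 c _ _ H1 H2.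
  by rewrite mul1r; congr is_derive; apply/funext => z; rewrite mul1r.
have E1 y : DD y -> g1 y + c * h1 y = pd i (fun q => g q + c * g' q) y.
  by move=> Dy; rewrite (D_val _ _ _ _ (lin1 _ _ _ _ _ (d1 y Dy) (e1 y Dy))).
have E2 y : DD y -> g1 y = pd i g y by move=> Dy; rewrite (D_val _ _ _ _ (d1 y Dy)).
have E3 y : DD y -> h1 y = pd i g' y by move=> Dy; rewrite (D_val _ _ _ _ (e1 y Dy)).
rewrite -(eq_open_D DD i _ _ q oDD Dq E1) -(eq_open_D DD i _ _ q oDD Dq E2).
rewrite -(eq_open_D DD i _ _ q oDD Dq E3).
rewrite (D_val _ _ _ _ (lin1 _ _ _ _ _ (d2 q Dq) (e2 q Dq))).
by rewrite (D_val _ _ _ _ (d2 q Dq)) (D_val _ _ _ _ (e2 q Dq)).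
Qed.

Lemma lapl_shift_lin B B' (c : R) : lapl_shift B -> lapl_shift B' ->
  lapl_shift (fun n q => B n q + c * B' n q).
Proof.
move=> [r1 l1] [r2 l2]; split=> n; first exact: radial_lin.
by move=> q Dq; rewrite lapl_lin // l1 // l2 //; ring.
Qed.

Lemma lapl_shift_sum (I : Type) (r : seq I) (P : pred I) B (c : I -> R) (B' : I -> nat -> 'rV[R]_M -> R) :
  lapl_shift B -> (forall x, P x -> lapl_shift (B' x)) ->
  lapl_shift (fun n q => B n q + \sum_(x <- r | P x) c x * B' x n q).
Proof.
move=> HB HB'; elim: r => [|x r IH].
  suff -> : (fun n q => B n q + \sum_(x <- [::] | P x) c x * B' x n q) = B by [].
  by apply/funext => n; apply/funext => q; rewrite big_nil addr0.
have [Px|Px] := boolP (P x).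
  suff -> : (fun n q => B n q + \sum_(y <- x :: r | P y) c y * B' y n q) =
    (fun n q => (B n q + \sum_(y <- r | P y) c y * B' y n q) + c x * B' x n q).
    by apply: lapl_shift_lin => //; exact: HB'.
  by apply/funext => n; apply/funext => q; rewrite big_cons Px [c x * _ + _]addrC addrA.
suff -> : (fun n q => B n q + \sum_(y <- x :: r | P y) c y * B' y n q) =
  (fun n q => B n q + \sum_(y <- r | P y) c y * B' y n q) by [].
by apply/funext => n; apply/funext => q; rewrite big_cons (negbTE Px).
Qed.

End RadialEigen.

(** * Iterated Laplacians of kernel elements *)

Section Kernel.
Context {R : realType} {A : falgType R}.
Variables (v : nat -> A) (N : nat).
Hypothesis vsq : forall s, (1 <= s <= N)%N -> v s * v s = -1.
Hypothesis vac : forall s r, (1 <= s <= N)%N -> (1 <= r <= N)%N -> s != r ->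
  v s * v r = - (v r * v s).
Hypothesis vfree : free [seq v s | s <- iota 0 N.+1].
Variables (t : nat -> nat) (tau : nat).
Hypothesis tinc : forall h, (h < tau.+1)%N -> (t h < t h.+1)%N.
Hypothesis ttau : t tau.+1 = N.
Local Notation d0 := (t 0%N).+1.
Local Notation d1 := (t 1%N).+1.
Local Notation m := (d0 + tau.+1)%N.
Local Notation M := (d1 + tau)%N.
Local Notation toD := (@toD R t tau.+1).
Local Notation b := (bidx t tau).
Variable D : set 'rV[R]_m.
Hypothesis oD : open D.
Hypothesis rD : reflection_invariant t tau.+1 D.
Local Notation DD := [set q : 'rV[R]_M | D (toD q)].
Local Notation sgK := (sgK tau).
Variables (f : A -> A) (F : {set 'I_tau.+1} -> 'rV[R]_m -> A).
Hypothesis sF : stem_reg t tau.+1 (Creg 2) D F.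
Hypothesis iF : induces v t tau.+1 D F f.
Hypothesis lF : induces v t tau.+1 D (lapS t tau.+1 F) (fun _ => 0).
Implicit Types (K : {set 'I_tau.+1}) (L : {set 'I_tau}) (p : 'rV[R]_m) (q : 'rV[R]_M).
Implicit Types (j : 'I_(@dimA R A)).

Let t01 : (t 0 < t 1)%N. Proof. exact: tinc. Qed.
Let oDD : open DD. Proof. exact: open_preimage_toD. Qed.
Let tinc' h : (h < tau)%N -> (ttilde t h < ttilde t h.+1)%N.
Proof. by move=> ht; apply: tinc. Qed.
Let ttau' : ttilde t tau = N. Proof. exact: ttau. Qed.

(** The hypothesis concerns the induced function; it reaches each component because a stem function
    inducing 0 is 0. *)
Lemma stem_lap0 K p : D p -> \sum_(i < m) partial m i (partial m i (F K)) p = 0.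
Proof.
apply: (induces_inj v N vsq vac t tau.+1 tinc ttau D _ (fun _ _ => 0) _ (fun=> 0) lF) => //.
by move=> p' J _ _; rewrite big1 // => K' _; rewrite mulr0.
Qed.

Lemma harm_stem K j : harm D (cf (F K) j).
Proof.
by apply: Ckon2_harm => //; [have [_] := sF; apply | exact: stem_lap0].
Qed.

Lemma An_stem K j : An D (cf (F K) j).
Proof. by apply: harm_An => //; exact: harm_stem. Qed.

Lemma idx_lt (h : 'I_tau.+1) : (d0 + h < m)%N.
Proof. by rewrite ltn_add2l. Qed.
Definition idx (h : 'I_tau.+1) : 'I_m := Ordinal (idx_lt h).

Lemma idx0 : idx ord0 = b.
Proof. by apply: val_inj; rewrite /= addn0. Qed.

Lemma idx_inj : injective idx.
Proof. by move=> h h' /(congr1 val) /= /addnI /val_inj. Qed.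

Lemma flip_rfl (h : 'I_tau.+1) p : flip t tau.+1 h p = rfl (idx h) p.
Proof. by apply/rowP => k; rewrite !mxE. Qed.

Lemma D_rfl (h : 'I_tau.+1) p : D p -> D (rfl (idx h) p).
Proof. by move=> Dp; rewrite -flip_rfl; apply: rD. Qed.

Definition ksign K (h : 'I_tau.+1) : R := if h \in K then -1 else 1.
Lemma ksign_sqr K h : ksign K h * ksign K h = 1.
Proof. by rewrite /ksign; case: ifP => _; rewrite ?mulrNN mulr1. Qed.

Lemma coordA_ksign (G : {set 'I_tau.+1} -> 'rV[R]_m -> A) K (h : 'I_tau.+1) p j :
  is_stem t tau.+1 D G -> D p -> cf (G K) j (rfl (idx h) p) = ksign K h * cf (G K) j p.
Proof.
move=> sG Dp; rewrite /cf -flip_rfl sG // /ksign; case: ifP => _; last by rewrite mul1r.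
by rewrite -[- G K p]scaleN1r coordAZ.
Qed.

Lemma par_stem K j h : par D (idx h) (ksign K h) (cf (F K) j).
Proof. by move=> p Dp; apply: coordA_ksign => //; have [] := sF. Qed.

(* When 0 is in K the component F_K is odd in beta_1, and the tower starts at F_K / beta_1. *)
Definition base K j := if ord0 \in K then quo b (cf (F K) j) else cf (F K) j.
Definition atw K j := tw b (base K j).

Let Db x : D x -> D (rfl b x). Proof. by rewrite -idx0; exact: D_rfl. Qed.

Lemma stem_odd_eq0 K j x : ord0 \in K -> D x -> x ord0 b = 0 -> cf (F K) j x = 0.
Proof.
move=> K0; have := par_stem K j ord0; rewrite /ksign K0 idx0; exact: par_odd_eq0.
Qed.

Lemma An_base K j : An D (base K j).
Proof.
rewrite /base; case: ifP => K0; last exact: An_stem.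
by apply: An_quo => //; [exact: An_stem | move=> x; exact: stem_odd_eq0].
Qed.

Lemma par_base K j : par D b 1 (base K j).
Proof.
rewrite /base; have := par_stem K j ord0; rewrite /ksign idx0; case: ifP => // K0.
exact: par_quo_self.
Qed.

Lemma mul_base K j x : ord0 \in K -> D x -> x ord0 b * base K j x = cf (F K) j x.
Proof.
move=> K0 Dx; rewrite /base K0; apply: (mul_quo D) => // y; exact: stem_odd_eq0.
Qed.

Lemma par_base_other K j h : h != ord0 -> par D (idx h) (ksign K h) (base K j).
Proof.
move=> h0; have hb : idx h != b by rewrite -idx0 (inj_eq idx_inj).
rewrite /base; case: ifP => K0; last exact: par_stem.
apply: par_quo => //; first exact: par_stem.
have := par_pd D (idx h) (ksign K h) (cf (F K) j) b oD (D_rfl h) (ksign_sqr K h).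
rewrite eq_sym (negbTE hb) mul1r; apply; last exact: par_stem.
by move=> x Dx; exact: An_derivable (An_stem K j) Dx.
Qed.

Lemma atw_tower K j : tower D b (atw K j).
Proof. by apply: tw_tower => //; [exact: An_base | exact: par_base]. Qed.

Lemma atw_even K j n : par D b 1 (atw K j n).
Proof. by have [] := tw_even D b (base K j) oD Db (An_base K j) (par_base K j) n. Qed.

Lemma atw_par K j h n : h != ord0 -> par D (idx h) (ksign K h) (atw K j n).
Proof.
move=> h0; apply: tw_par => //.
- exact: D_rfl.
- exact: An_base.
- exact: par_base.
- by rewrite -idx0 (inj_eq idx_inj).
- exact: ksign_sqr.
- exact: par_base_other.
Qed.

Lemma atw_eq K j n : tower_eq D b (atw K j) (if ord0 \in K then 3 else 1) n.
Proof.
apply: tower_eqE => //; first exact: atw_tower.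
have lap x : D x -> \sum_i pd i (pd i (cf (F K) j)) x = 0.
  by move=> Dx; have [] := harm_stem K j x Dx.
case: ifP => K0.
  apply: (tower_eq_odd D b _ (cf (F K) j)) => //; first exact: atw_tower.
  by move=> x Dx; exact: mul_base.
by apply: tower_eq_even => //; [exact: atw_tower | rewrite /atw /= /base K0].
Qed.

Definition Fnc n K j p : R := if ord0 \in K then p ord0 b * atw K j n p else atw K j n p.
Definition Fn n K x : A := ofcoordA (\row_j Fnc n K j x).

Lemma coordA_Fn n K j x : coordA (Fn n K x) ord0 j = Fnc n K j x.
Proof. by rewrite ofcoordAK mxE. Qed.

Lemma cf_Fn n K j : cf (Fn n K) j = Fnc n K j.
Proof. by apply/funext => x; exact: coordA_Fn. Qed.

Lemma is_stem_Fn n : is_stem t tau.+1 D (Fn n).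
Proof.
move=> K h p Dp; apply: coordA_inj; apply/rowP => j.
have -> : (if h \in K then - Fn n K p else Fn n K p) = ksign K h *: Fn n K p.
  by rewrite /ksign; case: ifP; rewrite ?scaleN1r ?scale1r.
rewrite coordAZ !coordA_Fn flip_rfl /Fnc /=.
have [->|h0] := eqVneq h ord0.
  have := atw_even K j n p Dp; rewrite idx0 rflE eqxx /ksign => ->.
  by case: ifP => _; ring.
rewrite (atw_par K j h n h0 p Dp) rflE -idx0 (inj_eq idx_inj) eq_sym (negbTE h0).
by case: ifP => _; ring.
Qed.

Lemma An_Fnc n K j : An D (Fnc n K j).
Proof.
have [Aa Ha] := atw_tower K j; rewrite /Fnc; case K0: (ord0 \in K); last exact: Aa.
move=> p Dp; have [r r0 Hr] := (openP_norm _ _).1 oD _ Dp.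
(* No product rule for the class is needed: beta_1 a_0 is F_K, and beta_1 a_(n+1) is the
   beta_1-derivative of a_n. *)
case: n => [|n].
  apply: (eq_An_at (cf (F K) j) _ p r r0); last exact: An_stem.
  by move=> x /Hr Dx; rewrite mul_base.
apply: (eq_An_at (pd b (atw K j n)) _ p r r0); last exact: An_at_pd (Aa n p Dp).
by move=> x /Hr Dx; rewrite Ha.
Qed.

Lemma stem_reg_Fn n : stem_reg t tau.+1 Cw D (Fn n).
Proof.
split=> [|K p Dp j]; first exact: is_stem_Fn.
by rewrite -[fun x => _]/(cf (Fn n K) j) cf_Fn; apply: An_at_analytic; exact: An_Fnc.
Qed.

Lemma Fn0 K p : D p -> Fn 0 K p = F K p.
Proof.
move=> Dp; apply: coordA_inj; apply/rowP => j; rewrite coordA_Fn /Fnc.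
by case: ifP => K0; [rewrite mul_base | rewrite /atw /= /base K0].
Qed.

Definition aA K n x : A := ofcoordA (\row_j atw K j n x).

(* The T~-stem function of f^[n], in coordinates; see [Gn_alg]. *)
Definition Gc L j n q : R := atw (lft false L) j n (toD q) +
  \sum_(x : 'I_M * 'I_(@dimA R A) | midx t x.1) (sgK L * lmulc (v x.1) j x.2) *
      (q ord0 x.1 * atw (lft true L) x.2 n (toD q)).
Definition Gn n L q : A := ofcoordA (\row_j Gc L j n q).

Lemma coordA_Gn n L j q : coordA (Gn n L q) ord0 j = Gc L j n q.
Proof. by rewrite ofcoordAK mxE. Qed.

Lemma Gn_alg n L q :
  Gn n L q = aA (lft false L) n (toD q) + sgK L *: (xone v t tau q * aA (lft true L) n (toD q)).
Proof.
apply: coordA_inj; apply/rowP => j; rewrite coordA_Gn coordAD coordAZ.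
congr (_ + _); first by rewrite ofcoordAK mxE.
rewrite /xone mulr_suml coordA_sum mulr_sumr.
transitivity (\sum_(i < M | midx t i) \sum_k
    (sgK L * lmulc (v i) j k) * (q ord0 i * atw (lft true L) k n (toD q))).
  by rewrite pair_big_dep /=; apply: eq_bigl => x; rewrite andbT.
apply: (sum_mid t tau t01) => i mi.
rewrite -scalerAl coordAZ coordA_mul rcoord_ord mulrA mulr_sumr; apply: eq_bigr => k _.
by rewrite ofcoordAK mxE; ring.
Qed.

Lemma Gc_shift L j : lapl_shift t tau D (Gc L j).
Proof.
have := (@lapl_shift_sum _ t tau t01 D oD _ (index_enum _) (fun x : 'I_M * 'I_(@dimA R A) => midx t x.1)
  (fun n q => atw (lft false L) j n (toD q)) (fun z => sgK L * lmulc (v z.1) j z.2)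
  (fun z n q => q ord0 z.1 * atw (lft true L) z.2 n (toD q))); apply.
  apply: lapl_shift_even => //; first exact: atw_tower.
  by move=> n; have := atw_eq (lft false L) j n; rewrite in_lft0.
move=> [k i] /= mk; apply: lapl_shift_odd => //; first exact: atw_tower.
by move=> n; have := atw_eq (lft true L) i n; rewrite in_lft0.
Qed.

(** Evaluate at beta_1 = rho q along a unit direction of x^1: the odd components rho a_n then
    combine with J_1 into x^1 a_n, which no longer depends on that direction. *)
Lemma Gn_induces n fn : induces v t tau.+1 D (Fn n) fn -> induces v (ttilde t) tau DD (Gn n) fn.
Proof.
move=> Hfn q J Dq HJ; have [y Hy ry] := unit_direction v t tau tinc q.
rewrite -(pt_toD v N t tau tinc ttau q y J ry) Hfn //; last exact: torus_Jcons.
under [RHS]eq_bigr do rewrite Gn_alg.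
rewrite -(tilde_sum v N vac t tau tinc ttau (fun K => aA K n (toD q)) y J _ _ Hy HJ ry).
apply: eq_bigr => K _; congr (_ * _); apply: coordA_inj; apply/rowP => j.
rewrite coordA_Fn /Fnc toD_b; case: ifP => _; first by rewrite coordAZ ofcoordAK mxE.
by rewrite ofcoordAK mxE.
Qed.

Lemma Gn_stem n : is_stem (ttilde t) tau DD (Gn n).
Proof.
move=> L h q Dq; rewrite !Gn_alg (xone_flip v N t tau ttau) (toD_flip N t tau tinc ttau).
have Hp c : aA (lft c L) n (flip t tau.+1 h.+1 (toD q)) =
    (if h \in L then -1 else 1 : R) *: aA (lft c L) n (toD q).
  apply: coordA_inj; apply/rowP => j; rewrite coordAZ !ofcoordAK !mxE.
  have := flip_rfl (lift ord0 h) (toD q); rewrite lift0 => ->.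
  have h0 : lift ord0 h != ord0 by rewrite eq_sym neq_lift.
  by rewrite (atw_par (lft c L) j _ n h0 (toD q) Dq) /ksign in_lftS.
rewrite !Hp -scalerAr scalerA; case: ifP => _; last by rewrite !scale1r mulr1.
by rewrite !scaleN1r mulrN1 scaleNr opprD.
Qed.

Lemma cprodS n : @cprod R t n.+1 = cprod t n * ((t 1%N)%:R - (t 0%N)%:R - 1 - 2 * n%:R).
Proof.
rewrite /cprod big_nat_recr //=; congr (_ * _); rewrite natrM -natr1; ring.
Qed.

Lemma slice_lap_step n fn fn1 : induces v t tau.+1 D (Fn n) fn ->
  induces v t tau.+1 D (Fn n.+1) fn1 ->
  slice_lap v (ttilde t) tau DD (fun x => cprod t n *: fn x) (fun x => cprod t n.+1 *: fn1 x).
Proof.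
move=> Hfn Hfn1; pose c := @cprod R t n.
pose H L q : A := c *: Gn n L q.
(* The class [radial] contains sums g + c g' only, so a multiple c g is presented as g + (c - 1)
   g. *)
have rad L j : exists g, radial t tau D g /\ forall q, DD q -> g q = cf (H L) j q.
  have [rG _] := Gc_shift L j; exists (fun q => Gc L j n q + (c - 1) * Gc L j n q); split.
    by apply: radial_lin.
  by move=> q _; rewrite /cf coordAZ coordA_Gn; ring.
exists H; split; last split.
- split; first by move=> L h q Dq; rewrite /H Gn_stem //; case: ifP => _; rewrite ?scalerN.
  move=> L; apply: (Ckon_class DD (radial t tau D)) => //; first last.
  + by move=> g i; exact: radial_derive.
  + by move=> g q; exact: radial_continuous.
- move=> q J Dq HJ; rewrite (Gn_induces n fn Hfn q J Dq HJ) scaler_sumr.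
  by apply: eq_bigr => L _; rewrite scalerAr.
- move=> q J Dq HJ; rewrite (Gn_induces n.+1 fn1 Hfn1 q J Dq HJ) scaler_sumr.
  apply: eq_bigr => L _; rewrite scalerAr; congr (_ * _).
  apply: coordA_inj; apply/rowP => j; rewrite coordAZ coordA_Gn.
  rewrite /lapS (coordA_lap DD (radial t tau D)) //; last first.
    by move=> g i; exact: radial_derive.
  have [rG lG] := Gc_shift L j.
  rewrite cprodS -mulrA -lG //.
  have := lapl_lin t tau t01 D oD _ _ (c - 1) q (rG n) (rG n) Dq.
  have -> : (fun q => Gc L j n q + (c - 1) * Gc L j n q) = cf (H L) j.
    by apply/funext => y; rewrite /cf coordAZ coordA_Gn; ring.
  by rewrite /lapl -/c => ->; ring.
Qed.

Lemma lap_iter_Fn (fn : nat -> A -> A) : (forall n, induces v t tau.+1 D (Fn n) (fn n)) ->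
  forall n, lap_iter v (ttilde t) tau DD n f (fun x => cprod t n *: fn n x).
Proof.
move=> Hfn; elim=> [x Ox|n IH].
  have [p [J [Dp [HJ ->]]]] := Omega_tilde v N t tau tinc ttau D x Ox.
  rewrite /cprod big_geq // scale1r Hfn // iF //.
  by apply: eq_bigr => K _; rewrite Fn0.
by exists (fun x => cprod t n *: fn n x); split => //; exact: slice_lap_step.
Qed.

(** The intermediate functions are determined on the domain only, but this fixes their stem
    components on an open set and hence the partial derivatives there. *)
Lemma lap_iter_unique n g g' : lap_iter v (ttilde t) tau DD n f g ->
  lap_iter v (ttilde t) tau DD n f g' -> forall x, Omega v (ttilde t) tau DD x -> g x = g' x.
Proof.
elim: n g g' => [g g' Hg Hg' x Ox|n IH g g' [h [Hh [G [sG [iG lG]]]]] [h' [Hh' [G' [sG' [iG' lG']]]]]].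
  by rewrite Hg // Hg'.
have GG' : forall L q, DD q -> G L q = G' L q.
  apply: (induces_inj v N vsq vac (ttilde t) tau tinc' ttau' DD G G' h h' iG iG').
  exact: IH.
move=> x [q [J [Dq [HJ ->]]]]; rewrite (lG q J Dq HJ) (lG' q J Dq HJ).
apply: eq_bigr => L _.
apply: (congr1 (fun z => JK tau J L * z)).
apply: eq_bigr => i _.
apply: (eq_open_partial DD _ _ i q oDD Dq) => y Dy.
exact: (eq_open_partial DD _ _ i y oDD Dy (GG' L)).
Qed.

Lemma Fn_formula n K p : D p -> betaof t tau.+1 p 0 != 0 ->
  Fn n K p = if [exists h in K, val h == 0%N] then
      \sum_(l < n.+1) (bnum R n l / betaof t tau.+1 p 0 ^+ (2 * n - l)) *: dbeta1 t tau.+1 l (F K) p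
    else
      \sum_(l < n.+1) (bshift R n l / betaof t tau.+1 p 0 ^+ (2 * n - l)) *: dbeta1 t tau.+1 l (F K) p.
Proof.
move=> Dp; have -> : betaof t tau.+1 p 0 = p ord0 b by rewrite /betaof addn0 -rcoord_ord.
move=> pb.
have -> : [exists h in K, val h == 0%N] = (ord0 \in K).
  apply/existsP/idP => [[h /andP[hK /eqP h0]]|K0]; last by exists ord0; rewrite K0.
  by have <- : h = ord0 by exact: val_inj.
have cfd l j : coordA (dbeta1 t tau.+1 l (F K) p) ord0 j = iter l (pd b) (cf (F K) j) p.
  by rewrite /dbeta1 -/(cf _ j _) (cf_iter_partial D _ b) // => j'; exact: An_stem.
apply: coordA_inj; apply/rowP => j; rewrite coordA_Fn /Fnc; have Ta := atw_tower K j.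
case: ifP => K0; rewrite coordA_sum.
  have HO x : D x -> x ord0 b * atw K j 0%N x = cf (F K) j x by move=> Dx; exact: mul_base.
  rewrite (tower_formula D b _ (cf (F K) j) oD Ta (An_stem K j) HO) // mulr_sumr.
  apply: eq_bigr => l _; rewrite coordAZ cfd.
  have -> : (2 * n + 1 - l = (2 * n - l).+1)%N by have := ltn_ord l; lia.
  by rewrite exprS; field; rewrite pb expf_neq0.
have a0 : atw K j 0%N = cf (F K) j by rewrite /atw /= /base K0.
case: n => [|n].
  by rewrite a0 big_ord1 coordAZ cfd /= subn0 muln0 expr0 divr1 mul1r.
have [Aa Ha] := Ta.
(* For 1 not in K the formula is applied to the tower started at a_1, for which beta_1 a_1 is the
   derivative of F_K. Both indices shift by one, giving b_(n-1,l-1), and the term l = 0 has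
   coefficient 0. *)
have Ta' : tower D b (fun k => atw K j k.+1).
  by split=> k; [exact: Aa | exact: Ha].
have HO x : D x -> x ord0 b * atw K j 1%N x = pd b (cf (F K) j) x.
  by move=> Dx; rewrite Ha // a0.
rewrite (tower_formula D b (fun k => atw K j k.+1) _ oD Ta' (An_pd D b _ (An_stem K j)) HO) //.
rewrite [RHS]big_ord_recl coordAZ [bshift R n.+1 _]/= mul0r mul0r add0r; apply: eq_bigr => l _.
rewrite coordAZ cfd lift0 -[bshift _ _ _]/(bnum R n l) -iterSr.
by have -> : (2 * n + 1 - l = 2 * n.+1 - l.+1)%N by have := ltn_ord l; lia.
Qed.

Lemma induced_Fn : exists fn : nat -> A -> A, forall n,
  induces v t tau.+1 D (Fn n) (fn n).
Proof.
have H n := induced_exists v N vfree t tau.+1 tinc ttau D (Fn n) rD (is_stem_Fn n).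
by have /choice[fn Hfn] := H; exists fn.
Qed.

(** A nonzero product can be divided out of the iterated Laplacian, which gives uniqueness of f^[n].
    Arbitrary stem functions inducing the same functions agree with [F] and [Fn n] on the open set
    [D], so the formula transfers to them. *)
Lemma kernel_fn_statement n : @cprod R t n != 0 -> fn_statement v t tau.+1 D f n.
Proof.
move=> cn; have [fn Hfn] := induced_Fn; exists (fn n); split.
  by exists (Fn n); split; [exact: stem_reg_Fn | exact: Hfn].
split; first exact: lap_iter_Fn Hfn n.
split.
  move=> g _ Hg x Ox.
  have Ox' : Omega v (ttilde t) tau DD x by exact: (Omega_untilde v N t tau tinc ttau).
  have := lap_iter_unique n _ _ Hg (lap_iter_Fn fn Hfn n) x Ox'.
  exact: scalerI.
move=> G Gn' sG iG sGn iGn K p Dp pb.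
have GF K' y : D y -> F K' y = G K' y.
  exact: (induces_inj v N vsq vac t tau.+1 tinc ttau D F G f f iF iG).
have -> : Gn' K p = Fn n K p.
  exact: (induces_inj v N vsq vac t tau.+1 tinc ttau D Gn' (Fn n) (fn n) (fn n) iGn (Hfn n)).
rewrite (Fn_formula n K p Dp pb).
have dE l y : D y -> dbeta1 t tau.+1 l (F K) y = dbeta1 t tau.+1 l (G K) y.
  elim: l y => [|l IH] y Dy; first exact: GF.
  exact: (eq_open_partial D _ _ b y oD Dy IH).
by case: ifP => _; apply: eq_bigr => l _; rewrite dE.
Qed.

(** The function induced by [Fn n] exists for every n; only its scalar factor vanishes. *)
Lemma kernel_lap_iter_eq0 n : @cprod R t n = 0 -> lapTt_iter v t tau.+1 D f n (fun _ => 0).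
Proof.
move=> cn; have [fn Hfn] := induced_Fn; have := lap_iter_Fn fn Hfn n; rewrite cn.
by congr lap_iter; apply/funext => x; rewrite scale0r.
Qed.

End Kernel.

Lemma SA_sqr {R : realType} {A : falgType R} (conj : A -> A) (x : A) :
  SA conj x -> x * x = -1.
Proof. by move=> [/addr0_eq <-]; rewrite mulrN => <-; rewrite opprK. Qed.

Lemma cprod_factorE {R : realType} (t : nat -> nat) l : (t 0 < t 1)%N ->
  (t 1%N)%:R - (t 0%N)%:R - (2 * l)%:R + 1 = ((t 1 - t 0)%N.+1)%:R - (2 * l)%:R :> R.
Proof. by move=> t01; rewrite -natr1 natrB ?(ltnW t01) //; ring. Qed.

Lemma cprod_even_neq0 {R : realType} (t : nat -> nat) n :
  (t 0 < t 1)%N -> ~~ odd (t 1 - t 0) -> @cprod R t n != 0.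
Proof.
move=> t01 ev; rewrite /cprod prodf_seq_neq0; apply/allP => l _ /=.
rewrite cprod_factorE // subr_eq0 eqr_nat; apply/eqP => e.
by move: ev; rewrite -[odd _]negbK -oddS e oddM.
Qed.

Lemma cprod_odd_neq0 {R : realType} (t : nat -> nat) n1 n :
  (t 1 - t 0 = 2 * n1 + 1)%N -> (n <= n1)%N -> @cprod R t n != 0.
Proof.
move=> e nn; rewrite /cprod prodf_seq_neq0; apply/allP => l.
rewrite mem_index_iota /= => ln.
by rewrite cprod_factorE ?subr_eq0 ?eqr_nat; lia.
Qed.

Lemma cprod_odd_eq0 {R : realType} (t : nat -> nat) n1 n :
  (t 1 - t 0 = 2 * n1 + 1)%N -> (n1 < n)%N -> @cprod R t n = 0.
Proof.
(* The factor l = n_1 + 1 is 2 n_1 + 2 - 2 l = 0, and it occurs as soon as n > n_1. *)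
move=> e nn; rewrite /cprod (bigD1_seq n1.+1) ?iota_uniq ?mem_index_iota //=.
rewrite cprod_factorE; last by lia.
by have -> : ((t 1 - t 0).+1 = 2 * n1.+1)%N; [lia | rewrite subrr mul0r].
Qed.

Theorem theorem6p3 (R : realType) (A : falgType R) (conj : A -> A)
    (N : nat) (v : nat -> A) (tau : nat) (t : nat -> nat)
    (D : set 'rV[R]_((t 0%N).+1 + tau)) (f : A -> A) :
  (* A: real algebra with *-involution; V with basis v_0 = 1, v_1..v_N *)
  star_involution conj ->
  (1 <= N)%N ->
  v 0%N = 1 ->
  (forall s, (1 <= s <= N)%N -> SA conj (v s)) ->
  (forall s r, (1 <= s <= N)%N -> (1 <= r <= N)%N -> s != r ->
     v s * v r = - (v r * v s)) ->
  free [seq v s | s <- iota 0 N.+1] ->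
  (forall x, x \in <<[seq v s | s <- iota 0 N.+1]>>%VS ->
     exists J, SA conj J /\ exists a b : R, x = a%:A + b *: J) ->
  (* steps T = (t_0,...,t_tau), tau >= 1 *)
  (0 < tau)%N ->
  (forall h, (h < tau)%N -> (t h < t h.+1)%N) ->
  t tau = N ->
  (* the domain *)
  open D -> reflection_invariant t tau D ->
  (* f in the kernel of Delta_T on S^2_T(Omega_D, A) *)
  (exists F, stem_reg t tau (Creg 2) D F /\ induces v t tau D F f /\
             induces v t tau D (lapS t tau F) (fun _ => 0)) ->
  (* (1) t_1 - t_0 even *)
  (~~ odd (t 1%N - t 0%N) -> forall n : nat, fn_statement v t tau D f n) /\
  (* (2) t_1 - t_0 = 2 n_1 + 1 *)
  (forall n1 : nat, (t 1%N - t 0%N = 2 * n1 + 1)%N ->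
     (forall n : nat, (n1 < n)%N -> lapTt_iter v t tau D f n (fun _ => 0)) /\
     (forall n : nat, (n <= n1)%N -> fn_statement v t tau D f n)).
Proof.
move=> _ _ _ vS vac vfree _; case: tau D => [//|tau'] D _ tinc ttau oD rD [F [sF [iF lF]]].
have vsq s : (1 <= s <= N)%N -> v s * v s = -1 by move=> /vS; exact: SA_sqr.
have t01 : (t 0 < t 1)%N by exact: tinc.
have stm := kernel_fn_statement v N vsq vac vfree t tau' tinc ttau D oD rD f F sF iF lF.
split=> [ev n|n1 e]; first by apply: stm; exact: cprod_even_neq0.
split=> n nn; last by apply: stm; exact: cprod_odd_neq0 e nn.
apply: (kernel_lap_iter_eq0 v N vsq vac vfree t tau' tinc ttau D oD rD f F sF iF lF).
exact: cprod_odd_eq0 e nn.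
Qed.
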